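(* Suppose that all edges of $\Omega$ have the same thickness (normalized to $1$) and that $\Omega$ contains a reservoir type subgraph $\mathcal R_0=\Delta_0\cup E_0$ as described in the context, with $L$ the length of $E_0$ and $|\Delta_0|$ the total length of the edges of $\Delta_0$. Let $\delta\in(0,a)$, $\mu^*>0$, $\sigma>0$ be constants such that $$\frac{\mu^*}{2}(s-\delta)^2-F(s)\ge\sigma\quad\text{for all }s\in[0,1].$$ Assume that $\mu_1(\Delta_0)\ge\mu^*$ and that $$\frac1{2L}+L\,(F(1)-F(a))\le\sigma|\Delta_0|\quad\text{if } L\le\Big(\sqrt{2(F(1)-F(a))}\Big)^{-1},$$ $$\sqrt{2(F(1)-F(a))}\le\sigma|\Delta_0|\quad\text{if } L>\Big(\sqrt{2(F(1)-F(a))}\Big)^{-1}.$$ Then, for any $i\in\{1,\ldots,N\}$, the limit profile $\widehat v_i$ satisfies $$\frac1{|\Delta_0|}\int_{\Delta_0}\widehat v_i\,dx\le\delta.$$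
   Context: Metric graphs: a metric graph is a connected graph each of whose edges $E$ is identified with an interval $[0,L_E]$ (finite length $L_E>0$) or $[0,\infty)$ (infinite length); directions of edges only serve to fix coordinates. Multiple edges, loops and vertices of degree $1$ are allowed. Here all edges have thickness $1$, so integrals over a graph are sums of the usual integrals over its edges. At a vertex $V$ with incident edges $E_1,\ldots,E_m$ (a loop is counted twice), $\frac{\partial u}{\partial\nu_k}(V)$ denotes the derivative of $u$ at $V$ along $E_k$ in the direction pointing from $V$ into the interior of $E_k$; the Kirchhoff condition at $V$ is $\sum_{k=1}^m\frac{\partial u}{\partial\nu_k}(V)=0$. The graph $\Omega$: $\Omega=D\cup\Omega_1\cup\cdots\cup\Omega_N$ with $N\ge2$, where $D$ (the center graph) is a bounded finite metric graph (finitely many edges of finite length) and each outer path $\Omega_i$ is an edge of infinite length with $D\cap\Omega_i=\{\mathrm P_i\}$, $\mathrm P_i$ being a vertex of $D$ (the $\mathrm P_i$ are not necessarily distinct). The coordinate on $\Omega_i$ is $x_i\in[0,\infty)$, with $x_i=0$ at $\mathrm P_i$. Nonlinearity: $f\in C^1$ and for some $0<a<1$: $f(0)=f(a)=f(1)=0$, $f<0$ on $(0,a)$, $f>0$ on $(a,1)$, $f'(0)<0$, $f'(a)>0$, $f'(1)<0$, $\int_0^1f(s)\,ds>0$. $F(s)=\int_0^sf(r)\,dr$. Solution of $\partial_tu=\Delta_\Omega u+f(u)$ on a time interval: a function $u(t,x)$ continuous in $(t,x)$ that satisfies $\partial_tu=\partial_x^2u+f(u)$ on each edge except at endpoints, with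 $\partial_xu$ continuous on each edge up to the endpoints, and the Kirchhoff condition at every vertex. Traveling wave: $(\phi,c)$, $c>0$, is the unique pair with $\phi''+c\phi'+f(\phi)=0$ and $0<\phi<1$ on $\mathbb R$, $\phi(-\infty)=1$, $\phi(+\infty)=0$, $\phi(0)=a$. Front-like solution and limit profile: for each $i$ there is a unique entire solution $\widehat u_i$ (defined for all $t\in\mathbb R$) with $0<\widehat u_i<1$ and $\lim_{t\to-\infty}\big(\sup_{x_i\in\Omega_i}|\widehat u_i|_{\Omega_i}(t,x_i)-\phi(-x_i-ct)|+\sup_{\Omega\setminus\Omega_i}|\widehat u_i(t,\cdot)|\big)=0$; it is strictly increasing in $t$. The limit profile is $\widehat v_i(x)=\lim_{t\to\infty}\widehat u_i(t,x)$. Reservoir: $\mathcal R_0\subset D$ consists of an edge $E_0=\mathrm P_0\mathrm Q_0$ of length $L$ and a bounded finite graph $\Delta_0$ attached to $E_0$ at the vertex $\mathrm Q_0$ (so $E_0\cap\Delta_0=\{\mathrm Q_0\}$); $\mathcal R_0$ is connected to the rest of $\Omega$ only through the other vertex $\mathrm P_0$ of $E_0$, there being no other common point of $\mathcal R_0$ and the rest of $\Omega$. $\mu_1(\Delta_0)$ denotes the smallest positive eigenvalue of $-\Delta_{\Delta_0}\varphi=\mu\varphi$ on $\Delta_0$, with $\varphi$ continuous and the Kirchhoff condition (with respect to the edges of $\Delta_0$) at every vertex of $\Delta_0$. *)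

(* Defs.v *)
From HB Require Import structures.
From mathcomp Require Import all_boot all_order all_algebra.
From mathcomp Require Import all_classical all_reals all_analysis.

Set Implicit Arguments.
Unset Strict Implicit.
Unset Printing Implicit Defensive.

Import Order.TTheory GRing.Theory Num.Theory.
Import numFieldNormedType.Exports.

Local Open Scope classical_set_scope.
Local Open Scope ring_scope.

(* Combinatorial data of a graph with coordinatized edges.  The coordinate of
   an edge [e] starts at 0, at the vertex [src e]; [far e = Some (l, w)] means
   that [e] is [0, l] and that its point l is the vertex [w], and
   [far e = None] means that [e] is [0, +oo[. *)
Record graph_data (R : realType) := GraphData {
  vert : finType;
  edge : finType;
  src : edge -> vert;
  far : edge -> option (R * vert) }.

Section Graph.
Context {R : realType} {G : graph_data R}.
Implicit Types (e : edge G) (v w : vert G).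
Implicit Types (E : {set edge G}) (V : {set vert G}).

Definition adj E : rel (vert G) := fun v w =>
  [exists e in E,
     if far e is Some (_, z)
     then ((src e == v) && (z == w)) || ((src e == w) && (z == v))
     else false].

Definition connected_on V E : Prop :=
  forall v w, v \in V -> w \in V -> connect (adj E) v w.

(* 0 for an edge of infinite length, a case in which it is never used *)
Definition elen e : R := if far e is Some (l, _) then l else 0.

Definition eclosed e : set R :=
  if far e is Some (l, _) then [set x | 0 <= x <= l] else [set x | 0 <= x].

Definition einterior e : set R :=
  if far e is Some (l, _) then [set x | 0 < x < l] else [set x | 0 < x].

(* the point of coordinate [x] of [e] is the vertex [v] *)
Definition at_vertex e (x : R) v : Prop :=
  (x = 0 /\ src e = v) \/ far e = Some (x, v).

Definition incident e v : Prop := exists x, at_vertex e x v.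

(* A function on a graph is a family [u : edge G -> R -> R], where [u e] only
   matters on [eclosed e], with a single value at each vertex. *)
Definition single_valued E (u : edge G -> R -> R) : Prop :=
  forall v e1 e2 x1 x2, e1 \in E -> e2 \in E ->
    at_vertex e1 x1 v -> at_vertex e2 x2 v -> u e1 x1 = u e2 x2.

End Graph.

(* Derivative relative to a set: two-sided at interior points of an interval,
   one-sided at its endpoints. *)
Section DerivativeIn.
Context {R : realType}.
Implicit Types (A : set R) (g : R -> R) (x : R).

Definition diff_quot_in A g x : set_system R :=
  h^-1 * (g (x + h) - g x) @[h --> within [set h | A (x + h)] (0 : R)^'].

Definition derivable_in A g x : Prop := cvg (diff_quot_in A g x).

Definition derive_in A g x : R := lim (diff_quot_in A g x).

Definition C1_in A g : Prop :=
  (forall x, A x -> derivable_in A g x) /\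
  {within A, continuous (derive_in A g)}.

End DerivativeIn.

Section Analysis.
Context {R : realType}.

Record is_metric_graph (G : graph_data R) : Prop := IsMetricGraph {
  far_gt0 : forall (e : edge G) l w, far e = Some (l, w) -> 0 < l;
  graph_connected : connected_on [set: vert G] [set: edge G] }.

(* The outer paths are exactly the edges of infinite length; the center graph
   D consists of all the vertices and of the edges of finite length, and it is
   connected if and only if the whole graph is. *)
Definition outer_paths (G : graph_data R) N (outer : 'I_N -> edge G) : Prop :=
  injective outer /\ forall e, far e = None <-> exists i, e = outer i.

Section Differential.
Context {G : graph_data R}.
Implicit Types (V : {set vert G}) (E : {set edge G}) (u : edge G -> R -> R).

(* Sum of the derivatives at [v] along the edges of [E], in the directions
   leaving [v]; the two ends of a loop contribute separately. *)
Definition outgoing_sum E u (v : vert G) : R :=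
  \sum_(e in E)
    ((if src e == v then derive_in (eclosed e) (u e) 0 else 0) +
     (if far e is Some (l, w)
      then if w == v then - derive_in (eclosed e) (u e) l else 0
      else 0)).

Definition kirchhoff V E u : Prop :=
  forall v, v \in V -> outgoing_sum E u v = 0.

Record eigenfunction V E (mu : R) u : Prop := Eigenfunction {
  eigen_single : single_valued E u;
  eigen_neq0 : exists e x, [/\ e \in E, eclosed e x & u e x != 0];
  eigen_C1 : forall e, e \in E -> C1_in (eclosed e) (u e);
  eigen_eq : forall e x, e \in E -> einterior e x ->
    derivable (derive1 (u e)) x 1 /\ - derive1n 2 (u e) x = mu * u e x;
  eigen_kirchhoff : kirchhoff V E u }.

Definition eigenvalue_on V E (mu : R) : Prop :=
  exists u, eigenfunction V E mu u.

Definition smallest_positive_eigenvalue V E (mu : R) : Prop :=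
  [/\ 0 < mu, eigenvalue_on V E mu &
      forall nu, 0 < nu -> eigenvalue_on V E nu -> mu <= nu].

Definition total_length E : R := \sum_(e in E) elen e.

Definition graph_integral E u : R :=
  \sum_(e in E) \int[lebesgue_measure]_(x in eclosed e) u e x.

(* The edge E_0 is [e0], of length [L]; the graph Delta_0 has vertices [V]
   and edges [E].  Apart from [e0], no edge outside of [E] meets [V], so that
   only [p0] is shared with the rest of the graph. *)
Record reservoir (e0 : edge G) (p0 q0 : vert G) (L : R) V E : Prop :=
  Reservoir {
  res_ends : (src e0 = p0 /\ far e0 = Some (L, q0)) \/
             (src e0 = q0 /\ far e0 = Some (L, p0));
  res_e0 : e0 \notin E;
  res_q0 : q0 \in V;
  res_p0 : p0 \notin V;
  res_bounded : forall e, e \in E -> far e <> None;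
  res_subgraph : forall e v, e \in E -> incident e v -> v \in V;
  res_connected : connected_on V E;
  res_isolated : forall e v, v \in V -> incident e v -> e \in E \/ e = e0 }.

Record entire_solution (f : R -> R) (u : R -> edge G -> R -> R) : Prop :=
  EntireSolution {
  sol_single : forall t, single_valued [set: edge G] (u t);
  sol_continuous : forall e,
    {within [set: R] `*` eclosed e,
       continuous (fun p : R * R => u p.1 e p.2)};
  sol_C1 : forall t e, C1_in (eclosed e) (u t e);
  sol_eq : forall t e x, einterior e x ->
    [/\ derivable (fun s => u s e x) t 1,
        derivable (derive1 (u t e)) x 1 &
        derive1 (fun s => u s e x) t = derive1n 2 (u t e) x + f (u t e x)];
  sol_kirchhoff : forall t, kirchhoff [set: vert G] [set: edge G] (u t) }.

(* [o] is the outer path along which the front comes in. *)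
Record front_like_solution (f phi : R -> R) (c : R) (o : edge G)
    (u : R -> edge G -> R -> R) : Prop := FrontLikeSolution {
  front_solution : entire_solution f u;
  front_range : forall t e x, eclosed e x -> 0 < u t e x < 1;
  front_limit :
    (ereal_sup [set `|u t o x - phi (- x - c * t)|%:E | x in eclosed o] +
     ereal_sup [set y | exists e x,
       [/\ e != o, eclosed e x & y = `|u t e x|%:E]])%E
    @[t --> -oo] --> 0%E }.

Definition limit_profile (u : R -> edge G -> R -> R) (v : edge G -> R -> R)
    : Prop :=
  forall e x, eclosed e x -> u t e x @[t --> +oo] --> v e x.

End Differential.

Definition primitive (f : R -> R) (s : R) : R :=
  if 0 <= s then \int[lebesgue_measure]_(r in `[0, s]) f r
  else - \int[lebesgue_measure]_(r in `[s, 0]) f r.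

Record bistable (f : R -> R) (a : R) : Prop := Bistable {
  bi_derivable : forall s, derivable f s 1;
  bi_C1 : continuous (derive1 f);
  bi_a : 0 < a < 1;
  bi_zeros : [/\ f 0 = 0, f a = 0 & f 1 = 0];
  bi_neg : forall s, 0 < s < a -> f s < 0;
  bi_pos : forall s, a < s < 1 -> 0 < f s;
  bi_slopes : [/\ derive1 f 0 < 0, 0 < derive1 f a & derive1 f 1 < 0];
  bi_mass : 0 < primitive f 1 }.

Record traveling_wave (f : R -> R) (a : R) (phi : R -> R) (c : R) : Prop :=
  TravelingWave {
  wave_speed : 0 < c;
  wave_eq : forall z,
    [/\ derivable phi z 1, derivable (derive1 phi) z 1 &
        derive1n 2 phi z + c * derive1 phi z + f (phi z) = 0];
  wave_range : forall z, 0 < phi z < 1;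
  wave_left : phi z @[z --> -oo] --> (1 : R);
  wave_right : phi z @[z --> +oo] --> (0 : R);
  wave_norm : phi 0 = a }.

End Analysis.

(* Main.v *)
Require Import Defs.
From HB Require Import structures.
From mathcomp Require Import all_boot all_order all_algebra.
From mathcomp Require Import all_classical all_reals all_analysis.
From mathcomp Require Import ring lra.

(** The reservoir is a potential well for the energy of w, the integral of
    w'^2/2 - F(w).  Consider functions with values in [0, 1] on Delta_0 and on
    a piece of E_0 of length l next to Q_0, equal to 1 at the far end of that
    piece.  If the mean of w over Delta_0 is delta, then Wirtinger's inequality
    with constant mu_1(Delta_0) and the choice of sigma give at least
    sigma |Delta_0| - l F(1) as energy.  The ramp which is linear on the piece
    of E_0 and 0 on Delta_0 has mean 0 and energy less than
    1/(2l) - l F(a); taking l = min(L, (2 (F(1) - F(a)))^(-1/2)), the two cases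
    of the hypothesis on L both say that this is below the barrier.  So a
    minimiser among the functions of mean at most delta has mean less than
    delta, every small upward perturbation of it is admissible, and it is a
    stationary supersolution.  It dominates the front-like solution u, which is
    less than 1 at the end of the piece and tends to 0 on the reservoir as
    t -> -oo; hence the mean of u is at most delta at all times, and in the limit.

    The argument is carried out on meshes, where minimisation is
    finite-dimensional.  Every edge is divided into the same number of cells;
    [supersolution_of_minimizer] produces the discrete supersolution, and a
    concave quadratic correction on each cell ([interpolant]) makes it a
    supersolution for the true problem, strict at the vertices, up to a source
    term eta which tends to 0 with the mesh.  [max_principle] compares it with
    u.  Before a time T1 both functions lie where f is decreasing, so that the
    error stays of order eta however long ago the comparison starts; between T1
    and the time of interest it grows by an exponential factor that does not
    depend on the mesh ([comparison]).  Refining the mesh removes the error.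

    Wirtinger's inequality is needed for functions on the mesh, with a constant
    arbitrarily close to mu_1 ([discrete_poincare]).  A discrete eigenvector is
    on each edge a sample of A cos + B sin; if its eigenvalue stayed below
    mu_1 - eps on arbitrarily fine meshes, the coefficients A, B, normalised,
    would converge along an ultrafilter to those of an eigenfunction of Delta_0
    with an eigenvalue in (0, mu_1).  The loss of eps is paid for by the amount
    by which the ramp stays below the barrier, which comes from F > F(a) on
    [0, a/2] and does not depend on the mesh ([energy_ramp]). *)

Import Order.TTheory GRing.Theory Num.Theory.
Import numFieldNormedType.Exports.

Local Open Scope classical_set_scope.
Local Open Scope ring_scope.

Set Implicit Arguments.
Unset Strict Implicit.
Unset Printing Implicit Defensive.

(** * Limits along ultrafilters and finite-dimensional minimisation *)

Section UltraLimits.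
Context {R : realType} {I : Type} (U : set_system I) {UU : UltraFilter U}.

Lemma ultra_bounded_cvg (x : I -> R) (a b : R) :
  U [set i | a <= x i <= b] -> exists2 l, a <= l <= b & x @ U --> l.
Proof.
move=> Uab.
have Ux : (x @ U) [set` `[a, b]].
  rewrite /fmap /=; apply: filterS Uab => i /=; by rewrite in_itv.
have [l [lab cl]] := @segment_compact R a b (x @ U) _ Ux.
exists l; first by move: lab; rewrite /= in_itv.
move=> B nB; have [//|UnB] := in_ultra_setVsetC (x @^-1` B) UU.
have [|y [/= nBy By]] := cl (~` B) B _ nB; first exact: UnB.
by case: nBy.
Qed.

Lemma cvg_constant_eq (x : I -> R) (k l : R) :
  (forall i, x i = k) -> x @ U --> l -> l = k.
Proof.
move=> xk xl; apply: (@cvg_unique _ (@Rhausdorff R) (x @ U)) => //.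
by rewrite (_ : x = fun=> k); [exact: cvg_cst|exact/funext].
Qed.

End UltraLimits.

Section FiniteDimensionalMinimum.
Context {R : realType} {T : finType}.

(** Existence of minimisers without a topology on T -> R: a minimising
    sequence has all its coordinates converging along one ultrafilter. *)
Lemma bounded_min (K : set (T -> R)) (J : (T -> R) -> R) (a b m : R) :
  K !=set0 ->
  (forall w, K w -> forall x, a <= w x <= b) ->
  (forall w, K w -> m <= J w) ->
  (forall (U : set_system nat) (wn : nat -> T -> R) (w : T -> R), UltraFilter U ->
     (forall n, K (wn n)) -> (forall x, wn ^~ x @ U --> w x) ->
     K w /\ (J \o wn) @ U --> J w) ->
  exists2 w, K w & forall z, K z -> J w <= J z.
Proof.
move=> [w0 Kw0] Kab Jm Kc.
have hi : has_inf (J @` K).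
  by split; [exists (J w0); exists w0|exists m => _ [w Kw <-]; exact: Jm].
have wnP (n : nat) : {w | K w /\ J w < inf (J @` K) + n.+1%:R^-1}.
  apply: cid; have [||_ [w Kw <-] lew] := @inf_adherent _ (J @` K) n.+1%:R^-1 => //.
  by exists w.
have [wn /all_and2[Kwn Jwn]] := all_sig wnP.
have [U [UU leU]] := ultraFilterLemma (@eventually_filter).
have lP (x : T) : {l | a <= l <= b & wn ^~ x @ U --> l}.
  apply: cid2; apply: ultra_bounded_cvg; apply: filterS filterT => n _ /=; exact: Kab.
have [w _ wP] := all_sig2 lP.
have [Kw Jw] := Kc U wn w UU Kwn wP.
exists w => // z Kz.
apply: (@le_trans _ _ (inf (J @` K))); last first.
  by apply: ge_inf; [case: hi|exists z].
have : (fun n : nat => inf (J @` K) + n.+1%:R^-1) @ U --> inf (J @` K) + 0.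
  apply: cvgD; first exact: cvg_cst.
  apply: cvg_trans (@cvg_harmonic R).
  exact: cvg_fmap2.
rewrite addr0 => inflim.
apply: (ler_cvg_to Jw inflim).
by apply: filterS filterT => n _ /=; exact/ltW.
Qed.

End FiniteDimensionalMinimum.

(** * Functions on a weighted graph of cells *)

Section CellGraph.
Context {R : realType} {C T : finType} (s t : C -> T) (h : C -> R).
Implicit Types (P : {set C}) (w z : T -> R) (x : T).

Definition grad w c := w (t c) - w (s c).

(** The Dirichlet form of the functions that are affine on each cell. *)
Definition dform P w z := \sum_(c in P) grad w c * grad z c / h c.

(** The trapezoidal rule; its diagonal form is what makes the minimisation of
    the energy local at each node. *)
Definition mass P (g : T -> R) := \sum_(c in P) h c / 2 * (g (s c) + g (t c)).

(** Nodes which end no cell of P carry no mass, and the forms above ignore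
    the values there. *)
Definition touched P x := [exists c in P, (s c == x) || (t c == x)].

Lemma dformDr P w z y : dform P w (fun x => z x + y x) = dform P w z + dform P w y.
Proof.
by rewrite -big_split/=; apply: eq_bigr => c _; rewrite /grad; ring.
Qed.

Lemma massD P w z : mass P (fun x => w x + z x) = mass P w + mass P z.
Proof. by rewrite -big_split/=; apply: eq_bigr => c _; ring. Qed.

Lemma massZ P k w : mass P (fun x => k * w x) = k * mass P w.
Proof. by rewrite big_distrr/=; apply: eq_bigr => c _; ring. Qed.

Lemma mass_cst P k : mass P (fun=> k) = k * \sum_(c in P) h c.
Proof. by rewrite big_distrr/=; apply: eq_bigr => c _; field. Qed.

Lemma dform_sq P w z k :
  dform P (fun x => w x + k * z x) (fun x => w x + k * z x) =
  dform P w w + 2 * k * dform P w z + k ^+ 2 * dform P z z.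
Proof.
rewrite !big_distrr/= -!big_split/=; apply: eq_bigr => c _; rewrite /grad; ring.
Qed.

Lemma mass_sq P w z k :
  mass P (fun x => (w x + k * z x) ^+ 2) =
  mass P (fun x => w x ^+ 2) + 2 * k * mass P (fun x => w x * z x)
    + k ^+ 2 * mass P (fun x => z x ^+ 2).
Proof.
rewrite !big_distrr/= -!big_split/=; apply: eq_bigr => c _; ring.
Qed.

Lemma eq_mass P w z : (forall x, touched P x -> w x = z x) -> mass P w = mass P z.
Proof.
move=> wz; apply: eq_bigr => c cP.
by rewrite !wz//; apply/existsP; exists c; rewrite cP eqxx ?orbT.
Qed.

Lemma eq_grad P w z c : (forall x, touched P x -> w x = z x) -> c \in P ->
  grad w c = grad z c.
Proof.
move=> wz cP.
by rewrite /grad !wz//; apply/existsP; exists c; rewrite cP eqxx ?orbT.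
Qed.

Hypothesis h0 : forall c, 0 < h c.

Lemma dform_ge0 P w : 0 <= dform P w w.
Proof.
by apply: sumr_ge0 => c _; rewrite -expr2 divr_ge0 ?sqr_ge0// ltW.
Qed.

Lemma le_mass P w z : (forall x, touched P x -> w x <= z x) -> mass P w <= mass P z.
Proof.
move=> wz; apply: ler_sum => c cP; rewrite ler_pM2l ?divr_gt0//.
by rewrite lerD// wz//; apply/existsP; exists c; rewrite cP eqxx ?orbT.
Qed.

Lemma mass_sq_ge0 P w : 0 <= mass P (fun x => w x ^+ 2).
Proof.
apply: sumr_ge0 => c _; rewrite mulr_ge0 ?addr_ge0 ?sqr_ge0//.
by rewrite divr_ge0// ltW.
Qed.

Lemma mass_sq_gt0 P w x : touched P x -> w x != 0 -> 0 < mass P (fun x => w x ^+ 2).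
Proof.
case/existsP => c /andP[cP scx] wx; rewrite /mass (bigD1 c)//=.
have w2 : 0 < w x ^+ 2 by rewrite exprn_even_gt0.
have w2s : 0 <= w (s c) ^+ 2 by rewrite sqr_ge0.
have w2t : 0 <= w (t c) ^+ 2 by rewrite sqr_ge0.
apply: ltr_wpDr.
  apply: sumr_ge0 => d _; rewrite mulr_ge0 ?addr_ge0 ?sqr_ge0//.
  by rewrite divr_ge0// ltW.
rewrite mulr_gt0 ?divr_gt0//.
by case/orP : scx => /eqP ->; lra.
Qed.

Section Limits.
Context {U : set_system nat} {UU : UltraFilter U}.
Variables (wn zn : nat -> T -> R) (w z : T -> R).
Hypotheses (wnw : forall x, wn ^~ x @ U --> w x) (znz : forall x, zn ^~ x @ U --> z x).

Lemma cvg_mass P : (fun n => mass P (wn n)) @ U --> mass P w.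
Proof.
apply: cvg_big; first by apply: add_continuous.
by move=> c _; apply: cvgM; [exact: cvg_cst|exact: cvgD].
Qed.

Lemma cvg_dform P : (fun n => dform P (wn n) (zn n)) @ U --> dform P w z.
Proof.
apply: cvg_big; first by apply: add_continuous.
move=> c _; apply: cvgM; last exact: cvg_cst.
by apply: cvgM; apply: cvgB.
Qed.

End Limits.

(** The first nonconstant eigenvector, as minimiser of the Rayleigh quotient
    over the functions of mean zero.  The last equation holds for every z, not
    only for z of mean zero: on constants both sides vanish. *)
Lemma discrete_eigenvector P mu z0 :
  mass P z0 = 0 -> dform P z0 z0 < mu * mass P (fun x => z0 x ^+ 2) ->
  exists (w : T -> R) (lam : R), [/\ 0 <= lam < mu,
    exists2 x, touched P x & w x != 0,
    mass P w = 0 &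
    forall z, dform P w z = lam * mass P (fun x => w x * z x)].
Proof.
move=> mz0 ltz0.
pose K := [set w : T -> R | [/\ \sum_x w x ^+ 2 = 1,
  forall x, ~~ touched P x -> w x = 0 & mass P w = 0]].
pose J w := dform P w w / mass P (fun x => w x ^+ 2).
have K0 w : K w -> exists2 x, touched P x & w x != 0.
  case=> w1 wu _; apply: contrapT => nw.
  suff : \sum_x w x ^+ 2 = 0 by rewrite w1 => /eqP; rewrite oner_eq0.
  rewrite big1// => x _; have [tx|/wu ->] := boolP (touched P x); last by rewrite expr0n.
  by have [->|wx] := eqVneq (w x) 0; [rewrite expr0n|case: nw; exists x].
have Kpos w : K w -> 0 < mass P (fun x => w x ^+ 2).
  by case/K0 => x; exact: mass_sq_gt0.
(* erasing the values at untouched nodes and normalising maps every relevant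
   function into K, without changing the Rayleigh quotient *)
have scale (z : T -> R) : mass P z = 0 -> (exists2 x, touched P x & z x != 0) ->
    exists (y : T -> R) (k : R), [/\ K y, 0 < k & forall x, touched P x -> z x = k * y x].
  move=> mz [x0 tx0 zx0].
  pose z' x := if touched P x then z x else 0.
  have S0 : 0 < \sum_x z' x ^+ 2.
    rewrite (bigD1 x0)//= ltr_wpDr//; first by apply: sumr_ge0 => x _; rewrite sqr_ge0.
    by rewrite exprn_even_gt0//= /z' tx0.
  pose k := Num.sqrt (\sum_x z' x ^+ 2).
  have k0 : 0 < k by rewrite sqrtr_gt0.
  have zk x : touched P x -> z x = k * (k^-1 * z' x).
    by rewrite /z' => ->; rewrite mulrA divff ?mul1r// gt_eqF.
  exists (fun x => k^-1 * z' x), k; split => //; split.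
  - under eq_bigr do rewrite exprMn.
    by rewrite -big_distrr/= exprVn sqr_sqrtr ?(ltW S0)// mulVf// gt_eqF.
  - by move=> x; rewrite /z' => /negbTE ->; rewrite mulr0.
  - rewrite massZ (_ : mass P z' = 0) ?mulr0// -mz; apply: eq_mass => x tx.
    by rewrite /z' tx.
have JZ (z y : T -> R) (k : R) : 0 < k -> (forall x, touched P x -> z x = k * y x) ->
    dform P z z = k ^+ 2 * dform P y y /\
    mass P (fun x => z x ^+ 2) = k ^+ 2 * mass P (fun x => y x ^+ 2).
  move=> k0 zy; split.
    rewrite /dform big_distrr/=; apply: eq_bigr => c cP.
    by rewrite !(@eq_grad P z (fun x => k * y x))// /grad; ring.
  by rewrite -massZ; apply: eq_mass => x tx; rewrite zy// exprMn.
have z0n : exists2 x, touched P x & z0 x != 0.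
  apply: contrapT => nz; have z00 x : touched P x -> z0 x ^+ 2 = 0.
    move=> tx; have [->|zx] := eqVneq (z0 x) 0; first by rewrite expr0n.
    by case: nz; exists x.
  move: ltz0; rewrite (@eq_mass P (fun x => z0 x ^+ 2) (fun=> 0))//.
  by rewrite mass_cst mul0r mulr0 ltNge dform_ge0.
have [y0 [k0 [Ky0 k00 z0y0]]] := scale _ mz0 z0n.
have [w Kw wmin] : exists2 w, K w & forall z, K z -> J w <= J z.
  apply: (@bounded_min _ _ _ _ (-1) 1 0).
  - by exists y0.
  - move=> w [w1 _ _] x; rewrite -ler_norml -(@ler_pXn2r _ 2)// ?nnegrE//.
    rewrite real_normK ?num_real// expr1n -w1 (bigD1 x)//= lerDl.
    by apply: sumr_ge0 => y _; rewrite sqr_ge0.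
  - by move=> w Kw; rewrite divr_ge0 ?dform_ge0// ltW// Kpos.
  - move=> U wn w UU Kwn wnw.
    have Kw : K w; last first.
      split => //; apply: cvgM; first exact: cvg_dform.
      apply: cvgV; first by rewrite gt_eqF// Kpos.
      by apply: cvg_mass => x; apply: cvgM.
    split.
    + apply: (@cvg_constant_eq _ _ U _ (fun n => \sum_x wn n x ^+ 2)).
        by move=> n; case: (Kwn n).
      apply: cvg_big; first by apply: add_continuous.
      by move=> x _; apply: cvgM.
    + move=> x tx; apply: (@cvg_constant_eq _ _ U _ (wn ^~ x)) => // n.
      by case: (Kwn n) => _ ->.
    + apply: (@cvg_constant_eq _ _ U _ (fun n => mass P (wn n))).
        by move=> n; case: (Kwn n).
      exact: cvg_mass.
have [w1 wu mw] := Kw; have Mw := Kpos _ Kw.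
exists w, (J w).
have Jge z : mass P z = 0 -> J w * mass P (fun x => z x ^+ 2) <= dform P z z.
  move=> mz; have [/(scale _ mz)[y [k [Ky k1 /(JZ _ _ _ k1)[-> ->]]]]|nz] :=
      pselect (exists2 x, touched P x & z x != 0).
    rewrite mulrCA ler_pM2l ?exprn_gt0// -ler_pdivlMr ?Kpos//.
    exact: wmin.
  rewrite (@eq_mass P (fun x => z x ^+ 2) (fun=> 0)).
    by rewrite mass_cst mul0r mulr0 dform_ge0.
  move=> x tx; have [->|zx] := eqVneq (z x) 0; first by rewrite expr0n.
  by case: nz; exists x.
have crit z : mass P z = 0 -> dform P w z = J w * mass P (fun x => w x * z x).
  move=> mz; set b := dform P w z; set m := mass P _.
  set D := dform P z z; set M := mass P (fun x => z x ^+ 2).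
  have q k : 0 <= 2 * k * (b - J w * m) + k ^+ 2 * (D - J w * M).
    have := Jge (fun x => w x + k * z x).
    rewrite massD massZ mz mw mulr0 addr0 => /(_ erefl).
    rewrite dform_sq mass_sq -/b -/m -/D -/M.
    rewrite (_ : dform P w w = J w * mass P (fun x => w x ^+ 2)).
      by move=> ?; lra.
    by rewrite divfK// gt_eqF.
  apply/eqP; rewrite -subr_eq0; apply/negPn/negP => bm0.
  set e := b - J w * m in q bm0; set d := D - J w * M in q.
  have d0 : 0 <= d by have := Jge _ mz; rewrite /d subr_ge0.
  (* the minimum of 2 k e + k ^ 2 d is at k = - e / d; the 1 avoids d = 0 *)
  have := q (- e / (d + 1)).
  have d1 : 0 < d + 1 by lra.
  rewrite (_ : _ + _ = - (e ^+ 2 * (d + 2) / (d + 1) ^+ 2)); last by field; lra.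
  rewrite oppr_ge0 leNgt => /negP; apply; apply: divr_gt0; last exact: exprn_gt0.
  by apply: mulr_gt0; [rewrite exprn_even_gt0|lra].
split => //.
- rewrite divr_ge0 ?dform_ge0 ?(ltW Mw)//=.
  apply: (le_lt_trans (wmin _ Ky0)); rewrite ltr_pdivrMr ?Kpos//.
  have [e1 e2] := JZ _ _ _ k00 z0y0; move: ltz0; rewrite e1 e2 mulrCA.
  by rewrite ltr_pM2l ?exprn_gt0.
- exact: K0.
- move=> z; set H := \sum_(c in P) h c.
  have H0 : 0 < H.
    have [x /existsP[c /andP[cP _]] _] := K0 _ Kw.
    rewrite /H (bigD1 c)//= ltr_pwDl// sumr_ge0// => d _; exact: ltW.
  have := crit (fun x => z x + - (mass P z / H)).
  rewrite massD mass_cst -/H mulNr divfK ?gt_eqF// subrr => /(_ erefl).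
  have dc k : dform P w (fun=> k) = 0.
    by apply: big1 => c _; rewrite {2}/grad subrr mulr0 mul0r.
  rewrite dformDr dc addr0 => ->; congr (_ * _).
  rewrite (_ : (fun x => w x * _) = (fun x => w x * z x + - (mass P z / H) * w x)).
    by rewrite massD massZ mw mulr0 addr0.
  by apply/funext => x; ring.
Qed.

End CellGraph.

(** * Constrained minimisers are discrete supersolutions *)

(** The first-order condition for a minimum over a half-line. *)
Lemma ge0_of_small {R : realType} (a b t0 : R) : 0 < t0 ->
  (forall t, 0 < t <= t0 -> 0 <= a + t * b) -> 0 <= a.
Proof.
move=> t00 H; rewrite leNgt; apply/negP => a0.
have bp : 0 < `|b| + 1 by rewrite ltr_wpDl.
pose t := Num.min t0 (- a / (`|b| + 1) / 2).
have tp : 0 < t by rewrite lt_min t00 !divr_gt0// oppr_gt0.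
have := H t; rewrite tp ge_min lexx/= => /(_ erefl).
have tb : t * b <= - a / 2.
  apply: (@le_trans _ _ (t * (`|b| + 1))).
    by rewrite ler_pM2l// ltW// (le_lt_trans (ler_norm _))// ltrDl.
  rewrite -ler_pdivlMr//.
  have : t <= - a / (`|b| + 1) / 2 by rewrite ge_min lexx orbT.
  by rewrite mulrAC.
lra.
Qed.

Section ConstrainedMinimizer.
Context {R : realType} {C T : finType} (s t : C -> T) (h : C -> R).
Hypothesis h0 : forall c, 0 < h c.
Variables (F f : R -> R) (K Fmax : R).
Hypothesis F_lip : forall x y : R, 0 <= x <= 1 -> 0 <= y <= 1 ->
  `|F x - F y| <= K * `|x - y|.
Hypothesis F_quad : forall x e : R, 0 <= x -> 0 <= e -> x + e <= 1 ->
  e * f x - K * e ^+ 2 <= F (x + e) - F x.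
Hypothesis F_le : forall x : R, 0 <= x <= 1 -> F x <= Fmax.
Hypothesis f1 : f 1 = 0.

Definition energy (P : {set C}) (w : T -> R) :=
  dform s t h P w w / 2 - mass s t h P (F \o w).

Definition bump (x y : T) : R := (y == x)%:R.

Definition admissible (Q : {set C}) b (d : R) (w : T -> R) :=
  [/\ forall x, 0 <= w x <= 1, w b = 1 & mass s t h Q w <= d].

Lemma admissible_minimizer P Q b d w0 : admissible Q b d w0 ->
  exists2 w, admissible Q b d w &
    forall z, admissible Q b d z -> energy P w <= energy P z.
Proof.
move=> Kw0; apply: (@bounded_min _ _ _ _ 0 1 (- mass s t h P (fun=> Fmax))).
- by exists w0.
- by move=> w [].
- move=> w [w01 _ _]; rewrite -[leLHS]add0r lerB//.
    by rewrite divr_ge0// dform_ge0.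
  by apply: le_mass => // x _; exact: F_le.
move=> U wn w UU Kwn wnw.
have w01 x : 0 <= w x <= 1.
  apply/andP; split.
    apply: (ler_cvg_to (@cvg_cst _ (0 : R) _ _ _) (wnw x)).
    by apply: filterS filterT => n _ /=; case: (Kwn n) => /(_ x)/andP[].
  apply: (ler_cvg_to (wnw x) (@cvg_cst _ (1 : R) _ _ _)).
  by apply: filterS filterT => n _ /=; case: (Kwn n) => /(_ x)/andP[].
split; first split => //.
- apply: (@cvg_constant_eq _ _ U _ (wn ^~ b)) => // n.
  by case: (Kwn n).
- apply: (ler_cvg_to (@cvg_mass _ _ _ s t h U UU wn w wnw Q) (@cvg_cst _ (d : R) _ _ _)).
  by apply: filterS filterT => n _ /=; case: (Kwn n).
apply: cvgB; first by apply: cvgM; [exact: cvg_dform|exact: cvg_cst].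
apply: cvg_mass => x /=.
have dist0 : (fun n => K * `|wn n x - w x|) @ U --> 0.
  rewrite -[X in _ --> X](mulr0 K); apply: cvgM; first exact: cvg_cst.
  rewrite -(normr0 R); apply: cvg_norm; rewrite -(subrr (w x)).
  by apply: cvgB => //; exact: cvg_cst.
apply/cvgrPdist_le => e e0.
have /cvgrPdist_le /(_ e e0) := dist0.
apply: filterS => n /=; rewrite sub0r normrN; apply: le_trans.
rewrite distrC; apply: le_trans (F_lip _ _) (ler_norm _) => //.
by case: (Kwn n).
Qed.

Lemma dform_bump_top P w x : (forall y, w y <= w x) ->
  0 <= dform s t h P w (bump x).
Proof.
move=> wx; apply: sumr_ge0 => c _; apply: divr_ge0; last exact: ltW.
rewrite /grad /bump; have := wx (s c); have := wx (t c).
case: (eqVneq (s c) x) => [->|_]; case: (eqVneq (t c) x) => [->|_]; rewrite /=; nra.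
Qed.

(** If the constraint on the mean is not saturated at the minimiser, the value
    at any node below 1 may be increased a little, which gives one sign of the
    Euler-Lagrange equation.  At a node where the value is 1 that sign is
    automatic, since f 1 = 0 and the node is a maximum. *)
Lemma supersolution_of_minimizer P Q b d w0 :
  admissible Q b d w0 ->
  (forall w, admissible Q b d w -> mass s t h Q w = d ->
     energy P w0 < energy P w) ->
  exists w, [/\ admissible Q b d w, energy P w <= energy P w0 &
    forall x, x != b ->
      f (w x) * mass s t h P (bump x) <= dform s t h P w (bump x)].
Proof.
move=> Kw0 barrier; have [w Kw wmin] := admissible_minimizer P Kw0.
exists w; split => //; first exact: wmin.
have [w01 wb mw] := Kw.
have {}mw : mass s t h Q w < d.
  rewrite lt_neqAle mw andbT; apply/eqP => mwd.
  by have := barrier _ Kw mwd; rewrite ltNge wmin.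
move=> x xb; have [wx|wx] := ltP (w x) 1; last first.
  have {}wx : w x = 1 by apply/eqP; rewrite eq_le wx andbT; case/andP: (w01 x).
  rewrite wx f1 mul0r; apply: dform_bump_top => y; rewrite wx.
  by case/andP: (w01 y).
rewrite -subr_ge0.
set D := dform s t h P w (bump x); set m := mass s t h P (bump x).
have m0 (S : {set C}) : 0 <= mass s t h S (bump x).
  rewrite (_ : bump x = fun y => bump x y ^+ 2); first exact: mass_sq_ge0.
  by apply/funext => y; rewrite /bump; case: eqP; rewrite ?expr1n ?expr0n.
set q := mass s t h Q (bump x).
have q1 : 0 < q + 1 by rewrite ltr_wpDl// m0.
(* the two bounds keep the perturbed value below 1 and its mean below d *)
pose e0 := Num.min (1 - w x) ((d - mass s t h Q w) / (q + 1)).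
have e00 : 0 < e0 by rewrite lt_min subr_gt0 wx divr_gt0// subr_gt0.
apply: (@ge0_of_small _ _ (dform s t h P (bump x) (bump x) / 2 + m * K) e0) => //.
move=> e /andP[ep]; rewrite le_min => /andP[e1 e2].
pose z y := w y + e * bump x y.
have zx : z x = w x + e by rewrite /z /bump eqxx mulr1.
have zy y : y != x -> z y = w y by move=> /negbTE yx; rewrite /z /bump yx mulr0 addr0.
have Kz : admissible Q b d z.
  split.
  - move=> y; have [->|/zy ->//] := eqVneq y x; rewrite zx.
    case/andP: (w01 x) => w0x _; apply/andP; split; [exact: addr_ge0 (ltW _)|lra].
  - by rewrite zy// eq_sym.
  - rewrite massD massZ -/q.
    move: e2; rewrite ler_pdivlMr// => e2; have := m0 Q; rewrite -/q => q0; nra.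
have := wmin _ Kz; rewrite /energy dform_sq -/D -subr_ge0.
have -> : F \o z = fun y => (F \o w) y + (F (z x) - F (w x)) * bump x y.
  apply/funext => y /=; rewrite /bump; have [->|yx] := eqVneq y x.
    by rewrite mulr1 addrC subrK.
  by rewrite mulr0 addr0 zy.
rewrite massD massZ -/m zx => ineq.
have w0x : 0 <= w x by case/andP: (w01 x).
have := @F_quad (w x) e w0x (ltW ep); rewrite -lerBrDl => /(_ e1) quad.
have mx : 0 <= m by exact: m0.
have {}quad := ler_wpM2r mx quad.
rewrite -(pmulr_rge0 _ ep); lra.
Qed.

End ConstrainedMinimizer.

(** * Subdivision of the edges of a graph *)

Lemma sqr_sum_le {R : realType} (a : nat -> R) k :
  (\sum_(j < k) a j) ^+ 2 <= k%:R * \sum_(j < k) a j ^+ 2.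
Proof.
elim: k => [|k IH]; first by rewrite !big_ord0 expr0n mulr0.
rewrite !big_ord_recr/=; set x := \sum_(j < k) _ in IH *; set q := \sum_(j < k) _ in IH *.
have q0 : 0 <= q by apply: sumr_ge0 => j _; rewrite sqr_ge0.
have k0 : 0 <= k%:R :> R by [].
have [kN|kN] := eqVneq k 0%N.
  have -> : x = 0.
    by apply/eqP; rewrite -sqrf_eq0 eq_le sqr_ge0 andbT (le_trans IH)// kN mul0r.
  by rewrite kN add0r mul1r lerDr.
have kp : 0 < k%:R :> R by rewrite ltr0n lt0n.
rewrite -natr1; set r := k%:R in IH k0 kp *; set y := a k.
have : 0 <= (x - r * y) ^+ 2 / r by rewrite divr_ge0// sqr_ge0.
rewrite (_ : _ / r = x ^+ 2 / r - 2 * x * y + r * y ^+ 2); last by field; rewrite gt_eqF.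
have : x ^+ 2 / r <= q by rewrite ler_pdivrMr// mulrC.
lra.
Qed.

Section Subdivision.
Context {R : realType} {V E : finType} (src tgt : E -> V) (len : E -> R).
Hypothesis len0 : forall e, 0 < len e.
Variable m : nat.

(** The j-th of the m.+2 mesh points of the edge e.  The point [inr (e, 0)] is
    never reached; it is kept so that the index type is the one of the cells. *)
Definition node (e : E) (j : nat) : (V + E * 'I_m.+1)%type :=
  if j == 0%N then inl (src e) else
  if (m < j)%N then inl (tgt e) else inr (e, inord j).

Definition cell_s (c : E * 'I_m.+1) := node c.1 c.2.
Definition cell_t (c : E * 'I_m.+1) := node c.1 c.2.+1.
Definition cell_h (c : E * 'I_m.+1) : R := len c.1 / m.+1%:R.
Definition cells (S : {set E}) : {set E * 'I_m.+1} := [set c | c.1 \in S].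

Lemma cell_h_gt0 c : 0 < cell_h c.
Proof. by rewrite divr_gt0. Qed.

Lemma node0 e : node e 0 = inl (src e). Proof. by []. Qed.

Lemma node_last e : node e m.+1 = inl (tgt e).
Proof. by rewrite /node ltnSn. Qed.

Lemma node_inr e j : (0 < j <= m)%N -> node e j = inr (e, inord j).
Proof. by rewrite /node lt0n => /andP[/negbTE -> jm]; rewrite ltnNge jm. Qed.

Lemma node_inner e j e' k : (0 < j <= m)%N -> (k <= m.+1)%N ->
  (node e' k == node e j) = (e' == e) && (k == j).
Proof.
move=> jm km; rewrite (node_inr e jm) /node; have [->|k0] := eqVneq k 0%N.
  by rewrite andbC; case: j jm.
case: ltnP => mk.
  rewrite andbC; case: (eqVneq k j) => // kj; move: jm; rewrite -kj => /andP[_].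
  by rewrite leqNgt mk.
apply/eqP/andP => [[-> kj]|[/eqP -> /eqP ->]//]; split => //.
apply/eqP; have := congr1 (@nat_of_ord _) kj.
by rewrite !inordK// ltnS; case/andP: jm.
Qed.

Lemma node_vertex e v : (node e 0 == inl v) = (src e == v).
Proof. by []. Qed.

Lemma node_vertex_last e v : (node e m.+1 == inl v) = (tgt e == v).
Proof. by rewrite node_last. Qed.

Lemma node_vertex_inner e j v : (0 < j <= m)%N -> (node e j == inl v) = false.
Proof. by move=> jm; rewrite node_inr. Qed.

Lemma sum_cells (S : {set E}) (g : E -> nat -> R) :
  \sum_(c in cells S) g c.1 c.2 = \sum_(e in S) \sum_(j < m.+1) g e j.
Proof.
rewrite pair_big_dep/=; apply: eq_bigl => c.
by rewrite inE andbT.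
Qed.

(** Contributions of the two sides of a mesh point inside an edge cancel, so that
    a sum over nodes of the mesh only sees the vertices of the graph. *)
Lemma telescope_cells (S : {set E}) (X : E -> nat -> R) :
  \sum_(c in cells S) (X c.1 c.2.+1 - X c.1 c.2) =
  \sum_(e in S) (X e m.+1 - X e 0%N).
Proof.
rewrite (sum_cells S (fun e j => X e j.+1 - X e j)); apply: eq_bigr => e _.
by rewrite -(big_mkord xpredT (fun j => X e j.+1 - X e j)) telescope_sumr.
Qed.

Lemma cells_length S : \sum_(c in cells S) cell_h c = \sum_(e in S) len e.
Proof.
rewrite (sum_cells S (fun e _ => len e / m.+1%:R)); apply: eq_bigr => e _.
by rewrite sumr_const card_ord -[LHS]mulr_natr divfK.
Qed.

Lemma touched_cells S x : touched cell_s cell_t (cells S) x ->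
  exists e j, [/\ e \in S, (j <= m.+1)%N & x = node e j].
Proof.
case/existsP => -[e j] /=; rewrite inE/= => /andP[eS /orP[] /eqP <-].
  by exists e, j; split => //; exact: ltnW.
by exists e, j.+1; split => //; exact: ltn_ord.
Qed.

Definition edge_adj (S : {set E}) : rel V := fun v w =>
  [exists e in S, ((src e == v) && (tgt e == w)) || ((src e == w) && (tgt e == v))].

Section Oscillation.
Variables (S : {set E}) (w : (V + E * 'I_m.+1)%type -> R).
Let Q := dform cell_s cell_t cell_h (cells S) w w.
Let osc := Num.sqrt ((\sum_(e in S) len e) * Q).

Let Q0 : 0 <= Q.
Proof. by apply: dform_ge0; exact: cell_h_gt0. Qed.

Lemma edge_osc e j : e \in S -> (j <= m.+1)%N ->
  `|w (node e j) - w (inl (src e))| <= osc.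
Proof.
move=> eS jm; rewrite -sqrtr_sqr ler_wsqrtr//.
have -> : w (node e j) - w (inl (src e)) =
    \sum_(i < j) (w (node e i.+1) - w (node e i)).
  by rewrite -(big_mkord xpredT (fun i => w (node e i.+1) - w (node e i)))
    telescope_sumr.
apply: (le_trans (sqr_sum_le (fun i => w (node e i.+1) - w (node e i)) j)).
have sum_le : \sum_(i < j) (w (node e i.+1) - w (node e i)) ^+ 2 <=
    \sum_(i < m.+1) (w (node e i.+1) - w (node e i)) ^+ 2.
  rewrite (big_ord_widen_cond m.+1 xpredT (fun i => (w (node e i.+1) - w (node e i)) ^+ 2))//=.
  by rewrite [leRHS](bigID (fun i : 'I_m.+1 => (i < j)%N))/= lerDl sumr_ge0// => i _; exact: sqr_ge0.
apply: (@le_trans _ _ (m.+1%:R * \sum_(i < m.+1) (w (node e i.+1) - w (node e i)) ^+ 2)).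
  by rewrite ler_pM ?ler_nat// sumr_ge0// => i _; exact: sqr_ge0.
have -> : m.+1%:R * \sum_(i < m.+1) (w (node e i.+1) - w (node e i)) ^+ 2 =
    len e * \sum_(i < m.+1) (w (node e i.+1) - w (node e i)) ^+ 2 / (len e / m.+1%:R).
  rewrite -mulr_suml; have : m.+1%:R != 0 :> R by rewrite pnatr_eq0.
  move: (m.+1%:R : R) => r r0; field; by rewrite r0 gt_eqF.
have Qe : Q = \sum_(e in S) \sum_(i < m.+1) (w (node e i.+1) - w (node e i)) ^+ 2 / (len e / m.+1%:R).
  rewrite -(sum_cells S (fun e i => (w (node e i.+1) - w (node e i)) ^+ 2 / (len e / m.+1%:R))).
  by apply: eq_bigr => c _; rewrite -expr2.
have term0 e' : 0 <= \sum_(i < m.+1) (w (node e' i.+1) - w (node e' i)) ^+ 2 / (len e' / m.+1%:R).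
  by apply: sumr_ge0 => i _; rewrite divr_ge0 ?sqr_ge0// ltW// divr_gt0.
apply: ler_pM => //; first exact: ltW.
  by rewrite (bigD1 e)//= lerDl sumr_ge0// => e' _; exact: ltW.
by rewrite Qe [leRHS](bigD1 e)//= lerDl sumr_ge0.
Qed.

Lemma path_osc v p : path (edge_adj S) v p ->
  `|w (inl v) - w (inl (last v p))| <= (size p)%:R * osc.
Proof.
elim: p v => [|v' p IH] v /=; first by rewrite subrr normr0 mul0r.
case/andP => /existsP[e /andP[eS ee]] /IH pp.
rewrite -natr1 mulrDl mul1r [leRHS]addrC.
rewrite (_ : _ - _ = (w (inl v) - w (inl v')) + (w (inl v') - w (inl (last v' p)))).
  apply: (le_trans (ler_normD _ _)); apply: lerD => //.
  have := @edge_osc e m.+1 eS (leqnn _); rewrite node_last.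
  by case/orP: ee => /andP[/eqP <- /eqP <-] //; rewrite distrC.
by ring.
Qed.

Hypothesis conn : forall e e', e \in S -> e' \in S ->
  connect (edge_adj S) (src e) (src e').

Lemma total_osc x y :
  touched cell_s cell_t (cells S) x -> touched cell_s cell_t (cells S) y ->
  `|w x - w y| <= (#|V|.+2)%:R * osc.
Proof.
move=> /touched_cells[e [i [eS im ->]]] /touched_cells[e' [j [e'S jm ->]]].
have /connectP[p0 pp0] := conn eS e'S; case/shortenP: pp0 => p pp up _ lp.
have := path_osc pp; rewrite -lp => ov.
have sp : (size p <= #|V|)%N.
  by apply: leq_trans (leqnSn _) _; rewrite -[(size p).+1]/(size (src e :: p)) -(card_uniqP up) max_card.
have o0 : 0 <= osc by exact: sqrtr_ge0.
have {}ov : `|w (inl (src e)) - w (inl (src e'))| <= #|V|%:R * osc.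
  by apply: (le_trans ov); rewrite ler_wpM2r// ler_nat.
have := edge_osc eS im; have := edge_osc e'S jm; rewrite -!natr1 => o1 o2.
rewrite (_ : _ - _ = (w (node e i) - w (inl (src e))) +
  ((w (inl (src e)) - w (inl (src e'))) - (w (node e' j) - w (inl (src e'))))); last by ring.
apply: (le_trans (ler_normD _ _)).
have := ler_normB (w (inl (src e)) - w (inl (src e'))) (w (node e' j) - w (inl (src e'))).
lra.
Qed.

(** A bound independent of the mesh, from the paths of a connected graph: it
    keeps the discrete eigenvalues away from 0. *)
Lemma crude_poincare : mass cell_s cell_t cell_h (cells S) w = 0 ->
  mass cell_s cell_t cell_h (cells S) (fun x => w x ^+ 2) <=
  ((#|V|.+2)%:R * (\sum_(e in S) len e)) ^+ 2 * Q.
Proof.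
move=> mw; set M := \sum_(e in S) len e; set N := (#|V|.+2)%:R.
have M0 : 0 <= M by apply: sumr_ge0 => e _; exact: ltW.
have N0 : 0 <= N :> R by [].
have wx x : touched cell_s cell_t (cells S) x -> `|w x| * M <= N * osc * M.
  move=> tx.
  have : `|w x * M| <= N * osc * M; last by rewrite normrM (ger0_norm M0).
  have bnd z : (forall y, touched cell_s cell_t (cells S) y -> z y <= N * osc) ->
      mass cell_s cell_t cell_h (cells S) z <= N * osc * M.
    move=> zN; apply: (le_trans (@le_mass _ _ _ _ _ _ cell_h_gt0 _ z (fun=> N * osc) zN)).
    by rewrite mass_cst cells_length.
  rewrite -[M in w x * M](cells_length S) -(mass_cst cell_s cell_t).
  rewrite ler_norml; apply/andP; split.
    rewrite lerNl -[leLHS]addr0 -mw -mulN1r -massZ -massD; apply: bnd => y ty.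
    have := total_osc tx ty; rewrite ler_norml => /andP[]; rewrite -/N; lra.
  rewrite -[leLHS]subr0 -[X in _ - X]mw -[X in _ - X]mul1r -mulNr -massZ -massD; apply: bnd => y ty.
  have := total_osc tx ty; rewrite ler_norml => /andP[]; rewrite -/N; lra.
have osc2 : osc ^+ 2 = M * Q by rewrite sqr_sqrtr// mulr_ge0.
have [M00|Mn] := eqVneq M 0.
  rewrite (_ : mass _ _ _ _ _ = 0); first by rewrite mulr_ge0// sqr_ge0.
  have S0 : S = finset.set0.
    apply/setP => e; rewrite inE; apply/negP => eS; move: M00.
    rewrite /M (bigD1 e)//= => /eqP; rewrite gt_eqF//.
    by rewrite ltr_pwDl// sumr_ge0// => e' _; exact: ltW.
  by rewrite /mass big1// => c; rewrite inE S0 inE.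
have Mp : 0 < M by rewrite lt_neqAle eq_sym Mn.
apply: (@le_trans _ _ (mass cell_s cell_t cell_h (cells S) (fun=> (N * osc) ^+ 2))).
  apply: le_mass; first exact: cell_h_gt0.
  move=> x /wx; rewrite ler_pM2r// => wN.
  by rewrite -real_normK ?num_real// ler_pXn2r ?nnegrE// (le_trans _ wN).
by rewrite mass_cst cells_length -/M exprMn osc2; lra.
Qed.

End Oscillation.
End Subdivision.

(** * Discrete eigenvectors are sampled trigonometric functions *)

Lemma cos_recurrence {R : realType} (W : nat -> R) (th : R) k :
  sin th != 0 ->
  (forall j, (0 < j < k)%N -> W j.+1 = 2 * cos th * W j - W j.-1) ->
  forall j, (j <= k)%N ->
    W j = W 0%N * cos (j%:R * th) + (W 1%N - W 0%N * cos th) / sin th * sin (j%:R * th).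
Proof.
move=> s0 rec; set A := W 0%N; set B := _ / _.
have W0 : W 0%N = A * cos (0%:R * th) + B * sin (0%:R * th).
  by rewrite mul0r cos0 sin0 mulr1 mulr0 addr0.
have W1 : W 1%N = A * cos (1%:R * th) + B * sin (1%:R * th).
  by rewrite mul1r /B divfK// addrC subrK.
suff H j : ((j <= k)%N -> W j = A * cos (j%:R * th) + B * sin (j%:R * th)) /\
           ((j < k)%N -> W j.+1 = A * cos (j.+1%:R * th) + B * sin (j.+1%:R * th)).
  by move=> j; case: (H j).
elim: j => [|j [IH0 IH1]]; first by split.
split=> [jk|jk]; first exact: IH1.
rewrite (rec j.+1 jk)/= (IH0 (ltnW (ltnW jk))) (IH1 (ltnW jk)).
have -> : j.+2%:R * th = j.+1%:R * th + th by rewrite -[j.+2%:R]natr1 mulrDl mul1r.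
have -> : j%:R * th = j.+1%:R * th - th by rewrite -[j.+1%:R]natr1 mulrDl mul1r addrK.
by rewrite !cosD !sinD cosN sinN; ring.
Qed.

Section DiscreteModes.
Context {R : realType} {V E : finType} (src tgt : E -> V) (len : E -> R).
Hypothesis len0 : forall e, 0 < len e.
Variable (S : {set E}).

Section OneMesh.
Variable m : nat.
Local Notation nd := (node src tgt m).
Local Notation cs := (@cell_s V E src tgt m).
Local Notation ct := (@cell_t V E src tgt m).
Local Notation ch := (@cell_h R E len m).
Local Notation cl := (@cells E m).
Implicit Types (A B : E -> nat -> R).

Lemma sum_at_inner A B e j : e \in S -> (0 < j <= m)%N ->
  \sum_(c in cl S) (A c.1 c.2 * (ct c == nd e j)%:R
                     + B c.1 c.2 * (cs c == nd e j)%:R) = A e j.-1 + B e j.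
Proof.
move=> eS jm.
rewrite (sum_cells m S (fun e' i => A e' i * (nd e' i.+1 == nd e j)%:R
                                + B e' i * (nd e' i == nd e j)%:R)).
have z e' (i : 'I_m.+1) : A e' i * (nd e' i.+1 == nd e j)%:R
    + B e' i * (nd e' i == nd e j)%:R =
    A e' i * ((e' == e) && (i.+1 == j))%:R + B e' i * ((e' == e) && (nat_of_ord i == j))%:R.
  by rewrite !node_inner//; exact: ltnW.
under eq_bigr => e' _ do under eq_bigr => i _ do rewrite z.
rewrite (bigD1 e)//= [X in _ + X]big1 ?addr0; last first.
  by move=> e' /andP[_ /negbTE e'e]; rewrite big1// => i _; rewrite e'e !mulr0 addr0.
rewrite eqxx/= big_split/=; congr (_ + _).
  have j1 : (j.-1 < m.+1)%N by case/andP: jm => _ /(leq_trans (leq_pred _)).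
  rewrite (bigD1 (Ordinal j1))//= prednK ?eqxx ?mulr1; last by case/andP: jm.
  rewrite big1 ?addr0// => i; rewrite -val_eqE/= => ij.
  by case: eqP => [ji|]; [rewrite -ji eqxx in ij|rewrite mulr0].
have j1 : (j < m.+1)%N by case/andP: jm.
rewrite (bigD1 (Ordinal j1))//= eqxx mulr1 big1 ?addr0// => i.
by rewrite -val_eqE/= => /negbTE ->; rewrite mulr0.
Qed.

Lemma sum_at_vertex A B v :
  \sum_(c in cl S) (A c.1 c.2 * (ct c == inl v)%:R
                     + B c.1 c.2 * (cs c == inl v)%:R) =
  \sum_(e in S) (A e m * (tgt e == v)%:R + B e 0%N * (src e == v)%:R).
Proof.
rewrite (sum_cells m S (fun e' i => A e' i * (nd e' i.+1 == inl v)%:R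
                                + B e' i * (nd e' i == inl v)%:R)).
apply: eq_bigr => e _; rewrite big_split/=; congr (_ + _).
  rewrite (bigD1 ord_max)//= node_vertex_last big1 ?addr0// => i im.
  rewrite node_vertex_inner ?mulr0//=.
  by move: im; rewrite -val_eqE/= => im; rewrite ltn_neqAle im -ltnS ltn_ord.
rewrite (bigD1 ord0)//= node_vertex big1 ?addr0// => i i0.
rewrite -val_eqE/= in i0.
by rewrite node_vertex_inner ?mulr0// lt0n i0 -ltnS ltn_ord.
Qed.

Section Eigenvector.
Variables (w : (V + E * 'I_m.+1)%type -> R) (lam : R).
Hypothesis eqn : forall z, dform cs ct ch (cl S) w z =
  lam * mass cs ct ch (cl S) (fun x => w x * z x).

Let h e := len e / m.+1%:R.
Let W e j := w (nd e j).

Lemma dform_bump x :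
  dform cs ct ch (cl S) w (bump x) =
  \sum_(c in cl S) ((W c.1 c.2.+1 - W c.1 c.2) / h c.1 * (ct c == x)%:R
                     + - ((W c.1 c.2.+1 - W c.1 c.2) / h c.1) * (cs c == x)%:R).
Proof. by apply: eq_bigr => c _; rewrite /grad /bump /W /h /cell_h /cell_s /cell_t; ring. Qed.

Lemma mass_bump x :
  mass cs ct ch (cl S) (fun y => w y * bump x y) =
  \sum_(c in cl S) (h c.1 / 2 * W c.1 c.2.+1 * (ct c == x)%:R
                     + h c.1 / 2 * W c.1 c.2 * (cs c == x)%:R).
Proof. by apply: eq_bigr => c _; rewrite /bump/= /W /h /cell_h /cell_s /cell_t; ring. Qed.

(** The three-term recurrence whose solutions are cosines and sines of multiples
    of the angle th with 2 - 2 cos th = lam * h ^ 2. *)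
Lemma eigenvector_inner e j : e \in S -> (0 < j <= m)%N ->
  W e j.+1 = (2 - lam * h e ^+ 2) * W e j - W e j.-1.
Proof.
move=> eS jm; have := eqn (bump (nd e j)).
rewrite dform_bump mass_bump.
rewrite (sum_at_inner (fun e i => (W e i.+1 - W e i) / h e) (fun e i => - ((W e i.+1 - W e i) / h e)) eS jm).
rewrite (sum_at_inner (fun e i => h e / 2 * W e i.+1) (fun e i => h e / 2 * W e i) eS jm)/=.
rewrite prednK; last by case/andP: jm.
have he : h e != 0 by rewrite gt_eqF// divr_gt0.
move=> /(congr1 (fun x => x * h e)).
rewrite mulrBl !divfK// => H.
by rewrite -[LHS]addr0 -(subrr (W e j)); move: H; set x := W e _; set y := W e _; set z := W e _; lra.
Qed.

Lemma eigenvector_vertex v :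
  \sum_(e in S) ((W e m.+1 - W e m) / h e * (tgt e == v)%:R
                 + - ((W e 1%N - W e 0%N) / h e) * (src e == v)%:R) =
  lam * \sum_(e in S) (h e / 2 * W e m.+1 * (tgt e == v)%:R
                      + h e / 2 * W e 0%N * (src e == v)%:R).
Proof.
have := eqn (bump (inl v)); rewrite dform_bump mass_bump.
rewrite (sum_at_vertex (fun e i => (W e i.+1 - W e i) / h e) (fun e i => - ((W e i.+1 - W e i) / h e))).
by rewrite (sum_at_vertex (fun e i => h e / 2 * W e i.+1) (fun e i => h e / 2 * W e i)).
Qed.

End Eigenvector.
End OneMesh.
End DiscreteModes.

Lemma double_asin {R : realType} (x : R) : 0 <= x < 1 ->
  sin (2 * asin x) = 2 * x * Num.sqrt (1 - x ^+ 2) /\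
  cos (2 * asin x) = 1 - 2 * x ^+ 2.
Proof.
move=> /andP[x0 x1].
have xi : -1 <= x <= 1 by apply/andP; split; lra.
have sx : sin (asin x) = x by rewrite asinK// in_itv.
have -> : 2 * asin x = asin x *+ 2 by rewrite mulr_natl.
rewrite sin_mulr2n cos_mulr2n cos_asin// sx sqr_sqrtr; last by nra.
by split; rewrite -mulr_natr; ring.
Qed.

Section Modes.
Context {R : realType} {V E : finType} (src tgt : E -> V) (len : E -> R).
Hypothesis len0 : forall e, 0 < len e.
Variable (S : {set E}).

(** The angle per cell: 2 sin (th / 2) = sqrt lam * h on a fine mesh. *)
Definition mode_angle m lam e : R := 2 * asin (Num.sqrt lam * (len e / m.+1%:R) / 2).

Definition mode_val m lam (A B : E -> R) e (j : nat) : R :=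
  A e * cos (j%:R * mode_angle m lam e) + B e * sin (j%:R * mode_angle m lam e).

(** A discrete eigenvector, described by data whose types do not depend on the
    mesh so that they can converge when the mesh is refined. *)
Record discrete_mode m lam (A B : E -> R) (y : V -> R) : Prop := DiscreteMode {
  mode_norm : \sum_(e in S) (A e ^+ 2 + B e ^+ 2) = 1;
  mode_bound : forall e, -1 <= A e <= 1 /\ -1 <= B e <= 1;
  mode_bound_vertex : forall v, -2 <= y v <= 2;
  mode_src : forall e, e \in S -> A e = y (src e);
  mode_tgt : forall e, e \in S -> mode_val m lam A B e m.+1 = y (tgt e);
  mode_kirchhoff : forall v,
    \sum_(e in S)
      ((mode_val m lam A B e m.+1 - mode_val m lam A B e m) / (len e / m.+1%:R) * (tgt e == v)%:R
       + - ((mode_val m lam A B e 1%N - mode_val m lam A B e 0%N) / (len e / m.+1%:R)) * (src e == v)%:R) =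
    lam * \sum_(e in S)
      (len e / m.+1%:R / 2 * mode_val m lam A B e m.+1 * (tgt e == v)%:R
       + len e / m.+1%:R / 2 * mode_val m lam A B e 0%N * (src e == v)%:R) }.

Lemma mode_of_eigenvector m (w : (V + E * 'I_m.+1)%type -> R) lam :
  0 < lam -> (forall e, Num.sqrt lam * (len e / m.+1%:R) / 2 < 1) ->
  (exists2 x, touched (@cell_s V E src tgt m) (@cell_t V E src tgt m) (cells m S) x & w x != 0) ->
  (forall z, dform (@cell_s V E src tgt m) (@cell_t V E src tgt m) (@cell_h R E len m) (cells m S) w z =
    lam * mass (@cell_s V E src tgt m) (@cell_t V E src tgt m) (@cell_h R E len m) (cells m S) (fun x => w x * z x)) ->
  exists A B y, discrete_mode m lam A B y.
Proof.
move=> lam0 small [x0 tx0 wx0] eqn.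
pose h e := len e / m.+1%:R; pose th := mode_angle m lam.
have h0 e : 0 < h e by rewrite divr_gt0.
have xp e : 0 < Num.sqrt lam * h e / 2 by rewrite divr_gt0// mulr_gt0// sqrtr_gt0.
have trig e : sin (th e) != 0 /\ 2 * cos (th e) = 2 - lam * h e ^+ 2.
  have [] := @double_asin R (Num.sqrt lam * h e / 2); first by rewrite ltW// small.
  rewrite -/(th e) => -> ->; split.
    rewrite mulf_neq0//; first by rewrite mulf_neq0// gt_eqF.
    rewrite gt_eqF// sqrtr_gt0 subr_gt0 -[ltRHS](expr1n _ 2) ltr_pXn2r ?nnegrE ?(ltW (xp e))//.
    exact: small.
  by rewrite !exprMn sqr_sqrtr ?(ltW lam0)//; field.
pose W e j := w (node src tgt m e j).
pose A0 e := W e 0%N; pose B0 e := (W e 1%N - W e 0%N * cos (th e)) / sin (th e).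
have WE e j : e \in S -> (j <= m.+1)%N ->
    W e j = A0 e * cos (j%:R * th e) + B0 e * sin (j%:R * th e).
  move=> eS jm; have [s0 c2] := trig e.
  apply: (cos_recurrence (k := m.+1)) => // i im.
  by rewrite c2 /W (eigenvector_inner len0 eqn).
pose N2 := \sum_(e in S) (A0 e ^+ 2 + B0 e ^+ 2).
have sq0 (G H : E -> R) e : 0 <= G e ^+ 2 + H e ^+ 2 by rewrite addr_ge0 ?sqr_ge0.
have N20 : 0 < N2.
  rewrite lt_neqAle eq_sym sumr_ge0 ?andbT//; apply/negP => /eqP N0.
  have [e [j [eS jm x0E]]] := touched_cells tx0.
  have AB : A0 e ^+ 2 + B0 e ^+ 2 = 0.
    have := N0; rewrite /N2 (bigD1 e)//= => /eqP.
    by rewrite paddr_eq0 ?sumr_ge0// => /andP[/eqP].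
  have /andP[/eqP/eqP A00 /eqP/eqP B00] : (A0 e ^+ 2 == 0) && (B0 e ^+ 2 == 0).
    by rewrite -paddr_eq0 ?sqr_ge0// AB.
  rewrite !sqrf_eq0 in A00 B00.
  by move: wx0; rewrite x0E -/(W e j) WE// (eqP A00) (eqP B00) !mul0r addr0 eqxx.
pose k := (Num.sqrt N2)^-1.
have k2 : k ^+ 2 * N2 = 1 by rewrite exprVn sqr_sqrtr ?(ltW N20)// mulVf// gt_eqF.
pose A e := if e \in S then k * A0 e else 0.
pose B e := if e \in S then k * B0 e else 0.
have mv e j : e \in S -> (j <= m.+1)%N -> mode_val m lam A B e j = k * W e j.
  by move=> eS jm; rewrite WE// /mode_val /A /B eS -/(th e); ring.
have norm1 : \sum_(e in S) (A e ^+ 2 + B e ^+ 2) = 1.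
  rewrite -k2 /N2 big_distrr; apply: eq_bigr => e eS /=.
  by rewrite /A /B eS; ring.
have AB1 e : A e ^+ 2 + B e ^+ 2 <= 1.
  have [eS|eS] := boolP (e \in S); last by rewrite /A /B (negbTE eS) expr0n addr0.
  by rewrite -norm1 [leRHS](bigD1 e)//= lerDl sumr_ge0.
have bnd e : -1 <= A e <= 1 /\ -1 <= B e <= 1 by have := AB1 e; split; apply/andP; split; nra.
(* untouched vertices get the value 0 so that y is bounded everywhere *)
pose y v := if touched (@cell_s V E src tgt m) (@cell_t V E src tgt m) (cells m S) (inl v) then k * w (inl v) else 0.
have ysrc e : e \in S -> y (src e) = k * W e 0%N.
  move=> eS; rewrite /y ifT//; apply/existsP; exists (e, ord0).
  by rewrite inE/= eS/= /cell_s/= node0 eqxx.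
have ytgt e : e \in S -> y (tgt e) = k * W e m.+1.
  move=> eS; rewrite /y /W node_last ifT//; apply/existsP; exists (e, ord_max).
  by rewrite inE/= eS/= /cell_t/= node_last eqxx orbT.
exists A, B, y; split => //.
- move=> v; have [tv|/negbTE tv] := boolP (touched (@cell_s V E src tgt m) (@cell_t V E src tgt m) (cells m S) (inl v)); last first.
    by rewrite /y tv; apply/andP; split; lra.
  have [e [j [eS jm vE]]] := touched_cells tv.
  rewrite /y tv vE -/(W e j) -mv//.
  have [A1 B1] := bnd e; rewrite /mode_val -/(th e).
  have c1 := cos_le1 (j%:R * th e); have c2 := cos_geN1 (j%:R * th e).
  have s1 := sin_le1 (j%:R * th e); have s2 := sin_geN1 (j%:R * th e).
  by apply/andP; split; nra.
- by move=> e eS; rewrite ysrc// /A eS.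
- by move=> e eS; rewrite ytgt// mv.
- move=> v; have := eigenvector_vertex eqn v => /(congr1 (fun x => k * x)).
  rewrite mulrCA !big_distrr/= => H.
  transitivity (\sum_(i in S) k * ((W i m.+1 - W i m) / h i * (tgt i == v)%:R + - ((W i 1%N - W i 0%N) / h i) * (src i == v)%:R)).
    by apply: eq_bigr => e eS; rewrite !mv// /h; ring.
  rewrite H; apply: eq_bigr => e eS.
  by rewrite !mv// /W; ring.
Qed.

End Modes.

(** * From discrete modes to eigenfunctions *)

Lemma asin_quotient_cvg {R : realType} : (asin x / x : R) @[x --> 0^'] --> (1 : R).
Proof.
have d : is_derive (0 : R) 1 (@asin R) 1.
  have := @is_derive1_asin R 0; rewrite expr0n subr0 sqrtr1 invr1; apply.
  by apply/andP; split; lra.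
have asin0 : asin 0 = 0 :> R.
  rewrite -[X in asin X](sin0 R) sinK// in_itv/=.
  have := @pi_gt0 R; lra.
have : (h^-1 *: ((asin \o shift 0) (h *: (1 : R)) - asin 0) : R) @[h --> 0^'] --> (1 : R).
  rewrite -[X in _ --> X](@derive_val _ _ _ _ _ _ _ d); exact: (@ex_derive _ _ _ _ _ _ _ d).
apply: cvg_trans; apply: near_eq_cvg; near=> x.
by rewrite /= asin0 subr0 addr0 [x *: 1]mulr1 [LHS]mulrC.
Unshelve. all: by end_near. Qed.

Section ModeLimit.
Context {R : realType} {V E : finType} (src tgt : E -> V) (len : E -> R).
Hypothesis len0 : forall e, 0 < len e.
Variable (S : {set E}).
Context (U : set_system nat) {UU : UltraFilter U}.
Hypothesis Uoo : \oo `<=` U.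

Lemma cvg_near_eq (f g : nat -> R) (a b : R) :
  f @ U --> a -> g @ U --> b -> U [set n | f n = g n] -> a = b.
Proof.
move=> fa gb fg; apply: (@cvg_unique _ (@Rhausdorff R) (f @ U)) => //.
move=> /=; apply: cvg_trans gb; apply: near_eq_cvg.
by apply: filterS fg => n /= ->.
Qed.

Variables (lam_ : nat -> R) (A_ B_ : nat -> E -> R) (y_ : nat -> V -> R) (c mu : R).
Hypothesis c0 : 0 < c.
Hypothesis mode_ : U [set m | c <= lam_ m <= mu /\
  discrete_mode src tgt len S m (lam_ m) (A_ m) (B_ m) (y_ m)].

(** All the bounded coefficients converge along the ultrafilter U; m.+1 times the
    angle per cell tends to k * len e because asin x is equivalent to x, and the
    right-hand side of the discrete Kirchhoff condition vanishes with the length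
    of the cells.  The bound c keeps the limit k away from 0. *)
Lemma mode_limit : exists (k : R) (A B : E -> R) (y : V -> R),
  [/\ 0 < k, k ^+ 2 <= mu,
      \sum_(e in S) (A e ^+ 2 + B e ^+ 2) = 1 &
   [/\ forall e, e \in S -> A e = y (src e),
       forall e, e \in S ->
         A e * cos (k * len e) + B e * sin (k * len e) = y (tgt e) &
       forall v, \sum_(e in S)
         (k * (B e * cos (k * len e) - A e * sin (k * len e)) * (tgt e == v)%:R
          - k * B e * (src e == v)%:R) = 0]].
Proof.
have lims (x : nat -> R) (a b : R) : (forall m, discrete_mode src tgt len S m (lam_ m) (A_ m) (B_ m) (y_ m) -> a <= x m <= b) ->
    {l : R | x @ U --> l}.
  move=> xab; apply: cid; have [|l _ xl] := @ultra_bounded_cvg R _ U _ x a b.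
    by apply: filterS mode_ => m [_ /xab].
  by exists l.
have [A AP] := all_sig (fun e => lims (A_ ^~ e) (-1) 1 (fun m d => (mode_bound d e).1)).
have [B BP] := all_sig (fun e => lims (B_ ^~ e) (-1) 1 (fun m d => (mode_bound d e).2)).
have [y yP] := all_sig (fun v => lims (y_ ^~ v) (-2) 2 (fun m d => mode_bound_vertex d v)).
have [lam /andP[clam lammu] lamP] : exists2 l, c <= l <= mu & lam_ @ U --> l.
  by apply: ultra_bounded_cvg; apply: filterS mode_ => m [].
have lam0 : 0 < lam by exact: lt_le_trans clam.
pose k : R := Num.sqrt lam.
have k0 : 0 < k by rewrite sqrtr_gt0.
have kP : (fun m => Num.sqrt (lam_ m)) @ U --> k.
  exact: (continuous_cvg _ (@sqrt_continuous R lam)).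
have invP : (fun m => m.+1%:R^-1 : R) @ U --> 0.
  apply: cvg_trans (@cvg_harmonic R) => P; exact: Uoo.
have hP e : (fun m => len e / m.+1%:R) @ U --> 0.
  by rewrite -[X in _ --> X](mulr0 (len e)); apply: cvgM => //; exact: cvg_cst.
pose x_ e m : R := Num.sqrt (lam_ m) * (len e / m.+1%:R) / 2.
have xP e : x_ e @ U --> 0.
  rewrite -[X in _ --> X](mul0r (2^-1)) -[X in X / _](mulr0 k); apply: cvgM; last exact: cvg_cst.
  exact: cvgM.
have x1 : U [set m | forall e, x_ e m < 1].
  by apply: filter_forall => e; apply: cvgr_lt (xP e) _ _.
have lamp : U [set m | 0 < lam_ m].
  by apply: filterS mode_ => m [/andP[cl _] _]; exact: lt_le_trans cl.
have xp m e : 0 < lam_ m -> 0 < x_ e m.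
  by move=> lp; rewrite divr_gt0// mulr_gt0 ?sqrtr_gt0// divr_gt0.
have angleP e : (fun m => m.+1%:R * mode_angle len m (lam_ m) e) @ U --> k * len e.
  have q1 : (fun m => asin (x_ e m) / x_ e m) @ U --> (1 : R).
    have : x_ e @ U --> (0 : R)^'.
      move=> P [r r0 rP]; have xr : U [set m | `|x_ e m| < r].
        by have /cvgr0Pnorm_lt := xP e; apply.
      suff : U [set m | P (x_ e m)] by [].
      apply: filterS (filterI xr lamp) => m [xmr lp] /=.
      by apply: rP => /=; rewrite ?sub0r ?normrN// gt_eqF// xp.
    by move=> x0; exact: (cvg_comp (x_ e) (fun x => asin x / x) x0 asin_quotient_cvg).
  have : (fun m => Num.sqrt (lam_ m) * len e * (asin (x_ e m) / x_ e m)) @ U --> k * len e.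
    rewrite -[X in _ --> X]mulr1; apply: cvgM => //; apply: cvgM => //; exact: cvg_cst.
  apply: cvg_trans; apply: near_eq_cvg; apply: filterS lamp => m lp.
  have := xp m e lp; rewrite /mode_angle -/(x_ e m) => xn.
  have mn : m.+1%:R != 0 :> R by rewrite pnatr_eq0.
  have xE : x_ e m = Num.sqrt (lam_ m) * len e / (2 * m.+1%:R).
    by rewrite /x_; move: (m.+1%:R : R) mn => r mn; field.
  rewrite (_ : Num.sqrt _ * len e = 2 * m.+1%:R * x_ e m); last first.
    by rewrite xE; move: (m.+1%:R : R) mn => r mn; field.
  by field; rewrite gt_eqF.
have cosP e : (fun m => cos (m.+1%:R * mode_angle len m (lam_ m) e)) @ U --> cos (k * len e).
  exact: (continuous_cvg _ (@continuous_cos R _)).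
have sinP e : (fun m => sin (m.+1%:R * mode_angle len m (lam_ m) e)) @ U --> sin (k * len e).
  exact: (continuous_cvg _ (@continuous_sin R _)).
have valP e : (fun m => mode_val len m (lam_ m) (A_ m) (B_ m) e m.+1) @ U -->
    A e * cos (k * len e) + B e * sin (k * len e).
  by apply: cvgD; apply: cvgM.
(* sin th = g_ * h and 1 - cos th = r_ * h, with h the length of a cell *)
pose g_ e m : R := Num.sqrt (lam_ m) * Num.sqrt (1 - x_ e m ^+ 2).
have gP e : g_ e @ U --> k.
  rewrite -[X in _ --> X]mulr1 -[X in _ * X](sqrtr1 R); apply: cvgM => //.
  apply: (continuous_cvg _ (@sqrt_continuous R 1)).
  rewrite -[X in _ --> X]subr0 -[X in _ - X](mulr0 0); apply: cvgB; first exact: cvg_cst.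
  exact: cvgM.
pose r_ e m : R := lam_ m * (len e / m.+1%:R) / 2.
have rP e : r_ e @ U --> 0.
  rewrite -[X in _ --> X](mul0r (2^-1)) -[X in X / _](mulr0 lam); apply: cvgM; last exact: cvg_cst.
  exact: cvgM.
have trig : U [set m | forall e, sin (mode_angle len m (lam_ m) e) = g_ e m * (len e / m.+1%:R) /\
    cos (mode_angle len m (lam_ m) e) = 1 - r_ e m * (len e / m.+1%:R)].
  apply: filterS (filterI x1 lamp) => m [xl lp] e.
  have [] := @double_asin R (x_ e m); first by rewrite ltW ?xp//=; exact: xl.
  rewrite -/(mode_angle len m (lam_ m) e) => -> ->.
  have mn : m.+1%:R != 0 :> R by rewrite pnatr_eq0.
  split; last rewrite /x_ /r_ !exprMn sqr_sqrtr ?(ltW lp)//.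
    by rewrite /g_ {1}/x_; move: (Num.sqrt (1 - _)) => q; move: (m.+1%:R : R) mn => r mn; field.
  by move: (m.+1%:R : R) mn => r mn; field.
exists k, A, B, y; split => //.
- by rewrite sqr_sqrtr// ltW.
- apply: (@cvg_near_eq (fun m => \sum_(e in S) (A_ m e ^+ 2 + B_ m e ^+ 2)) (fun=> 1)).
  + apply: cvg_big; first exact: add_continuous.
    by move=> e _; apply: cvgD; apply: cvgM.
  + exact: cvg_cst.
  + by apply: filterS mode_ => m [_ []].
split.
- move=> e eS; apply: (@cvg_near_eq (A_ ^~ e) (y_ ^~ (src e))) => //.
  by apply: filterS mode_ => m [_ d]; exact: (mode_src d).
- move=> e eS; apply: (@cvg_near_eq _ (y_ ^~ (tgt e)) _ _ (valP e)) => //.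
  by apply: filterS mode_ => m [_ d]; exact: (mode_tgt d).
- move=> v.
  pose dn e m : R := A_ m e * (cos (m.+1%:R * mode_angle len m (lam_ m) e) * r_ e m - sin (m.+1%:R * mode_angle len m (lam_ m) e) * g_ e m)
     + B_ m e * (sin (m.+1%:R * mode_angle len m (lam_ m) e) * r_ e m + cos (m.+1%:R * mode_angle len m (lam_ m) e) * g_ e m).
  pose d0 e m : R := B_ m e * g_ e m - A_ m e * r_ e m.
  have dnP e : dn e @ U --> k * (B e * cos (k * len e) - A e * sin (k * len e)).
    rewrite (_ : k * _ = A e * (cos (k * len e) * 0 - sin (k * len e) * k) + B e * (sin (k * len e) * 0 + cos (k * len e) * k)); last by ring.
    by apply: cvgD; apply: cvgM => //; [apply: cvgB|apply: cvgD]; apply: cvgM.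
  have d0P e : d0 e @ U --> k * B e.
    rewrite (_ : k * _ = B e * k - A e * 0); last by ring.
    by apply: cvgB; apply: cvgM.
  pose rhs m : R := lam_ m * \sum_(e in S)
      (len e / m.+1%:R / 2 * mode_val len m (lam_ m) (A_ m) (B_ m) e m.+1 * (tgt e == v)%:R
       + len e / m.+1%:R / 2 * mode_val len m (lam_ m) (A_ m) (B_ m) e 0%N * (src e == v)%:R).
  have h2P e : (fun m => len e / m.+1%:R / 2) @ U --> 0.
    by rewrite -[X in _ --> X](mul0r (2^-1)); apply: cvgM => //; exact: cvg_cst.
  have rhsP : rhs @ U --> 0.
    rewrite -[X in _ --> X](mulr0 lam); apply: cvgM => //.
    rewrite -[X in _ --> X](_ : \sum_(e in S) (0 : R) = 0); last by rewrite big1.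
    apply: cvg_big; first exact: add_continuous.
    move=> e _; rewrite -[X in _ --> X](addr0 0); apply: cvgD.
      rewrite -[X in _ --> X](mul0r (tgt e == v)%:R); apply: cvgM; last exact: cvg_cst.
      rewrite -[X in _ --> X](mul0r (A e * cos (k * len e) + B e * sin (k * len e))).
      exact: cvgM.
    rewrite -[X in _ --> X](mul0r (src e == v)%:R); apply: cvgM; last exact: cvg_cst.
    rewrite -[X in _ --> X](mul0r (A e)); apply: cvgM => //.
    rewrite (_ : (fun m => mode_val _ _ _ _ _ _ _) = A_ ^~ e)//.
    by apply/funext => m; rewrite /mode_val mul0r cos0 sin0 mulr1 mulr0 addr0.
  apply: (@cvg_near_eq (fun m => \sum_(e in S) (dn e m * (tgt e == v)%:R - d0 e m * (src e == v)%:R)) rhs) => //.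
    apply: cvg_big; first exact: add_continuous.
    by move=> e _; apply: cvgB; apply: cvgM => //; exact: cvg_cst.
  apply: filterS (filterI mode_ trig) => m [[_ d] tr] /=.
  rewrite /rhs -(mode_kirchhoff d v); apply: eq_bigr => e eS.
  have [sE cE] := tr e; have hn : len e / m.+1%:R != 0 by rewrite gt_eqF// divr_gt0.
  rewrite /mode_val mul0r mul1r cos0 sin0.
  have -> : m%:R * mode_angle len m (lam_ m) e = m.+1%:R * mode_angle len m (lam_ m) e - mode_angle len m (lam_ m) e.
    by rewrite -natr1; ring.
  rewrite cosB sinB sE cE /dn /d0.
  move: (len e / _) hn => h hn; field; exact: hn.
Qed.

End ModeLimit.

Section DiscretePoincare.
Context {R : realType} {V E : finType} (src tgt : E -> V) (len : E -> R).
Hypothesis len0 : forall e, 0 < len e.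
Variables (S : {set E}) (mu1 : R).
Hypothesis conn : forall e e', e \in S -> e' \in S ->
  connect (edge_adj src tgt S) (src e) (src e').
Hypothesis no_small_mode : forall (k : R) (A B : E -> R) (y : V -> R),
  0 < k -> \sum_(e in S) (A e ^+ 2 + B e ^+ 2) = 1 ->
  (forall e, e \in S -> A e = y (src e)) ->
  (forall e, e \in S -> A e * cos (k * len e) + B e * sin (k * len e) = y (tgt e)) ->
  (forall v, \sum_(e in S)
     (k * (B e * cos (k * len e) - A e * sin (k * len e)) * (tgt e == v)%:R
      - k * B e * (src e == v)%:R) = 0) ->
  mu1 <= k ^+ 2.

Local Notation cs := (@cell_s V E src tgt _).
Local Notation ct := (@cell_t V E src tgt _).
Local Notation ch := (@cell_h R E len _).

(** Otherwise the meshes on which the inequality fails belong to some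
    nonprincipal ultrafilter, along which the corresponding eigenvectors converge
    to a mode with k ^ 2 <= mu < mu1. *)
Lemma discrete_poincare mu : mu < mu1 -> \forall m \near \oo,
  forall w : (V + E * 'I_m.+1)%type -> R, mass cs ct ch (cells m S) w = 0 ->
    mu * mass cs ct ch (cells m S) (fun x => w x ^+ 2) <=
    dform cs ct ch (cells m S) w w.
Proof.
move=> mumu1.
pose bad := [set m : nat | exists2 w : (V + E * 'I_m.+1)%type -> R,
  mass cs ct ch (cells m S) w = 0 &
  dform cs ct ch (cells m S) w w < mu * mass cs ct ch (cells m S) (fun x => w x ^+ 2)].
have [good|nongood] := pselect (\oo (~` bad)).
  apply: filterS good => m nb w mw; rewrite leNgt; apply/negP => lt.
  by apply: nb; exists w.
have pF : ProperFilter (within bad \oo).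
  split; last exact: within_filter.
  by move=> b0; apply: nongood; exact: b0.
have [U [UU Usub]] := ultraFilterLemma pF.
have Uoo : \oo `<=` U by move=> P Pn; apply: Usub; apply: filterS Pn => m Pm _.
have Ubad : U bad by apply: Usub; exists 0%N.
pose C := ((#|V|.+2)%:R * (\sum_(e in S) len e)) ^+ 2 : R.
have C0 : 0 <= C by exact: sqr_ge0.
have Usmall : U [set m | forall e, Num.sqrt mu * (len e / m.+1%:R) / 2 < 1].
  apply: filter_forall => e.
  have : (fun m => Num.sqrt mu * (len e / m.+1%:R) / 2) @ U --> (0 : R).
    rewrite -[X in _ --> X](mul0r (2^-1)) -[X in X / _](mulr0 (Num.sqrt mu)) -[X in _ * X / _](mulr0 (len e)).
    apply: cvgM; last exact: cvg_cst.
    apply: cvgM; first exact: cvg_cst.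
    apply: cvgM; first exact: cvg_cst.
    by apply: cvg_trans (@cvg_harmonic R) => P; exact: Uoo.
  by move=> /cvgr_lt; apply.
have modes (m : nat) : {q : R * (E -> R) * (E -> R) * (V -> R) |
    bad m -> (forall e, Num.sqrt mu * (len e / m.+1%:R) / 2 < 1) ->
    (C + 1)^-1 <= q.1.1.1 <= mu /\ discrete_mode src tgt len S m q.1.1.1 q.1.1.2 q.1.2 q.2}.
  apply: cid; have [bm|nb] := pselect (bad m); last by exists (0, fun=> 0, fun=> 0, fun=> 0).
  have [sm|ns] := pselect (forall e, Num.sqrt mu * (len e / m.+1%:R) / 2 < 1); last first.
    by exists (0, fun=> 0, fun=> 0, fun=> 0) => _ /ns.
  have [w0 mw0 ltw0] := bm.
  have [w [lam [/andP[lam0 lammu] [x tx wx] mw eqn]]] :=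
    discrete_eigenvector (@cell_h_gt0 R E len len0 m) mw0 ltw0.
  have Mp := mass_sq_gt0 (@cell_h_gt0 R E len len0 m) tx wx.
  have lamC : (C + 1)^-1 <= lam.
    have C1 : 0 < C + 1 by rewrite ltr_wpDl.
    rewrite -div1r ler_pdivrMr//.
    have := crude_poincare len0 conn mw; rewrite eqn -/C.
    rewrite (_ : mass _ _ _ _ (fun x => w x * w x) = mass cs ct ch (cells m S) (fun x => w x ^+ 2)); last first.
      by congr (mass _ _ _ _ _); apply/funext => z; rewrite expr2.
    rewrite mulrA -[leLHS]mul1r ler_pM2r// => H; lra.
  have lamp : 0 < lam by apply: lt_le_trans lamC; rewrite invr_gt0 ltr_wpDl.
  have sm' e : Num.sqrt lam * (len e / m.+1%:R) / 2 < 1.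
    apply: le_lt_trans (sm e); rewrite ler_pM2r// ler_pM2r ?divr_gt0//.
    by rewrite ler_wsqrtr// ltW.
  have [A [B [y d]]] := mode_of_eigenvector len0 lamp sm' (ex_intro2 _ _ x tx wx) eqn.
  by exists (lam, A, B, y) => _ _; split => //=; rewrite lamC ltW.
have [q qP] := all_sig modes.
have [||k [A [B [y [k0 kmu norm1 [As At kir]]]]]] :=
    @mode_limit R V E src tgt len len0 S U UU Uoo (fun m => (q m).1.1.1) (fun m => (q m).1.1.2)
      (fun m => (q m).1.2) (fun m => (q m).2) (C + 1)^-1 mu.
- by rewrite invr_gt0 ltr_wpDl.
- by apply: filterS (filterI Ubad Usmall) => m [bm sm]; exact: qP.
by have := no_small_mode k0 norm1 As At kir; rewrite leNgt (le_lt_trans kmu mumu1).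
Qed.

End DiscretePoincare.

(** * One-sided derivatives *)

Section OneSided.
Context {R : realType}.
Implicit Types (A : set R) (g : R -> R) (x : R).

(** A contains a right neighbourhood of x, so that one-sided difference
    quotients from the right are allowed in [diff_quot_in A]. *)
Definition room_right A x := exists2 d, 0 < d & forall h, 0 < h < d -> A (x + h).
Definition room_left A x := exists2 d, 0 < d & forall h, 0 < h < d -> A (x - h).

Lemma room_right_within A x : room_right A x ->
  within [set h | A (x + h)] (0 : R)^' `<=` 0^'+.
Proof.
move=> [d d0 dA] P [r /= r0 rP].
exists (Num.min r d); first by rewrite /= lt_min r0 d0.
move=> h; rewrite /= sub0r normrN lt_min => /andP[hr hd] h0.
apply: rP; first by rewrite /= sub0r normrN.
- by rewrite gt_eqF.
- by apply: dA; rewrite h0 (le_lt_trans (ler_norm _)).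
Qed.

Lemma room_left_within A x : room_left A x ->
  within [set h | A (x + h)] (0 : R)^' `<=` 0^'-.
Proof.
move=> [d d0 dA] P [r /= r0 rP].
exists (Num.min r d); first by rewrite /= lt_min r0 d0.
move=> h; rewrite /= sub0r normrN lt_min => /andP[hr hd] h0.
apply: rP; first by rewrite /= sub0r normrN.
- by rewrite lt_eqF.
- rewrite -[h]opprK; apply: dA; rewrite oppr_gt0 h0/=.
  by rewrite (le_lt_trans _ hd)// -normrN ler_norm.
Qed.

Lemma within_proper A x : room_right A x \/ room_left A x ->
  ProperFilter (within [set h | A (x + h)] (0 : R)^').
Proof.
move=> rm; split; last exact: within_filter.
case: rm => [/room_right_within|/room_left_within] sub /sub; exact: filter_not_empty.
Qed.

Lemma derive_in_derive1 A g x : room_right A x \/ room_left A x ->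
  derivable g x 1 -> derivable_in A g x /\ derive_in A g x = derive1 g x.
Proof.
move=> rm dg; have pF := within_proper rm.
have H : diff_quot_in A g x --> derive1 g x.
  apply: cvg_within_filter; rewrite derive1E.
  rewrite (_ : (fun h => _) = fun h : R => h^-1 *: ((g \o shift x) (h *: (1 : R)) - g x)).
    exact: dg.
  by apply/funext => h; rewrite /= [h *: 1]mulr1 [h + x]addrC.
split; first exact: cvgP H.
exact: cvg_lim H.
Qed.

(** Touching from above by a parabola bounds the one-sided derivative; this is
    the only form in which first derivatives enter the comparison argument. *)
Lemma slope_right A g x a b r : room_right A x -> derivable_in A g x ->
  0 < r -> (forall y, 0 < y < r -> g (x + y) - g x <= a * y + b * y ^+ 2) ->
  derive_in A g x <= a.
Proof.
move=> rm dg r0 gr.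
have H : (h^-1 * (g (x + h) - g x) @[h --> 0^'+]) --> derive_in A g x.
  by apply: cvg_trans dg => P; exact: room_right_within.
have H' : ((a + b * h) @[h --> (0 : R)^'+]) --> a.
  rewrite -[X in _ --> X]addr0 -[X in _ + X](mulr0 b).
  apply: cvgD; first exact: cvg_cst.
  apply: cvgM; first exact: cvg_cst.
  exact: cvg_at_right_filter.
apply: (ler_cvg_to H H'); near=> h.
have h0 : 0 < h by [].
rewrite mulrC ler_pdivrMr//; have := gr h; rewrite h0/= => /(_ _)/le_trans; apply.
  by near: h; apply: nbhs_right_lt.
nra.
Unshelve. all: by end_near. Qed.

Lemma slope_left A g x a b r : room_left A x -> derivable_in A g x ->
  0 < r -> (forall y, 0 < y < r -> g (x - y) - g x <= a * y + b * y ^+ 2) ->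
  - derive_in A g x <= a.
Proof.
move=> rm dg r0 gr; rewrite lerNl.
have H : (h^-1 * (g (x + h) - g x) @[h --> 0^'-]) --> derive_in A g x.
  by apply: cvg_trans dg => P; exact: room_left_within.
have H' : ((- a + b * h) @[h --> (0 : R)^'-]) --> - a.
  rewrite -[X in _ --> X]addr0 -[X in _ + X](mulr0 b).
  apply: cvgD; first exact: cvg_cst.
  apply: cvgM; first exact: cvg_cst.
  exact: cvg_at_left_filter.
apply: (ler_cvg_to H' H); near=> h.
have h0 : h < 0 by [].
have := gr (- h); rewrite opprK oppr_gt0 h0/= sqrrN => /(_ _) gh.
rewrite [leRHS]mulrC ler_ndivlMr//; apply: le_trans (gh _) _.
  by rewrite ltrNl; near: h; apply: nbhs_left_gt; rewrite oppr_lt0.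
nra.
Unshelve. all: by end_near. Qed.

End OneSided.

(** * Trigonometric modes are eigenfunctions *)

Section TrigEigenfunction.
Context {R : realType}.

Lemma is_derive_trig (A B k x : R) :
  is_derive x 1 (fun z => A * cos (k * z) + B * sin (k * z))
    (k * (B * cos (k * x) - A * sin (k * x))).
Proof.
have dk : is_derive x 1 (fun z => k * z) k.
  by have := is_deriveZ k (is_derive_id x (1 : R)); rewrite [k%:A]mulr1.
have dc : is_derive x 1 (fun z => cos (k * z)) (- sin (k * x) * k).
  exact: (@is_derive1_comp _ cos (fun z => k * z) x).
have ds : is_derive x 1 (fun z => sin (k * z)) (cos (k * x) * k).
  exact: (@is_derive1_comp _ sin (fun z => k * z) x).
have := is_deriveD (is_deriveZ A dc) (is_deriveZ B ds).
suff -> : A *: (- sin (k * x) * k) + B *: (cos (k * x) * k) =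
  k * (B * cos (k * x) - A * sin (k * x)) by [].
by rewrite /GRing.scale/=; ring.
Qed.

Lemma derive1_trig (A B k : R) :
  derive1 (fun z => A * cos (k * z) + B * sin (k * z)) =
  fun x => (k * B) * cos (k * x) + (- (k * A)) * sin (k * x).
Proof.
apply/funext => x; rewrite derive1E (@derive_val _ _ _ _ _ _ _ (is_derive_trig A B k x)); ring.
Qed.

Lemma itv_room (l x : R) : 0 < l -> 0 <= x <= l ->
  room_right [set z | 0 <= z <= l] x \/ room_left [set z | 0 <= z <= l] x.
Proof.
move=> l0 /andP[x0 xl]; have [xl'|lx] := ltP x l.
  left; exists (l - x); first by rewrite subr_gt0.
  by move=> h /andP[h0 hl] /=; apply/andP; split; lra.
right; exists l => // h /andP[h0 hl] /=; apply/andP; split; lra.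
Qed.

Lemma mode_eigenvalue (G : graph_data R) (VD : {set vert G}) (ED : {set edge G})
    (tgt : edge G -> vert G) (len : edge G -> R) (k : R) (A B : edge G -> R) (y : vert G -> R) :
  (forall e, e \in ED -> far e = Some (len e, tgt e)) ->
  (forall e, e \in ED -> 0 < len e) ->
  0 < k -> \sum_(e in ED) (A e ^+ 2 + B e ^+ 2) = 1 ->
  (forall e, e \in ED -> A e = y (src e)) ->
  (forall e, e \in ED -> A e * cos (k * len e) + B e * sin (k * len e) = y (tgt e)) ->
  (forall v, \sum_(e in ED)
     (k * (B e * cos (k * len e) - A e * sin (k * len e)) * (tgt e == v)%:R
      - k * B e * (src e == v)%:R) = 0) ->
  eigenvalue_on VD ED (k ^+ 2).
Proof.
move=> farE len0 k0 norm1 As At kir.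
pose u e x := A e * cos (k * x) + B e * sin (k * x).
have du e x : derivable (u e) x 1 by have [] := is_derive_trig (A e) (B e) k x.
have closedE e : e \in ED -> eclosed e = [set z | 0 <= z <= len e].
  by move=> eE; rewrite /eclosed farE.
have din e x : e \in ED -> 0 <= x <= len e ->
    derivable_in (eclosed e) (u e) x /\ derive_in (eclosed e) (u e) x = derive1 (u e) x.
  move=> eE xl; rewrite closedE//; apply: derive_in_derive1; last exact: du.
  by apply: itv_room => //; exact: len0.
have uv e x v : e \in ED -> at_vertex e x v -> u e x = y v.
  move=> eE [[-> <-]|]; first by rewrite /u mulr0 cos0 sin0 mulr1 mulr0 addr0 As.
  by rewrite farE// => -[<- <-]; exact: At.
exists u; split.
- by move=> v e1 e2 x1 x2 E1 E2 v1 v2; rewrite (uv _ _ _ E1 v1) (uv _ _ _ E2 v2).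
- have [e eE AB] : exists2 e, e \in ED & (A e != 0) || (B e != 0).
    apply: contrapT => nE; have := norm1; rewrite big1 => [/esym/eqP|]; first by rewrite oner_eq0.
    move=> e eE; have [A0|An] := eqVneq (A e) 0; last by case: nE; exists e; rewrite ?An.
    have [B0|Bn] := eqVneq (B e) 0; last by case: nE; exists e; rewrite ?Bn ?orbT.
    by rewrite A0 B0 expr0n addr0.
  have le := len0 _ eE.
  have [A0|An] := eqVneq (A e) 0; last first.
    exists e, 0; split => //; first by rewrite closedE//= lexx ltW.
    by rewrite /u mulr0 cos0 sin0 mulr1 mulr0 addr0.
  rewrite A0 eqxx/= in AB.
  pose x := Num.min (len e) k^-1.
  have x0 : 0 < x by rewrite lt_min le invr_gt0.
  exists e, x; split => //; first by rewrite closedE//= ltW//= ge_min lexx.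
  rewrite /u A0 mul0r add0r mulf_neq0// gt_eqF// sin_gt0_pi//.
  rewrite mulr_gt0//=; apply: (@le_lt_trans _ _ 1).
    by rewrite -(mulfV (lt0r_neq0 k0)) ler_pM2l// ge_min lexx orbT.
  by apply: lt_le_trans (pi_ge2 R); lra.
- move=> e eE; rewrite /C1_in; split.
    by move=> x; rewrite {1}closedE// => xl; have [] := din e x eE xl.
  apply: (@subspace_eq_continuous _ _ _ (derive1 (u e))).
    move=> x; rewrite inE => xl; apply: esym.
    by rewrite {1}closedE// in xl; have [] := din e x eE xl.
  apply: continuous_subspaceT; rewrite derive1_trig => x.
  by apply: differentiable_continuous; apply/derivable1_diffP; have [] := is_derive_trig (k * B e) (- (k * A e)) k x.
- move=> e x eE _; rewrite derive1nS derive1n1 !derive1_trig.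
  by split; [have [] := is_derive_trig (k * B e) (- (k * A e)) k x|rewrite /u; ring].
- move=> v _; rewrite /outgoing_sum -[RHS]oppr0 -[in RHS](kir v) -sumrN.
  apply: eq_bigr => e eE; have le := len0 _ eE; rewrite farE//.
  have [|_ ->] := din e 0 eE; first by rewrite lexx ltW.
  have [|_ ->] := din e (len e) eE; first by rewrite lexx ltW.
  rewrite derive1_trig mulr0 cos0 sin0.
  by case: (src e == v); case: (tgt e == v); rewrite /=; ring.
Qed.

End TrigEigenfunction.

(** * A maximum principle *)

Section MaximumPrinciple.
Context {R : realType} {C : finType} (h : C -> R).
Hypothesis h0 : forall c, 0 < h c.
Variables (z : R -> C -> R -> R) (T0 T1 A r : R).
Hypotheses (A0 : 0 <= A) (r0 : 0 <= r).
Hypothesis z_cont : forall c, {within [set: R] `*` [set x | 0 <= x <= h c],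
  continuous (fun p : R * R => z p.1 c p.2)}.
Hypothesis z_init : forall c x, 0 <= x <= h c -> z T0 c x <= A.
Hypothesis z_inner : forall t c x, T0 < t <= T1 -> 0 < x < h c ->
  (forall y, 0 <= y <= h c -> z t c y <= z t c x) -> A < z t c x ->
  exists2 d, is_derive t 1 (fun s => z s c x) d & d < r * z t c x.
Hypothesis z_node : forall t c x, T0 < t <= T1 -> x = 0 \/ x = h c ->
  (forall c' y, 0 <= y <= h c' -> z t c' y <= z t c x) -> A < z t c x -> False.

(** The function z * exp (- r (t - T0)) has a maximum over [T0, T1] and all the
    cells.  If it exceeds A, it is reached neither at T0, nor at the end of a
    cell, nor inside a cell, where the derivative in time would be at least
    r * z. *)
Lemma max_principle t c x : T0 <= t <= T1 -> 0 <= x <= h c ->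
  z t c x <= A * expR (r * (t - T0)).
Proof.
move=> tT xh.
pose w (t : R) := expR (- (r * (t - T0))).
pose g c (p : R * R) := z p.1 c p.2 * w p.1.
pose D c := [set s : R | T0 <= s <= T1] `*` [set x : R | 0 <= x <= h c].
have w_cont : continuous w.
  move=> s; apply: continuous_comp; last exact: continuous_expR.
  apply: continuousN; apply: continuousM; first exact: cst_continuous.
  by apply: continuousB; [exact: cvg_id|exact: cst_continuous].
have itvE (a b : R) : [set s : R | a <= s <= b] = [set` `[a, b]].
  by apply/seteqP; split => s /=; rewrite in_itv.
have gmax c' : exists2 p, D c' p & forall q, D c' q -> g c' q <= g c' p.
  have [|||p pD pmax] := @compact_EVT_max _ R (g c') (D c').
  - exists (t, 0); split => //=.
    by rewrite lexx ltW.
  - by rewrite /D !itvE; apply: compact_setX; exact: segment_compact.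
  - have : {within D c', continuous (fun p : R * R => z p.1 c' p.2)}.
      by apply: continuous_subspaceW (z_cont (c := c')) => q [_ qx].
    move=> zc q; apply: (@continuousM _ (subspace (D c'))); first exact: zc.
    apply: (@continuous_subspaceT _ _ (D c') (w \o fst)) => {}q.
    by apply: continuous_comp; [exact: cvg_fst|exact: w_cont].
  - by exists p; [rewrite inE in pD|move=> q qD; apply: pmax; rewrite inE].
have [P Pmax] := all_sig2 (fun c => cid2 (gmax c)) => PD; move: Pmax => PDom.
have [c' _ c'max] := @Order.TotalTheory.arg_maxP _ _ C c xpredT (fun c => g c (P c)) isT.
have gle d s y : T0 <= s <= T1 -> 0 <= y <= h d -> g d (s, y) <= g c' (P c').
  by move=> sT yh; apply: le_trans (PD d (s, y) _) (c'max d isT).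
have [gA|Ag] := leP (g c' (P c')) A.
  have := le_trans (gle c t x tT xh) gA.
  by rewrite /g /w/= expRN -ler_pdivlMr ?invr_gt0 ?expR_gt0// invrK.
exfalso; move: Ag gle; have := PDom c'; case: (P c') => ts xs.
move=> [/= tsT xsh] Ag gle.
have ts0 : T0 < ts.
  rewrite lt_neqAle; case/andP: (tsT) => -> _; rewrite andbT; apply/eqP => ts0.
  by move: Ag; rewrite /g /w/= -ts0 subrr mulr0 oppr0 expR0 mulr1 ltNge z_init.
have wp s : 0 < w s by exact: expR_gt0.
have w1 : w ts <= 1.
  by rewrite /w -expR0 ler_expR oppr_le0 mulr_ge0// subr_ge0 ltW.
have zA : A < z ts c' xs.
  rewrite ltNge; apply/negP => zA; move: Ag; rewrite /g/= ltNge => /negP; apply.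
  by apply: le_trans (ler_wpM2r (ltW (wp ts)) zA) _; rewrite ler_piMr.
have zmax d y : 0 <= y <= h d -> z ts d y <= z ts c' xs.
  by move=> yh; have := gle d ts y tsT yh; rewrite /g/= ler_pM2r.
have tsT' : T0 < ts <= T1 by rewrite ts0; case/andP: tsT.
have [xi|xb] := boolP (0 < xs < h c'); last first.
  apply: (z_node tsT' _ zmax zA); move: xb xsh.
  rewrite negb_and -!leNgt => /orP[xb|xb] /andP[xs0 xsh]; [left|right].
    by apply/eqP; rewrite eq_le xb.
  by apply/eqP; rewrite eq_le xsh.
have [d dz dlt] := z_inner tsT' xi (fun y => zmax c' y) zA.
pose phi s := z s c' xs * w s.
have dw : is_derive ts 1 w (- r * w ts).
  have da : is_derive ts 1 (fun s => - (r * (s - T0))) (- r).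
    have dr := is_deriveN (is_deriveZ r (is_deriveB (is_derive_id ts (1 : R)) (is_derive_cst T0 ts (1:R)))).
    by move: dr; rewrite subr0 [r%:A]mulr1.
  have := @is_derive1_comp _ expR (fun s => - (r * (s - T0))) ts _ _ (is_derive_expR _) da.
  by rewrite mulrC.
have dphi : is_derive ts 1 phi (z ts c' xs * (- r * w ts) + w ts * d).
  exact: (is_deriveM dz dw).
have room : room_left [set: R] ts by exists 1.
have [] := @derive_in_derive1 R [set: R] phi ts (or_intror room).
  by case: dphi.
rewrite derive1E (@derive_val _ _ _ _ _ _ _ dphi) => din dE.
have := @slope_left R [set: R] phi ts 0 0 (ts - T0) room din.
rewrite dE subr_gt0 => /(_ ts0) sl.
have : - (z ts c' xs * (- r * w ts) + w ts * d) <= 0.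
  apply: sl => y /andP[y0 yT]; rewrite !mul0r addr0 subr_le0.
  apply: (gle c' (ts - y) xs) => //.
  by case/andP: tsT => _ tsT1; apply/andP; split; lra.
rewrite oppr_le0 leNgt => /negP; apply.
rewrite (_ : _ + _ = w ts * (d - r * z ts c' xs)); last by ring.
by rewrite pmulr_rlt0// subr_lt0.
Qed.

End MaximumPrinciple.

(** * The bistable nonlinearity and its primitive *)

Section Nonlinearity.
Context {R : realType} (f : R -> R) (a : R).
Hypothesis Hf : bistable f a.
Local Notation F := (primitive f).

Lemma f_continuous : continuous f.
Proof.
by move=> x; apply: differentiable_continuous; apply/derivable1_diffP; exact: (bi_derivable Hf).
Qed.

Lemma primitive0 : F 0 = 0.
Proof. by rewrite /primitive lexx set_itv1 Rintegral_set1. Qed.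

(** The mean value theorem needs a derivative on an open set; F is therefore
    compared with a primitive G starting at -1. *)
Lemma primitive_mvt (x y : R) : 0 <= x -> x <= y ->
  exists2 xi, x <= xi <= y & F y - F x = f xi * (y - x).
Proof.
move=> x0; rewrite le_eqVlt => /orP[/eqP <-|xy].
  by exists x; rewrite ?lexx// !subrr mulr0.
pose G (z : R) : R := \int[lebesgue_measure]_(r in `[-1, z]) f r.
have dG (z : R) : -1 < z -> is_derive z 1 G (f z).
  move=> z1.
  have [] := @continuous_FTC1_closed R f (-1) z (z + 1) _ _ z1 (@f_continuous z).
  - by rewrite ltrDl.
  - apply: continuous_compact_integrable; first exact: segment_compact.
    by apply: continuous_subspaceT; exact: f_continuous.
  move=> dd <-; rewrite derive1E; exact: derivableP.
have G_cont (z : R) : -1 < z -> {for z, continuous G}.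
  by move=> z1; apply: differentiable_continuous; apply/derivable1_diffP; case: (dG z z1).
have FG (z : R) : 0 <= z -> F z = G z - G 0.
  rewrite le_eqVlt => /orP[/eqP <-|z0]; first by rewrite primitive0 subrr.
  rewrite /primitive (ltW z0) /Rintegral (@continuous_FTC2 R f G 0 z)//.
  - by apply: continuous_subspaceT; exact: f_continuous.
  - split.
    + move=> t; rewrite in_itv/= => /andP[t0 _]; have t1 : -1 < t by lra.
      by case: (dG t t1).
    + apply: cvg_at_right_filter; apply: G_cont; lra.
    + apply: cvg_at_left_filter; apply: G_cont; lra.
  - move=> t; rewrite in_itv/= => /andP[t0 _]; rewrite derive1E.
    by apply: derive_val; apply: dG; lra.
rewrite FG ?(le_trans x0 (ltW xy))// FG//.
have [] := @MVT R G f x y xy.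
- by move=> t; rewrite in_itv/= => /andP[xt _]; apply: dG; lra.
- move=> t; apply: (@continuous_in_subspaceT _ _ [set` `[x, y]] G) => {}t.
  by rewrite inE/= in_itv/= => /andP[xt _]; apply: G_cont; lra.
move=> xi; rewrite in_itv/= => /andP[x1 y1] E.
exists xi; first by rewrite !ltW.
by rewrite -E; ring.
Qed.

Lemma f_lipschitz : exists2 K, 1 <= K & forall x y : R,
  -1 <= x <= 2 -> -1 <= y <= 2 -> `|f x - f y| <= K * `|x - y|.
Proof.
have [c _ cmax] : exists2 c, c \in `[(-1 : R), 2] & forall t, t \in `[(-1 : R), 2] -> `|derive1 f t| <= `|derive1 f c|.
  apply: (@EVT_max R (fun t => `|derive1 f t|)); first lra.
  apply: continuous_subspaceT => x; apply: continuous_comp; first exact: (bi_C1 Hf).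
  exact: norm_continuous.
exists (1 + `|derive1 f c|); first by rewrite lerDl.
suff H x y : -1 <= x -> y <= 2 -> x < y -> `|f x - f y| <= (1 + `|derive1 f c|) * `|x - y|.
  move=> x y /andP[x1 x2] /andP[y1 y2]; have [xy|yx|->] := ltgtP x y.
  - exact: H.
  - by rewrite distrC [X in _ <= _ * X]distrC; exact: H.
  - by rewrite !subrr normr0 mulr0.
move=> x1 y2 xy; have [] := @MVT R f (derive1 f) x y xy.
- by move=> t _; rewrite derive1E; apply: derivableP; exact: (bi_derivable Hf).
- by apply: continuous_subspaceT; exact: f_continuous.
move=> xi; rewrite in_itv/= => /andP[xx xiy] E.
rewrite distrC E normrM [X in _ <= _ * X]distrC ler_wpM2r//.
apply: le_trans (cmax xi _) _; first by rewrite in_itv/=; apply/andP; split; lra.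
by rewrite lerDr.
Qed.

(** Near the stable state 0 differences of solutions are damped. *)
Lemma f_decreasing_near0 : exists e k : R, [/\ 0 < e <= 1, 0 < k <= 1 & forall x y : R,
  - e <= x -> y <= e -> x <= y -> f y - f x <= - k * (y - x)].
Proof.
have [f0 _ _] := bi_slopes Hf.
pose k := Num.min 1 (- derive1 f 0 / 2).
have k0 : 0 < k by rewrite lt_min ltr01 divr_gt0// oppr_gt0.
have kf : derive1 f 0 < - k.
  rewrite ltrNr; have : k <= - derive1 f 0 / 2 by rewrite ge_min lexx orbT.
  lra.
have : \forall x \near (0 : R), derive1 f x < - k.
  by apply: (@cvgr_lt _ _ (nbhs (0:R)) _ (derive1 f) (derive1 f 0)) => //; exact: (bi_C1 Hf).
move=> [d /= d0 dP]; exists (Num.min 1 (d / 2)), k; split.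
- by rewrite lt_min ltr01 divr_gt0//= ge_min lexx.
- by rewrite k0 ge_min lexx.
set e := Num.min _ _ => x y xe ye; rewrite le_eqVlt => /orP[/eqP ->|xy].
  by rewrite !subrr mulr0.
have [] := @MVT R f (derive1 f) x y xy.
- by move=> t _; rewrite derive1E; apply: derivableP; exact: (bi_derivable Hf).
- by apply: continuous_subspaceT; exact: f_continuous.
move=> xi; rewrite in_itv/= => /andP[xx xiy] ->; rewrite ler_wpM2r ?subr_ge0 ?(ltW xy)//.
apply/ltW/dP; rewrite /= sub0r normrN ltr_norml.
have ed : e <= d / 2 by rewrite ge_min lexx orbT.
by apply/andP; split; lra.
Qed.

Lemma a_bounds : 0 < a /\ a < 1.
Proof. by case/andP: (bi_a Hf). Qed.

Lemma f_zeros : [/\ f 0 = 0, f a = 0 & f 1 = 0]. Proof. exact: bi_zeros. Qed.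

Lemma f_le0 s : 0 <= s <= a -> f s <= 0.
Proof.
have [z0 za _] := f_zeros; move=> /andP[]; rewrite le_eqVlt => /orP[/eqP <- _|s0]; first by rewrite z0.
rewrite le_eqVlt => /orP[/eqP ->|sa]; first by rewrite za.
by apply/ltW/(bi_neg Hf); rewrite s0.
Qed.

Lemma f_ge0 s : a <= s <= 1 -> 0 <= f s.
Proof.
have [_ za z1] := f_zeros; move=> /andP[]; rewrite le_eqVlt => /orP[/eqP <- _|s0]; first by rewrite za.
rewrite le_eqVlt => /orP[/eqP ->|sa]; first by rewrite z1.
by apply/ltW/(bi_pos Hf); rewrite s0.
Qed.

Lemma primitive_min s : 0 <= s <= 1 -> F a <= F s.
Proof.
move=> /andP[s0 s1]; have [a0 a1] := a_bounds; have [sa|As] := leP s a.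
  have [xi /andP[x1 x2] E] := primitive_mvt s0 sa.
  have := @f_le0 xi; rewrite x2 (le_trans s0 x1) => /(_ erefl) fx.
  by rewrite -subr_le0 E mulr_le0_ge0// subr_ge0.
have [xi /andP[x1 x2] E] := primitive_mvt (ltW a0) (ltW As).
have := @f_ge0 xi; rewrite x1 (le_trans x2 s1) => /(_ erefl) fx.
by rewrite -subr_ge0 E mulr_ge0// subr_ge0 ltW.
Qed.

Lemma primitive_max s : 0 <= s <= 1 -> F s <= F 1.
Proof.
move=> /andP[s0 s1]; have [a0 a1] := a_bounds; have [sa|As] := leP s a.
  have [xi /andP[x1 x2] E] := primitive_mvt (lexx 0) s0.
  have := @f_le0 xi; rewrite x1 (le_trans x2 sa) => /(_ erefl) fx.
  apply: (@le_trans _ _ 0); last exact/ltW/(bi_mass Hf).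
  by move: E; rewrite primitive0 !subr0 => ->; rewrite mulr_le0_ge0.
have [xi /andP[x1 x2] E] := primitive_mvt s0 s1.
have := @f_ge0 xi; rewrite x2 (le_trans (ltW As) x1) => /(_ erefl) fx.
by rewrite -subr_ge0 E mulr_ge0// subr_ge0.
Qed.

Lemma primitive_gap : F a < F (a / 2) /\ forall s, 0 <= s <= a / 2 -> F (a / 2) <= F s.
Proof.
have [a0 a1] := a_bounds; split; last first.
  move=> s /andP[s0 s1]; have [xi /andP[x1 x2] E] := primitive_mvt s0 s1.
  have := @f_le0 xi; rewrite (le_trans s0 x1) (le_trans x2)//=; last lra.
  move=> /(_ erefl) fx.
  by rewrite -subr_le0 E mulr_le0_ge0// subr_ge0.
have [||x1 /andP[x11 x12] E1] := @primitive_mvt (a / 2) (3 * a / 4); [lra|lra|].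
have [||x2 /andP[x21 x22] E2] := @primitive_mvt (3 * a / 4) a; [lra|lra|].
have f1 : f x1 < 0 by apply: (bi_neg Hf); apply/andP; split; lra.
have f2 : f x2 <= 0 by apply: f_le0; apply/andP; split; lra.
nra.
Qed.

Lemma primitive_taylor K : 1 <= K -> (forall x y : R,
  -1 <= x <= 2 -> -1 <= y <= 2 -> `|f x - f y| <= K * `|x - y|) ->
  (forall x y : R, 0 <= x <= 1 -> 0 <= y <= 1 -> `|F x - F y| <= K * `|x - y|) /\
  (forall x e : R, 0 <= x -> 0 <= e -> x + e <= 1 -> e * f x - K * e ^+ 2 <= F (x + e) - F x).
Proof.
move=> K1 lip; have [z0 _ _] := f_zeros.
have fK s : 0 <= s <= 1 -> `|f s| <= K.
  move=> /andP[s0 s1]; have := lip s 0; rewrite z0 !subr0 (ger0_norm s0) => H.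
  apply: (le_trans (H _ _)); [apply/andP; split; lra|apply/andP; split; lra|nra].
have half x y : 0 <= x -> y <= 1 -> x <= y -> `|F y - F x| <= K * (y - x).
  move=> x0 y1 xy; have [xi /andP[x1 x2] ->] := primitive_mvt x0 xy.
  rewrite normrM (@ger0_norm _ (y - x)) ?subr_ge0// ler_wpM2r ?subr_ge0// fK//.
  by rewrite (le_trans x0 x1) (le_trans x2 y1).
split.
  move=> x y /andP[x0 x1] /andP[y0 y1]; have [xy|yx] := leP x y.
    by rewrite distrC (@ler0_norm _ (x - y)) ?subr_le0// opprB half.
  by rewrite (@ger0_norm _ (x - y)) ?subr_ge0 ?(ltW yx)// half// ltW.
move=> x e x0 e0 xe1; have [|xi /andP[x1 x2] ->] := @primitive_mvt x (x + e) x0; first by rewrite lerDl.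
rewrite [x + e]addrC addrK.
have := lip x xi => /(_ _ _)/(le_trans (ler_norm _)) H.
have {}H : f x - f xi <= K * `|x - xi| by apply: H; apply/andP; split; lra.
have d : `|x - xi| <= e by rewrite ler_norml; apply/andP; split; lra.
have {}H : f x - f xi <= K * e by apply: le_trans H _; rewrite ler_wpM2l//; lra.
nra.
Qed.

End Nonlinearity.

(** * Comparison with the interpolated supersolution *)

Section Comparison.
Context {R : realType} {C T : finType} (s t : C -> T) (h : C -> R) (P : {set C}).
Hypothesis h0 : forall c, 0 < h c.
Variables (f : R -> R) (K eta e0 k : R).
Hypotheses (K1 : 1 <= K) (eta0 : 0 < eta) (eta_le : eta <= e0) (e01 : e0 <= 1)
  (k0 : 0 < k) (k1 : k <= 1) (f00 : f 0 = 0).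
Hypothesis f_lip : forall x y : R, -1 <= x <= 2 -> -1 <= y <= 2 ->
  `|f x - f y| <= K * `|x - y|.
Hypothesis f_decr : forall x y : R, - e0 <= x -> y <= e0 -> x <= y ->
  f y - f x <= - k * (y - x).
Variables (w : T -> R) (b : T).
Hypotheses (w01 : forall x, 0 <= w x <= 1) (wb : w b = 1).
Hypothesis w_super : forall x, x != b ->
  f (w x) * mass s t h P (bump x) <= dform s t h P w (bump x).
Hypothesis w_osc : forall c, c \in P ->
  K * (`|w (t c) - w (s c)| + (K + 1) * h c ^+ 2) <= eta.

Local Ltac slra := move: (K1) (eta0) (eta_le) (e01) (k0) (k1) => ? ? ? ? ? ?; lra.

Let kap c : R := Num.min (f (w (s c))) (f (w (t c))) - eta.

(** The affine interpolation plus a quadratic term with second derivative -kap.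
    As kap is below f at both ends, the quadratic terms do not compensate the
    discrete supersolution inequality at the nodes, which becomes strict by the
    amount eta; as f varies little on a cell, the equation inside is violated by
    at most 2 * eta. *)
Definition interpolant c (x : R) : R :=
  w (s c) + (w (t c) - w (s c)) / h c * x + kap c * x * (h c - x) / 2.

Let f_bound (x : R) : 0 <= x <= 1 -> `|f x| <= K.
Proof.
move=> /andP[x0 x1]; have := @f_lip x 0; rewrite f00 !subr0 (ger0_norm x0) => H.
apply: (le_trans (H _ _)); [apply/andP; split; slra|apply/andP; split; slra|].
by rewrite ler_piMr// (le_trans ler01 K1).
Qed.

Let kap_bound c : `|kap c| <= K + 1.
Proof.
have := f_bound (w01 (s c)); have := f_bound (w01 (t c)).
rewrite /kap !ler_norml minEle => /andP[A1 A2] /andP[A3 A4].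
by case: ifP => _; apply/andP; split; slra.
Qed.

Let rho c : R := `|w (t c) - w (s c)| + (K + 1) * h c ^+ 2.

Let rho_le c : c \in P -> rho c <= eta.
Proof.
move=> /w_osc; apply: le_trans; rewrite -/(rho c) ler_peMl//.
by rewrite addr_ge0// mulr_ge0 ?sqr_ge0//; slra.
Qed.

Lemma interpolant_osc c x : 0 <= x <= h c ->
  `|interpolant c x - w (s c)| <= rho c /\ `|interpolant c x - w (t c)| <= rho c.
Proof.
move=> /andP[x0 xh]; have hc := h0 c; have := kap_bound c; rewrite ler_norml => /andP[q1 q2].
pose th := x / h c.
have th0 : 0 <= th by rewrite divr_ge0// ltW.
have th1 : th <= 1 by rewrite ler_pdivrMr// mul1r.
have -> : interpolant c x - w (s c) = (w (t c) - w (s c)) * th + kap c * (x * (h c - x) / 2).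
  by rewrite /interpolant /th; field; rewrite gt_eqF.
have -> : interpolant c x - w (t c) = - ((w (t c) - w (s c)) * (1 - th)) + kap c * (x * (h c - x) / 2).
  by rewrite /interpolant /th; field; rewrite gt_eqF.
set q := x * (h c - x) / 2.
have q0 : 0 <= q by rewrite divr_ge0// mulr_ge0// subr_ge0.
have qh : q <= h c ^+ 2 by rewrite /q; nra.
have kq : `|kap c * q| <= (K + 1) * h c ^+ 2.
  by rewrite normrM (ger0_norm q0) ler_pM// kap_bound.
split; apply: le_trans (ler_normD _ _) _; apply: lerD => //.
  by rewrite normrM (ger0_norm th0) ler_piMr.
by rewrite normrN normrM (@ger0_norm _ (1 - th)) ?subr_ge0// ler_piMr//; slra.
Qed.

Lemma interpolant_range c x : c \in P -> 0 <= x <= h c ->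
  - eta <= interpolant c x <= 1 + eta /\
  interpolant c x <= (w (s c) + w (t c)) / 2 + eta.
Proof.
move=> /rho_le re xh; have [] := interpolant_osc xh.
rewrite !ler_norml => /andP[a1 a2] /andP[a3 a4].
have /andP[s0 s1] := w01 (s c).
by split; [apply/andP; split; slra|slra].
Qed.

Lemma interpolant_source c x : c \in P -> 0 <= x <= h c ->
  f (interpolant c x) - kap c <= 2 * eta.
Proof.
move=> cP xh; have [os1 os2] := interpolant_osc xh; have [/andP[r1 r2] _] := interpolant_range cP xh.
have wi : -1 <= interpolant c x <= 2 by apply/andP; split; slra.
have wo y : -1 <= w y <= 2 by have /andP[? ?] := w01 y; apply/andP; split; slra.
have := w_osc cP; rewrite -/(rho c) => Kr.
have h1 : f (interpolant c x) - f (w (s c)) <= eta.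
  apply: (le_trans (ler_norm _)); apply: (le_trans (f_lip wi (wo _))); apply: le_trans Kr.
  by rewrite ler_wpM2l//; slra.
have h2 : f (interpolant c x) - f (w (t c)) <= eta.
  apply: (le_trans (ler_norm _)); apply: (le_trans (f_lip wi (wo _))); apply: le_trans Kr.
  by rewrite ler_wpM2l//; slra.
by rewrite /kap minEle; case: ifP => _; slra.
Qed.

Lemma interpolant_expand c x y : interpolant c y - interpolant c x =
  ((w (t c) - w (s c)) / h c + kap c * (h c / 2 - x)) * (y - x) + (- kap c / 2) * (y - x) ^+ 2.
Proof. by rewrite /interpolant; field; rewrite gt_eqF. Qed.

Lemma interpolant_s c : interpolant c 0 = w (s c).
Proof. by rewrite /interpolant !mulr0 !mul0r !addr0. Qed.

Lemma interpolant_t c : interpolant c (h c) = w (t c).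
Proof. by rewrite /interpolant subrr mulr0 mul0r addr0 divfK ?gt_eqF// addrC subrK. Qed.

Variables (U : R -> C -> R -> R) (Y : R -> T -> R) (Ds Dt : R -> C -> R).
Hypothesis U_cont : forall c, c \in P -> {within [set: R] `*` [set x | 0 <= x <= h c],
  continuous (fun p : R * R => U p.1 c p.2)}.
Hypothesis U_range : forall (tau : R) c (x : R), c \in P -> 0 <= x <= h c -> 0 < U tau c x < 1.
Hypothesis U_s : forall (tau : R) c, c \in P -> U tau c 0 = Y tau (s c).
Hypothesis U_t : forall (tau : R) c, c \in P -> U tau c (h c) = Y tau (t c).
Hypothesis U_eqn : forall (tau : R) c (x : R), c \in P -> 0 < x < h c ->
  exists d g : R, [/\ is_derive tau 1 (fun tau => U tau c x) d, d = g + f (U tau c x) &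
    forall al be r : R, 0 < r ->
      (forall y : R, `|y - x| < r -> U tau c y - U tau c x <= al * (y - x) + be * (y - x) ^+ 2) ->
      g <= 2 * be].
Hypothesis U_Ds : forall (tau : R) c (al be : R), c \in P ->
  (forall y : R, 0 < y < h c -> U tau c y - U tau c 0 <= al * y + be * y ^+ 2) -> Ds tau c <= al.
Hypothesis U_Dt : forall (tau : R) c (al be : R), c \in P ->
  (forall y : R, 0 < y < h c -> U tau c (h c - y) - U tau c (h c) <= al * y + be * y ^+ 2) ->
  Dt tau c <= al.
Hypothesis U_kirchhoff : forall (tau : R) x, x != b ->
  \sum_(c in P) (Dt tau c * (t c == x)%:R + Ds tau c * (s c == x)%:R) = 0.
Hypothesis U_decay : forall e : R, 0 < e -> exists T0 : R, forall (tau : R) c (x : R), tau <= T0 -> c \in P ->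
  0 <= x <= h c -> U tau c x <= e.

(** At a maximum of U - interpolant all the outgoing slopes of U are at most those
    of the interpolant; their sum is 0 for U, by Kirchhoff's condition, and
    negative for the interpolant. *)
Lemma no_max_at_node (tau : R) x (A : R) : 0 <= A -> touched s t P x ->
  A < Y tau x - w x ->
  (forall c (y : R), c \in P -> 0 <= y <= h c -> U tau c y - interpolant c y <= Y tau x - w x) ->
  False.
Proof.
move=> A0 tx Ax zmax.
have [xb|xb] := eqVneq x b.
  move: Ax; rewrite xb wb; case/existsP: tx => c /andP[cP]; rewrite xb.
  have h1 := U_range tau cP; have hc := h0 c.
  case/orP => /eqP <-; [have := h1 0|have := h1 (h c)].
    by rewrite U_s// lexx ltW// => /(_ erefl)/andP[_ ?] ?; slra.
  by rewrite U_t// lexx ltW// => /(_ erefl)/andP[_ ?] ?; slra.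
have ds c : c \in P -> s c = x -> Ds tau c <= (w (t c) - w (s c)) / h c + kap c * (h c / 2).
  move=> cP sx; rewrite -[h c / 2]subr0; apply: (@U_Ds _ _ _ (- kap c / 2)) => // y /andP[y0 yh].
  have := interpolant_expand c 0 y; rewrite !subr0 => <-.
  rewrite U_s// interpolant_s sx; have := zmax c y cP.
  by rewrite (ltW y0) (ltW yh) => /(_ erefl); slra.
have dt c : c \in P -> t c = x -> Dt tau c <= - ((w (t c) - w (s c)) / h c) + kap c * (h c / 2).
  move=> cP tx'; apply: (@U_Dt _ _ _ (- kap c / 2)) => // y /andP[y0 yh].
  have := interpolant_expand c (h c) (h c - y).
  rewrite interpolant_t U_t// tx' => E.
  have := zmax c (h c - y) cP; rewrite subr_ge0 (ltW yh) lerBlDr lerDl (ltW y0) => /(_ erefl).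
  by move: E; rewrite (_ : h c - y - h c = - y) ?sqrrN; [slra|ring].
have mass_pos : 0 < mass s t h P (bump x).
  rewrite (_ : bump x = fun y => bump x y ^+ 2).
    by apply: (mass_sq_gt0 h0 tx); rewrite /bump eqxx oner_eq0.
  by apply/funext => y; rewrite /bump; case: eqP; rewrite ?expr1n ?expr0n.
have := w_super xb; rewrite -subr_ge0 => super.
have : \sum_(c in P) (Dt tau c * (t c == x)%:R + Ds tau c * (s c == x)%:R) <=
    - dform s t h P w (bump x) + (f (w x) - eta) * mass s t h P (bump x).
  rewrite /dform /mass big_distrr/= -sumrN -big_split/=; apply: ler_sum => c cP.
  have kx y : y = s c \/ y = t c -> kap c <= f (w y) - eta.
    by case=> ->; rewrite /kap lerB// ge_min lexx ?orbT.
  have hc := h0 c; set D := (w (t c) - w (s c)) / h c.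
  have -> : grad s t w c * grad s t (bump x) c / h c = D * (bump x (t c) - bump x (s c)).
    by rewrite /grad /D; ring.
  rewrite /bump; have [cx|] := eqVneq (t c) x; have [sx|] := eqVneq (s c) x => /=.
  - have := dt c cP cx; have := ds c cP sx; rewrite -/D.
    have := kx (s c) (or_introl erefl); rewrite sx; nra.
  - have := dt c cP cx; rewrite -/D.
    have := kx (t c) (or_intror erefl); rewrite cx; nra.
  - have := ds c cP sx; rewrite -/D.
    have := kx (s c) (or_introl erefl); rewrite sx; nra.
  - by move=> _ _; slra.
rewrite U_kirchhoff// => H.
have := mulr_gt0 eta0 mass_pos; slra.
Qed.

(** In the first case f (U) - f (interpolant) <= - k * (difference), and the bound
    3 * eta / k is preserved since 2 * eta < k * (3 * eta / k).  In the second
    case the difference grows at rate at most K, and the remaining 1 in the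
    exponent absorbs the source 2 * eta. *)
Lemma comparison_step (T0 T1 r : R) :
  (r = 0 /\ forall (tau : R) c (x : R), tau <= T1 -> c \in P -> 0 <= x <= h c -> U tau c x <= e0) \/
  r = K + 1 ->
  (forall c (x : R), c \in P -> 0 <= x <= h c -> U T0 c x - interpolant c x <= 3 * eta / k) ->
  forall (tau : R) c (x : R), T0 <= tau <= T1 -> c \in P -> 0 <= x <= h c ->
    U tau c x - interpolant c x <= 3 * eta / k * expR (r * (tau - T0)).
Proof.
move=> hr init tau c x tauT cP xh.
have A0 : 0 <= 3 * eta / k by rewrite divr_ge0// ltW//; slra.
have A3 : 3 * eta <= 3 * eta / k by rewrite ler_pdivlMr// ler_piMr//; slra.
have r0 : 0 <= r by case: hr => [[->//]|->]; slra.
pose CP := {c : C | c \in P}.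
apply: (@max_principle R CP (fun c => h (val c)) (fun c => h0 (val c))
  (fun tau c x => U tau (val c) x - interpolant (val c) x) T0 T1 (3 * eta / k) r A0 r0
  _ _ _ _ tau (exist _ c cP) x) => // {tau c cP x tauT xh}.
- move=> [c cP] /= p; apply: (@continuousB _ _ (subspace ([set: R] `*` [set x | 0 <= x <= h c]))).
    exact: U_cont.
  apply: (@continuous_subspaceT _ _ ([set: R] `*` [set x | 0 <= x <= h c]) (interpolant c \o snd)) => {}p.
  apply: continuous_comp; first exact: cvg_snd.
  have cp (q : R) : {for q, continuous (fun x : R => x)} by exact: cvg_id.
  rewrite /interpolant; apply: continuousD.
    apply: continuousD; first exact: cst_continuous.
    by apply: continuousM; [exact: cst_continuous|exact: cp].
  apply: continuousM; last exact: cst_continuous.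
  apply: continuousM; first by apply: continuousM; [exact: cst_continuous|exact: cp].
  by apply: continuousB; [exact: cst_continuous|exact: cp].
- by move=> [c cP] x /= xh; exact: init.
- move=> tau [c cP] x tauT /= xh zmax zA.
  have [d [g [dU dE gP]]] := U_eqn tau cP xh.
  have xh' : 0 <= x <= h c by case/andP: xh => *; rewrite !ltW.
  exists d.
    have := is_deriveB dU (is_derive_cst (interpolant c x) tau (1 : R)).
    by rewrite subr0.
  have gk : g <= - kap c.
    have -> : - kap c = 2 * (- kap c / 2) by field.
    have [x0 xhc] := andP xh.
    apply: (gP ((w (t c) - w (s c)) / h c + kap c * (h c / 2 - x)) _ (Num.min x (h c - x))).
      by rewrite lt_min x0 subr_gt0.
    move=> y; rewrite lt_min !ltr_norml => /andP[/andP[y1 y2] /andP[y3 y4]].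
    rewrite -interpolant_expand; have := zmax y; rewrite (_ : (0 <= y <= h c)); last by apply/andP; split; slra.
    move=> /(_ erefl); slra.
  have sr := interpolant_source cP xh'.
  have [/andP[i1 i2] _] := interpolant_range cP xh'.
  have /andP[u1 u2] := U_range tau cP xh'.
  rewrite dE; case: hr => [[-> small]|->].
    have ue : U tau c x <= e0 by apply: small => //; case/andP: tauT.
    have fd : f (U tau c x) - f (interpolant c x) <= - k * (U tau c x - interpolant c x).
      by apply: f_decr; slra.
    have : 3 * eta < k * (U tau c x - interpolant c x).
      by rewrite [ltRHS]mulrC -ltr_pdivrMr.
    by rewrite mul0r; slra.
  have ur : -1 <= U tau c x <= 2 by apply/andP; split; slra.
  have ir : -1 <= interpolant c x <= 2 by apply/andP; split; slra.
  have := f_lip ur ir; rewrite (@ger0_norm _ (U tau c x - _)); last slra.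
  move=> /(le_trans (ler_norm _)) fl.
  slra.
- move=> tau [c cP] x tauT /= xe zmax zA.
  have zmax' d y : d \in P -> 0 <= y <= h d -> U tau d y - interpolant d y <= U tau c x - interpolant c x.
    by move=> dP; exact: (zmax (exist _ d dP)).
  case: xe => xE; move: zA zmax'; rewrite xE.
    rewrite U_s// interpolant_s; apply: no_max_at_node => //.
    by apply/existsP; exists c; rewrite cP eqxx.
  rewrite U_t// interpolant_t; apply: no_max_at_node => //.
  by apply/existsP; exists c; rewrite cP eqxx orbT.
Qed.

(** The comparison starts at a time T0, depending on eta, where U <= eta; no
    constant depends on T0. *)
Lemma comparison (T1 : R) :
  (forall (tau : R) c (x : R), tau <= T1 -> c \in P -> 0 <= x <= h c -> U tau c x <= e0) ->
  forall (tau : R) c (x : R), T1 <= tau -> c \in P -> 0 <= x <= h c ->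
    U tau c x <= (w (s c) + w (t c)) / 2 + eta
      + 3 * eta / k * expR ((K + 1) * (tau - T1)).
Proof.
move=> small tau c x T1tau cP xh.
have A3 : 3 * eta <= 3 * eta / k by rewrite ler_pdivlMr// ler_piMr//; slra.
have early d y : d \in P -> 0 <= y <= h d -> U T1 d y - interpolant d y <= 3 * eta / k.
  have [T0 T0P] := U_decay eta0; pose T0' := Num.min T0 T1.
  move=> dP yh; have := @comparison_step T0' T1 0 (or_introl (conj erefl small)) _ T1 d y.
  rewrite mul0r expR0 mulr1; apply => //; last by rewrite lexx andbT ge_min lexx orbT.
  move=> d' y' d'P y'h; have := T0P T0' d' y' _ d'P y'h; rewrite ge_min lexx => /(_ erefl).
  have [/andP[? _] _] := interpolant_range d'P y'h; slra.
have := @comparison_step T1 tau (K + 1) (or_intror erefl) early tau c x.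
rewrite T1tau lexx => /(_ erefl cP xh).
have [_] := interpolant_range cP xh; slra.
Qed.

End Comparison.

(** * Solutions along one edge *)

Lemma within_continuous_precomp {S T W : topologicalType} (A : set S) (B : set T)
    (phi : S -> T) (F : T -> W) :
  continuous phi -> (forall x, A x -> B (phi x)) ->
  {within B, continuous F} -> {within A, continuous (fun x => F (phi x))}.
Proof.
move=> cphi AB /subspace_continuousP cF; apply/subspace_continuousP => x Ax Q nQ.
have H : nbhs (phi x) [set y | B y -> Q (F y)] := cF (phi x) (AB x Ax) Q nQ.
suff : nbhs x [set y | A y -> Q (F (phi y))] by [].
have H2 : nbhs x [set y | B (phi y) -> Q (F (phi y))] := cphi x _ H.
by apply: (filterS _ H2) => y /= Hy Ay; exact/Hy/AB.
Qed.

Lemma continuous_map_snd {R : realType} (phi : R -> R) : continuous phi ->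
  continuous (fun p : R * R => (p.1, phi p.2)).
Proof.
move=> cphi p.
have H1 : (fst : R * R -> R) x @[x --> p] --> p.1 by exact: cvg_fst.
have H2 : (phi \o snd : R * R -> R) x @[x --> p] --> phi p.2.
  have H : (snd : R * R -> R) x @[x --> p] --> p.2 by exact: cvg_snd.
  exact: (cvg_comp _ _ H (cphi p.2)).
exact: (cvg_pair H1 H2).
Qed.

Section EdgeSolution.
Context {R : realType} (f : R -> R).

Lemma exists_lt_both (d r : R) : 0 < d -> 0 < r ->
  exists k, [/\ 0 < k, k < d & k < r].
Proof.
move=> d0 r0; exists (Num.min d r / 2).
have m0 : 0 < Num.min d r by rewrite lt_min d0.
have md : Num.min d r <= d by rewrite ge_min lexx.
have mr : Num.min d r <= r by rewrite ge_min lexx orbT.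
by split; lra.
Qed.

(** The first derivatives agree at x by [slope_right] and [slope_left]; a larger
    second derivative would make g minus the parabola increase to the right of
    x, against the hypothesis. *)
Lemma second_derivative_test (g : R -> R) (x al be r : R) : 0 < r ->
  (forall y, `|y - x| < r -> derivable g y 1) -> derivable (derive1 g) x 1 ->
  (forall y, `|y - x| < r -> g y - g x <= al * (y - x) + be * (y - x) ^+ 2) ->
  derive1n 2 g x <= 2 * be.
Proof.
move=> r0 dg dg' gq.
have dx : derivable g x 1 by apply: dg; rewrite subrr normr0.
have rr : room_right [set: R] x by exists 1.
have rl : room_left [set: R] x by exists 1.
have [din dE] := derive_in_derive1 (or_introl rr) dx.
have alE : derive1 g x = al.
  apply/eqP; rewrite eq_le -dE; apply/andP; split.
    apply: (slope_right (b := be) rr din r0) => y /andP[y0 yr].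
    have := gq (x + y); rewrite [x + y]addrC addrK gtr0_norm// => /(_ yr); exact.
  rewrite -lerN2; apply: (slope_left (b := be) rl din r0) => y /andP[y0 yr].
  have := gq (x - y); rewrite (_ : x - y - x = - y); last by ring.
  by rewrite normrN gtr0_norm// sqrrN mulrN -mulNr => /(_ yr).
rewrite derive1nS derive1n1 leNgt; apply/negP => lt.
have [din' dE'] := derive_in_derive1 (or_introl rr) dg'.
have cv : (h^-1 * (derive1 g (x + h) - derive1 g x) @[h --> 0^'+]) --> derive1 (derive1 g) x.
  by rewrite -dE'; apply: cvg_trans din' => Q; exact: room_right_within.
have : \forall h \near (0 : R)^'+, 2 * be < h^-1 * (derive1 g (x + h) - derive1 g x).
  by move: cv => /cvgr_gt; apply.
move=> [d /= d0 dP].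
have [k [k0 kd kr]] := exists_lt_both d0 r0.
clear cv din' dE' dg'.
have xk : x < x + k by rewrite ltrDl.
pose q y := g y - al * (y - x) - be * (y - x) ^+ 2.
have nearx y : x <= y <= x + k -> `|y - x| < r.
  by move=> /andP[y1 y2]; rewrite ger0_norm; lra.
have dq y : x <= y <= x + k -> is_derive y 1 q (derive1 g y - al - 2 * be * (y - x)).
  move=> yx; have gd : is_derive y 1 g (derive1 g y).
    by rewrite derive1E; apply: derivableP; exact/dg/nearx.
  have sd : is_derive y 1 (fun y => y - x) (1 - 0).
    exact: (is_deriveB (is_derive_id y (1 : R)) (is_derive_cst x y (1:R))).
  have sq : is_derive y 1 (fun y => (y - x) ^+ 2) ((y - x) * (1 - 0) + (y - x) * (1 - 0)).
    have -> : (fun y : R => (y - x) ^+ 2) = (fun y => (y - x)) * (fun y => (y - x)).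
      by apply/funext => z; rewrite expr2.
    exact: (is_deriveM sd sd).
  have := is_deriveB (is_deriveB gd (is_deriveZ al sd)) (is_deriveZ be sq).
  suff -> : derive1 g y - al *: (1 - 0) - be *: ((y - x) * (1 - 0) + (y - x) * (1 - 0)) =
    derive1 g y - al - 2 * be * (y - x) by [].
  by rewrite /GRing.scale/=; ring.
have [] := @MVT R q (fun y => derive1 g y - al - 2 * be * (y - x)) x (x + k) xk.
- by move=> y; rewrite in_itv/= => /andP[y1 y2]; apply: dq; rewrite !ltW.
- move=> y; apply: (@continuous_in_subspaceT _ _ [set` `[x, x + k]] q) => {}y.
  rewrite inE/= in_itv/= => yx; apply: differentiable_continuous; apply/derivable1_diffP.
  by case: (dq y yx).
move=> xi; rewrite in_itv/= => /andP[xi1 xi2].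
have qle : q (x + k) - q x <= 0.
  rewrite /q subrr expr0n/= !mulr0 !subr0.
  have := gq (x + k); rewrite [x + k]addrC addrK gtr0_norm// => /(_ kr); lra.
move=> E; move: qle; rewrite E leNgt => /negP; apply.
rewrite [x + k]addrC addrK mulr_gt0//.
have := dP (xi - x); rewrite /= sub0r normrN gtr0_norm ?subr_gt0//.
rewrite (addrC x) subrK alE => H.
have : 2 * be < (xi - x)^-1 * (derive1 g xi - al) by apply: H => //; lra.
rewrite [ltRHS]mulrC ltr_pdivlMr ?subr_gt0//; lra.
Qed.

Lemma derivable_in_interior (A : set R) (g : R -> R) x :
  room_right A x -> room_left A x -> derivable_in A g x -> derivable g x 1.
Proof.
move=> [d1 d10 d1A] [d2 d20 d2A] dg.
apply/cvg_ex; exists (derive_in A g x).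
rewrite (_ : (fun h => _) = fun h : R => h^-1 * (g (x + h) - g x)); last first.
  by apply/funext => h; rewrite /= [h *: 1]mulr1 [h + x]addrC.
apply: cvg_trans dg => Q H.
have {}H : \forall h \near (0 : R)^', A (x + h) -> Q (h^-1 * (g (x + h) - g x)) := H.
have nA : \forall h \near (0 : R)^', A (x + h).
  exists (Num.min d1 d2); first by rewrite /= lt_min d10.
  move=> h; rewrite /= sub0r normrN lt_min => /andP[h1 h2].
  rewrite neq_lt => /orP[hn|hp].
    by rewrite -[h]opprK; apply: d2A; rewrite oppr_gt0 hn -(ltr0_norm hn).
  by apply: d1A; rewrite hp -(gtr0_norm hp).
suff : \forall h \near (0 : R)^', Q (h^-1 * (g (x + h) - g x)) by [].
by apply: (filterS _ (filterI H nA)) => h [] /[apply].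
Qed.

(** Derivatives in space are recorded through parabolas touching from above, a
    form which survives reversing, translating and shortening the edge; [dg] is
    the derivative in the direction of the coordinate. *)
Record edge_solution (g dg : R -> R -> R) (l : R) : Prop := EdgeSolution {
  edge_cont : {within [set: R] `*` [set x | 0 <= x <= l],
    continuous (fun p : R * R => g p.1 p.2)};
  edge_right : forall tau x al be r : R, 0 <= x < l -> 0 < r ->
    (forall y : R, 0 < y < r -> g tau (x + y) - g tau x <= al * y + be * y ^+ 2) ->
    dg tau x <= al;
  edge_left : forall tau x al be r : R, 0 < x <= l -> 0 < r ->
    (forall y : R, 0 < y < r -> g tau (x - y) - g tau x <= al * y + be * y ^+ 2) ->
    - dg tau x <= al;
  edge_eqn : forall tau x : R, 0 < x < l ->
    exists d e : R, [/\ is_derive tau 1 (fun tau => g tau x) d, d = e + f (g tau x) &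
      forall al be r : R, 0 < r ->
        (forall y : R, `|y - x| < r -> g tau y - g tau x <= al * (y - x) + be * (y - x) ^+ 2) ->
        e <= 2 * be] }.

Lemma edge_solution_rev g dg l : edge_solution g dg l ->
  edge_solution (fun tau x => g tau (l - x)) (fun tau x => - dg tau (l - x)) l.
Proof.
move=> [gc gr gl ge]; split.
- apply: (@within_continuous_precomp _ _ _ ([set: R] `*` [set x | 0 <= x <= l])
    ([set: R] `*` [set x | 0 <= x <= l]) (fun p : R * R => (p.1, l - p.2)) (fun p : R * R => g p.1 p.2)) gc.
    apply: (@continuous_map_snd R (fun x => l - x)) => x.
    by apply: continuousB; [exact: cst_continuous|exact: cvg_id].
  by move=> [t x] [_ /= /andP[x0 xl]]; split => //=; apply/andP; split; lra.
- move=> tau x al be r /andP[x0 xl] r0 H; apply: (gl tau (l - x) al be r) => //.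
    by apply/andP; split; lra.
  by move=> y yr; have := H y yr; rewrite opprD addrA.
- move=> tau x al be r /andP[x0 xl] r0 H; rewrite opprK; apply: (gr tau (l - x) al be r) => //.
    by apply/andP; split; lra.
  by move=> y yr; have := H y yr; rewrite opprB addrA addrAC.
- move=> tau x /andP[x0 xl]; have [|d [e [d1 d2 H]]] := ge tau (l - x).
    by apply/andP; split; lra.
  exists d, e; split => // al be r r0 H'; apply: (H (- al) be r) => // y yr.
  have := H' (l - y); rewrite (_ : l - (l - y) = y); last by ring.
  rewrite (_ : l - y - x = - (y - (l - x))); last by ring.
  by rewrite normrN sqrrN mulrN -mulNr => /(_ yr).
Qed.

Lemma edge_solution_shorten g dg l l' : l' <= l -> edge_solution g dg l ->
  edge_solution g dg l'.
Proof.
move=> ll [gc gr gl ge]; split.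
- by apply: continuous_subspaceW gc => p [_ /= /andP[? ?]]; split => //=; apply/andP; split; lra.
- by move=> tau x al be r /andP[x0 xl]; apply: gr; apply/andP; split; lra.
- by move=> tau x al be r /andP[x0 xl]; apply: gl; apply/andP; split; lra.
- by move=> tau x /andP[x0 xl]; apply: ge; apply/andP; split; lra.
Qed.

Lemma solution_edge (G : graph_data R) (u : R -> edge G -> R -> R) e l v :
  entire_solution f u -> far e = Some (l, v) ->
  edge_solution (fun tau x => u tau e x) (fun tau x => derive_in (eclosed e) (u tau e) x) l.
Proof.
move=> [_ uc uC1 ue _] fe.
have cE : eclosed e = [set x | 0 <= x <= l] by rewrite /eclosed fe.
have iE : einterior e = [set x | 0 < x < l] by rewrite /einterior fe.
have roomr x : 0 <= x < l -> room_right (eclosed e) x.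
  move=> /andP[x0 xl]; exists (l - x); first by rewrite subr_gt0.
  by rewrite cE => y /andP[y0 yl] /=; apply/andP; split; lra.
have rooml x : 0 < x <= l -> room_left (eclosed e) x.
  move=> /andP[x0 xl]; exists x => //.
  by rewrite cE => y /andP[y0 yl] /=; apply/andP; split; lra.
have din tau x : 0 <= x <= l -> derivable_in (eclosed e) (u tau e) x.
  by move=> xl; apply: (uC1 tau e).1; rewrite cE.
split.
- by have := uc e; rewrite cE.
- move=> tau x al be r xl r0; apply: slope_right r0; first exact: roomr.
  by apply: din; case/andP: xl => -> /ltW.
- move=> tau x al be r xl r0; apply: slope_left r0; first exact: rooml.
  by apply: din; case/andP: xl => /ltW ->.
- move=> tau x /andP[x0 xl]; have [|dt dx E] := ue tau e x; first by rewrite iE/= x0.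
  exists (derive1 (fun s => u s e x) tau), (derive1n 2 (u tau e) x); split; [|exact: E|].
    by rewrite derive1E; exact: (derivableP dt).
  move=> al be r r0 H; pose r' := Num.min r (Num.min x (l - x)).
  have rr : r' <= r by rewrite ge_min lexx.
  have rx : r' <= x by rewrite !ge_min lexx orbT.
  have rl : r' <= l - x by rewrite !ge_min lexx !orbT.
  apply: (@second_derivative_test _ x al be r'); [| |exact: dx|].
  + by rewrite !lt_min r0 x0 subr_gt0.
  + move=> y; rewrite ltr_norml => /andP[y1 y2].
    apply: (@derivable_in_interior (eclosed e)).
    * by apply: roomr; apply/andP; split; lra.
    * by apply: rooml; apply/andP; split; lra.
    * by apply: din; apply/andP; split; lra.
  + by move=> y yr; apply: H; exact: lt_le_trans rr.
Qed.

End EdgeSolution.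

(** * Integrals over subdivided edges *)

Section CellIntegral.
Context {R : realType}.
Local Notation mu := (@lebesgue_measure R).

Lemma integral_le_cells (g : R -> R) (l : R) m (beta : nat -> R) : 0 < l ->
  {within [set x | 0 <= x <= l], continuous g} ->
  (forall j x, (j < m.+1)%N -> 0 <= x <= l / m.+1%:R ->
     g (j%:R * (l / m.+1%:R) + x) <= beta j) ->
  \int[mu]_(x in [set x | 0 <= x <= l]) g x <= \sum_(j < m.+1) l / m.+1%:R * beta j.
Proof.
move=> l0 gc gb; set h := l / m.+1%:R in gb *.
have h0 : 0 < h by rewrite divr_gt0.
have lE : m.+1%:R * h = l by rewrite mulrC divfK.
have itvE : [set x : R | 0 <= x <= l] = [set` `[0, l]].
  by apply/seteqP; split => s /=; rewrite in_itv.
rewrite itvE in gc *.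
have gi : mu.-integrable [set` `[0, l]] (EFin \o g).
  by apply: continuous_compact_integrable => //; exact: segment_compact.
have sub (i : interval R) : [set` i] `<=` [set` `[0, l]] -> mu.-integrable [set` i] (EFin \o g).
  by move=> il; apply: integrableS gi.
suff H j : (j <= m.+1)%N -> \int[mu]_(x in [set` `[0, j%:R * h]]) g x <= \sum_(i < j) h * beta i.
  by have := H m.+1 (leqnn _); rewrite lE.
elim: j => [|j IH] jm.
  by rewrite mul0r set_itv1 Rintegral_set1 big_ord0.
rewrite big_ord_recr/=.
have jh : j%:R * h <= j.+1%:R * h by rewrite ler_pM2r// ler_nat.
have jl : j.+1%:R * h <= l by rewrite -lE ler_pM2r// ler_nat.
have j0 : 0 <= j%:R * h by rewrite mulr_ge0// ltW.
have itvsub : [set` `]j%:R * h, j.+1%:R * h]] `<=` [set` `[0, l]].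
  by move=> x /=; rewrite !in_itv/= => /andP[x1 x2]; apply/andP; split; lra.
have E : \int[mu]_(x in [set` `[0, j.+1%:R * h]]) g x - \int[mu]_(x in [set` `[0, j%:R * h]]) g x =
    \int[mu]_(x in [set` `]j%:R * h, j.+1%:R * h]]) g x.
  apply: Rintegral_itvB; rewrite ?bnd_simp//; apply: sub => x /=.
  by rewrite !in_itv/= => /andP[x1 x2]; apply/andP; split; lra.
have I2 : \int[mu]_(x in [set` `]j%:R * h, j.+1%:R * h]]) g x <= h * beta j.
  apply: (@le_trans _ _ (\int[mu]_(x in [set` `]j%:R * h, j.+1%:R * h]]) beta j)).
    apply: le_Rintegral => //; first exact: sub.
      apply: (@integrableS _ _ _ mu [set` `[0, l]]) => //.
      apply: continuous_compact_integrable; first exact: segment_compact.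
      by apply: continuous_subspaceT; exact: cst_continuous.
    move=> x /=; rewrite in_itv/= => /andP[x1 x2].
    have := gb j (x - j%:R * h) jm; rewrite [_ + (_ - _)]addrC subrK; apply.
    by move: x2; rewrite -natr1 mulrDl mul1r => x2; apply/andP; split; lra.
  have mE : mu [set` `]j%:R * h, j.+1%:R * h]] = h%:E.
    rewrite lebesgue_measure_itv/= lte_fin ltr_pM2r// ltr_nat ltnSn.
    by rewrite -EFinB -natr1 mulrDl mul1r [_ + h]addrC addrK.
  rewrite (@Rintegral_cst _ _ R mu _ (measurable_itv `]j%:R * h, j.+1%:R * h]) (beta j)).
  rewrite [leLHS](_ : _ = beta j * h); first by rewrite mulrC.
  exact: (congr1 (fun z => beta j * fine z) mE).
have := IH (ltnW jm); lra.
Qed.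

End CellIntegral.

(** * The ramp and the energy barrier *)

Section ReservoirEnergy.
Context {R : realType} {V E : finType} (src tgt : E -> V) (len : E -> R).
Hypothesis len0 : forall e, 0 < len e.
Variables (S : {set E}) (e0 : E) (b : V).
Hypotheses (e0S : e0 \notin S) (tgt_e0 : tgt e0 = b) (src_e0 : src e0 != b).
Hypothesis Sb : forall e, e \in S -> src e != b /\ tgt e != b.
Variables (f : R -> R) (a : R).
Hypothesis Hf : bistable f a.
Local Notation F := (primitive f).
Local Notation cs := (@cell_s V E src tgt _).
Local Notation ct := (@cell_t V E src tgt _).
Local Notation ch := (@cell_h R E len _).
Local Notation en := (energy cs ct ch F).
Let total := \sum_(e in S) len e.

Lemma sum_cells_U1 m (G : E * 'I_m.+1 -> R) :
  \sum_(c in cells m (e0 |: S)) G c =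
  \sum_(c in cells m [set e0]) G c + \sum_(c in cells m S) G c.
Proof.
rewrite (bigID (fun c : E * 'I_m.+1 => c.1 == e0))/=; congr (_ + _); apply: eq_bigl => c; rewrite !inE.
  by case: eqP; rewrite ?andbF.
by case: (eqVneq c.1 e0) => [->|]; rewrite ?(negbTE e0S)/= ?andbT.
Qed.

Lemma energy_U1 m (w : (V + E * 'I_m.+1)%type -> R) :
  en (cells m (e0 |: S)) w = en (cells m [set e0]) w + en (cells m S) w.
Proof. by rewrite /energy /dform /mass !sum_cells_U1; ring. Qed.

(** The coordinate of E_0 is oriented from Q_0, so that the ramp starts from 0 on
    Delta_0 and reaches 1 at the vertex b. *)
Definition ramp m (x : (V + E * 'I_m.+1)%type) : R :=
  match x with
  | inl v => (v == b)%:R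
  | inr (e, j) => if e == e0 then j%:R / m.+1%:R else 0
  end.

Lemma ramp_e0 m j : (j <= m.+1)%N -> ramp (node src tgt m e0 j) = j%:R / m.+1%:R.
Proof.
rewrite leq_eqVlt => /orP[/eqP ->|jm].
  by rewrite node_last/= tgt_e0 eqxx divff// pnatr_eq0.
case: j jm => [|j] jm; first by rewrite node0/= (negbTE src_e0) mul0r.
by rewrite node_inr//= eqxx inordK.
Qed.

Lemma ramp_S m e j : e \in S -> (j <= m.+1)%N -> ramp (node src tgt m e j) = 0.
Proof.
move=> eS; have [sb tb] := Sb eS; rewrite leq_eqVlt => /orP[/eqP ->|jm].
  by rewrite node_last/= (negbTE tb).
case: j jm => [|j] jm; first by rewrite node0/= (negbTE sb).
rewrite node_inr//=; case: eqP => // ee; by rewrite ee (negbTE e0S) in eS.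
Qed.

Lemma ramp01 m (x : (V + E * 'I_m.+1)%type) : 0 <= ramp x <= 1.
Proof.
case: x => [v|[e j]] /=; first by case: eqP; rewrite ?lexx ler01.
case: eqP => _; last by rewrite lexx ler01.
by rewrite divr_ge0//= ler_pdivrMr// mul1r ler_nat ltnW.
Qed.

Lemma ramp_touched_S m x : touched cs ct (cells m S) x -> ramp x = 0.
Proof. by move=> /touched_cells[e [j [eS jm ->]]]; exact: ramp_S. Qed.

Lemma mass_ramp m : mass cs ct ch (cells m S) (@ramp m) = 0.
Proof.
rewrite (@eq_mass _ _ _ _ _ _ _ _ (fun=> 0)); first by rewrite mass_cst mul0r.
by move=> x; exact: ramp_touched_S.
Qed.

(** On the first 1/M of the channel the ramp is at most a/2, where F is at least
    F (a / 2) > F a.  Taking the number of cells divisible by M makes this gain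
    independent of the mesh. *)
Lemma energy_ramp m (M k : nat) : m.+1 = (M * k)%N -> (0 < M)%N ->
  M%:R^-1 <= a / 2 ->
  en (cells m (e0 |: S)) (@ramp m) <=
  1 / (2 * len e0) - len e0 * F a - len e0 / M%:R * (F (a / 2) - F a).
Proof.
move=> mMk M0 Ma; rewrite energy_U1.
have -> : en (cells m S) (@ramp m) = 0.
  rewrite /energy (_ : dform _ _ _ _ _ _ = 0) ?mul0r; last first.
    apply: big1 => c cS; rewrite (@eq_grad _ _ _ _ _ (cells m S) _ (fun=> 0) c)//; last exact: ramp_touched_S.
    by rewrite /grad subrr !mul0r.
  rewrite (@eq_mass _ _ _ _ _ _ _ _ (fun=> 0)); first by rewrite mass_cst mul0r subr0.
  by move=> x tx /=; rewrite (ramp_touched_S tx) (primitive0 f).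
rewrite addr0 /energy.
have l0 := len0 e0; have n0 : 0 < m.+1%:R :> R by [].
have -> : dform cs ct ch (cells m [set e0]) (@ramp m) (@ramp m) = 1 / len e0.
  rewrite (_ : dform _ _ _ _ _ _ = \sum_(c in cells m [set e0]) (fun (_ : E) (_ : nat) => (m.+1%:R * len e0)^-1) c.1 c.2); last first.
    apply: eq_bigr => -[e j]; rewrite !inE/= => /eqP ->.
    rewrite /grad /cell_s /cell_t /cell_h/= !ramp_e0//; last exact: ltnW.
    rewrite -natr1; move: n0; set r := m.+1%:R; move: r => r r0.
    by field; rewrite !gt_eqF.
  rewrite (sum_cells m [set e0] (fun _ _ => (m.+1%:R * len e0)^-1)) big_set1 sumr_const card_ord -[LHS]mulr_natr.
  by rewrite invfM mulrAC mulVf ?mul1r// gt_eqF.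
have [gap gapP] := primitive_gap Hf; have [a0 a1] := a_bounds Hf.
have kM : len e0 / m.+1%:R * k%:R = len e0 / M%:R.
  have k0 : (0 < k)%N by move: mMk; case: (k) => //; rewrite muln0.
  have Mr : M%:R != 0 :> R by rewrite pnatr_eq0 -lt0n.
  have kr : k%:R != 0 :> R by rewrite pnatr_eq0 -lt0n.
  by rewrite mMk natrM; move: (M%:R : R) (k%:R : R) Mr kr => p q Mr kr; field; rewrite Mr kr.
have lower : len e0 * F a + len e0 / M%:R * (F (a / 2) - F a) <=
    mass cs ct ch (cells m [set e0]) (F \o @ramp m).
  have -> : len e0 * F a + len e0 / M%:R * (F (a / 2) - F a) =
      \sum_(j < m.+1) (len e0 / m.+1%:R * (F a + (F (a / 2) - F a) * (j < k)%:R)).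
    under eq_bigr do rewrite mulrDr.
    rewrite big_split/= sumr_const card_ord; congr (_ + _).
      by rewrite -[RHS]mulr_natr mulrAC divfK// gt_eqF.
    have sk : \sum_(j < m.+1) ((j < k)%N%:R : R) = k%:R.
      have km : (k <= m.+1)%N by rewrite mMk leq_pmull.
      transitivity (\sum_(j < k) (1 : R)); last by rewrite sumr_const card_ord.
      rewrite (big_ord_widen _ (fun=> 1) km) [RHS]big_mkcond/=.
      by apply: eq_bigr => j _; case: ltnP.
    rewrite -big_distrr/= -big_distrr/= sk [X in _ = _ * X]mulrC mulrA kM.
    by rewrite mulrC.
  have -> : mass cs ct ch (cells m [set e0]) (F \o @ramp m) =
      \sum_(c in cells m [set e0]) (fun (_ : E) (j : nat) => len e0 / m.+1%:R / 2 * (F (j%:R / m.+1%:R) + F (j.+1%:R / m.+1%:R))) c.1 c.2.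
    apply: eq_bigr => -[e j]; rewrite !inE/= => /eqP ->.
    by rewrite /cell_s /cell_t /cell_h/= !ramp_e0//; exact: ltnW.
  rewrite (sum_cells m [set e0] (fun _ j => len e0 / m.+1%:R / 2 * (F (j%:R / m.+1%:R) + F (j.+1%:R / m.+1%:R)))) big_set1.
  apply: ler_sum => j _.
  have h0 : 0 < len e0 / m.+1%:R by rewrite divr_gt0.
  rewrite -[leRHS]mulrA ler_pM2l//.
  have unit i : (i <= m.+1)%N -> 0 <= (i%:R / m.+1%:R : R) <= 1.
    by move=> im; rewrite divr_ge0//= ler_pdivrMr// mul1r ler_nat.
  have term i : (i <= m.+1)%N -> F a + (F (a / 2) - F a) * (i <= k)%N%:R <= F (i%:R / m.+1%:R).
    move=> im; have ui := unit i im; case: (leqP i k) => ik.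
      rewrite mulr1 addrC subrK; apply: gapP; case/andP: ui => -> _ /=.
      apply: le_trans Ma; rewrite ler_pdivrMr// mMk natrM mulrA mulVf ?mul1r ?ler_nat//.
      by rewrite pnatr_eq0 -lt0n.
    by rewrite mulr0 addr0; exact: (primitive_min Hf).
  have t1 := term j (ltnW (ltn_ord j)); have t2 := term j.+1 (ltn_ord j).
  have p1 := primitive_min Hf (unit j (ltnW (ltn_ord j))).
  have p2 := primitive_min Hf (unit j.+1 (ltn_ord j)).
  move: t1 t2; case: (ltnP j k) => jk; last by rewrite mulr0 => _ _; lra.
  by rewrite (ltnW jk) => t1 t2; lra.
lra.
Qed.

(** The trapezoidal rule applied to the pointwise inequality that defines sigma,
    with mu + eps in place of mustar; eps costs at most eps / 2 because
    (s - delta) ^ 2 <= 1. *)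
Lemma energy_barrier m (mu delta sigma eps : R) (w : (V + E * 'I_m.+1)%type -> R) :
  0 < delta < 1 -> 0 <= eps ->
  (forall s : R, 0 <= s <= 1 -> sigma <= (mu + eps) / 2 * (s - delta) ^+ 2 - F s) ->
  (forall z : (V + E * 'I_m.+1)%type -> R, mass cs ct ch (cells m S) z = 0 ->
    mu * mass cs ct ch (cells m S) (fun x => z x ^+ 2) <=
    dform cs ct ch (cells m S) z z) ->
  (forall x, 0 <= w x <= 1) -> mass cs ct ch (cells m S) w = delta * total ->
  (sigma - eps / 2) * total - len e0 * F 1 <= en (cells m (e0 |: S)) w.
Proof.
move=> /andP[d0 d1] ep sig poinc w01 mw; rewrite energy_U1 addrC /energy.
have hp := @cell_h_gt0 R E len len0 m.
apply: lerD.
  rewrite -[leLHS]add0r; apply: lerD; first by rewrite divr_ge0// dform_ge0.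
  rewrite lerN2; have -> : len e0 * F 1 = mass cs ct ch (cells m [set e0]) (fun=> F 1).
    by rewrite mass_cst (cells_length len) big_set1 mulrC.
  by apply: le_mass => // x _; exact: (primitive_max Hf).
pose z x := w x + - delta.
have mz : mass cs ct ch (cells m S) z = 0.
  by rewrite massD mass_cst (cells_length len) mw -/total; ring.
have dz : dform cs ct ch (cells m S) w w = dform cs ct ch (cells m S) z z.
  by apply: eq_bigr => c _; rewrite /grad /z; congr (_ / _); ring.
rewrite dz; apply: (@le_trans _ _ (mu * mass cs ct ch (cells m S) (fun x => z x ^+ 2) / 2
    - mass cs ct ch (cells m S) (F \o w))); last first.
  by rewrite lerD2r ler_pM2r// poinc.
have -> : mu * mass cs ct ch (cells m S) (fun x => z x ^+ 2) / 2 - mass cs ct ch (cells m S) (F \o w)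
   = mass cs ct ch (cells m S) (fun x => mu / 2 * z x ^+ 2 + - 1 * F (w x)).
  by rewrite massD !massZ; ring.
have -> : (sigma - eps / 2) * total = mass cs ct ch (cells m S) (fun=> sigma - eps / 2).
  by rewrite mass_cst (cells_length len).
apply: le_mass => // x _; have wx := w01 x; have := sig _ wx; rewrite -/(z x).
have z1 : z x ^+ 2 <= 1 by case/andP: wx => *; rewrite /z; nra.
nra.
Qed.

(** An energy bound makes the values at the ends of a cell differ by O(sqrt h). *)
Lemma energy_osc m (w : (V + E * 'I_m.+1)%type -> R) c (en0 : R) :
  (forall x, 0 <= w x <= 1) -> en (cells m (e0 |: S)) w <= en0 ->
  c \in cells m (e0 |: S) ->
  grad cs ct w c ^+ 2 <= 2 * (en0 + F 1 * (len e0 + total)) * ch c.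
Proof.
move=> w01 ew cP; have hp := @cell_h_gt0 R E len len0 m.
have mle : mass cs ct ch (cells m (e0 |: S)) (F \o w) <= F 1 * (len e0 + total).
  have -> : F 1 * (len e0 + total) = mass cs ct ch (cells m (e0 |: S)) (fun=> F 1).
    by rewrite mass_cst (cells_length len) big_setU1.
  by apply: le_mass => // x _; exact: (primitive_max Hf).
have : grad cs ct w c ^+ 2 / ch c <= dform cs ct ch (cells m (e0 |: S)) w w.
  rewrite /dform (bigD1 c)//= -expr2 lerDl sumr_ge0// => d _.
  by rewrite -expr2 divr_ge0 ?sqr_ge0// ltW.
rewrite -ler_pdivrMr//; move: ew; rewrite /energy; lra.
Qed.

End ReservoirEnergy.

(** * Mean value over the reservoir *)

Section ReservoirAverage.
Context {R : realType} {V E : finType} (src tgt : E -> V) (len : E -> R).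
Hypothesis len0 : forall e, 0 < len e.
Variables (S : {set E}) (e0 : E) (b : V).
Hypotheses (e0S : e0 \notin S) (tgt_e0 : tgt e0 = b) (src_e0 : src e0 != b).
Hypothesis Sb : forall e, e \in S -> src e != b /\ tgt e != b.
Variables (f : R -> R) (a delta mustar sigma mu1 : R).
Hypothesis Hf : bistable f a.
Local Notation F := (primitive f).
Local Notation cs := (@cell_s V E src tgt _).
Local Notation ct := (@cell_t V E src tgt _).
Local Notation ch := (@cell_h R E len _).
Let total := \sum_(e in S) len e.
Hypotheses (delta01 : 0 < delta < 1) (mu_le : mustar <= mu1).
Hypothesis sigmaP : forall s : R, 0 <= s <= 1 ->
  sigma <= mustar / 2 * (s - delta) ^+ 2 - F s.
Hypothesis poincare : forall mu, mu < mu1 -> \forall m \near \oo,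
  forall w : (V + E * 'I_m.+1)%type -> R, mass cs ct ch (cells m S) w = 0 ->
    mu * mass cs ct ch (cells m S) (fun x => w x ^+ 2) <=
    dform cs ct ch (cells m S) w w.
Hypothesis narrow : 1 / (2 * len e0) + len e0 * (F 1 - F a) <= sigma * total.

Variables (U dU : R -> E -> R -> R) (Y : R -> V -> R).
Hypothesis U_edge : forall e, e \in e0 |: S ->
  edge_solution f (fun tau x => U tau e x) (fun tau x => dU tau e x) (len e).
Hypothesis U_range : forall (tau : R) e (x : R), e \in e0 |: S -> 0 <= x <= len e ->
  0 < U tau e x < 1.
Hypothesis U_src : forall tau e, e \in e0 |: S -> U tau e 0 = Y tau (src e).
Hypothesis U_tgt : forall tau e, e \in e0 |: S -> U tau e (len e) = Y tau (tgt e).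
Hypothesis U_kirchhoff : forall tau v, v != b ->
  \sum_(e in e0 |: S) (dU tau e (len e) * (tgt e == v)%:R - dU tau e 0 * (src e == v)%:R) = 0.
Hypothesis U_decay : forall eps : R, 0 < eps -> exists T0 : R, forall (tau : R) e (x : R),
  tau <= T0 -> e \in e0 |: S -> 0 <= x <= len e -> U tau e x <= eps.

Lemma barrier_supersolution (K eta : R) : 1 <= K -> 0 < eta ->
  (forall x y : R, -1 <= x <= 2 -> -1 <= y <= 2 -> `|f x - f y| <= K * `|x - y|) ->
  exists m (w : (V + E * 'I_m.+1)%type -> R),
  [/\ forall x, 0 <= w x <= 1, w (inl b) = 1,
      mass cs ct ch (cells m S) w <= delta * total,
      forall x, x != inl b ->
        f (w x) * mass cs ct ch (cells m (e0 |: S)) (bump x) <=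
        dform cs ct ch (cells m (e0 |: S)) w (bump x) &
      forall c, c \in cells m (e0 |: S) ->
        K * (`|w (ct c) - w (cs c)| + (K + 1) * ch c ^+ 2) <= eta].
Proof.
move=> K1 eta0 lip.
have [lipF taylor] := primitive_taylor Hf K1 lip.
have [a0 a1] := a_bounds Hf; have [gap _] := primitive_gap Hf.
have l0 := len0 e0.
have total0 : 0 <= total by apply: sumr_ge0 => e _; exact: ltW.
(* M ^-1 <= a / 2, as required by the ramp *)
pose M := (Num.trunc (2 / a)).+1.
have M0 : (0 < M)%N by [].
have Mr : 0 < M%:R :> R by rewrite ltr0n.
have Ma : M%:R^-1 <= a / 2.
  rewrite -[leRHS]invrK lef_pV2 ?posrE ?invr_gt0 ?divr_gt0// invf_div.
  by rewrite ltW// truncnS_gt.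
pose g := len e0 / M%:R * (F (a / 2) - F a).
have g0 : 0 < g by rewrite mulr_gt0 ?divr_gt0// subr_gt0.
(* the loss eps / 2 * total in the barrier stays below the gain g of the ramp *)
pose eps := g / (total + 1).
have t1 : 0 < total + 1 by lra.
have eps0 : 0 < eps by rewrite divr_gt0.
have epst : eps / 2 * total < g.
  have : eps * (total + 1) = g by rewrite divfK// gt_eqF.
  by move: eps0 total0; nra.
have mu1' : mustar - eps < mu1 by have := mu_le; lra.
pose Lam := 2 * (1 / (2 * len e0) - len e0 * F a + F 1 * (len e0 + total)).
have osc_small : \forall m \near \oo, forall e,
    K * (Num.sqrt (Lam * (len e / m.+1%:R)) + (K + 1) * (len e / m.+1%:R) ^+ 2) <= eta.
  apply: filter_forall => e.
  have hP : (fun m => len e / m.+1%:R) @ \oo --> (0 : R).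
    by rewrite -[X in _ --> X](mulr0 (len e)); apply: cvgM; [exact: cvg_cst|exact: cvg_harmonic].
  have : (fun m => K * (Num.sqrt (Lam * (len e / m.+1%:R)) + (K + 1) * (len e / m.+1%:R) ^+ 2)) @ \oo --> (0 : R).
    rewrite -[X in _ --> X](mulr0 K); apply: cvgM; first exact: cvg_cst.
    rewrite -[X in _ --> X](addr0 0); apply: cvgD.
      rewrite -[X in _ --> X](sqrtr0 R); apply: (continuous_cvg _ (@sqrt_continuous R 0)).
      by rewrite -[X in _ --> X](mulr0 Lam); apply: cvgM => //; exact: cvg_cst.
    rewrite -[X in _ --> X](mulr0 (K + 1)); apply: cvgM; first exact: cvg_cst.
    by rewrite -[X in _ --> X](mulr0 0); apply: cvgM.
  by move=> /cvgr_le; apply.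
have [N _ NP] := filterI (poincare mu1') osc_small.
(* a mesh fine enough whose number of cells is divisible by M *)
pose m := (M * N.+1).-1.
have mMk : m.+1 = (M * N.+1)%N by rewrite /m prednK// muln_gt0.
have Nm : (N <= m)%N by rewrite -ltnS mMk leq_pmull.
have [pm om] := NP m Nm.
have hp := @cell_h_gt0 R E len len0 m.
have enramp := energy_ramp len0 e0S tgt_e0 src_e0 Sb Hf mMk M0 Ma.
have adm : admissible cs ct ch (cells m S) (inl b) (delta * total) (@ramp _ _ _ e0 b m).
  split; [exact: ramp01|by rewrite /= eqxx|].
  by rewrite (mass_ramp _ e0S Sb) mulr_ge0//; case/andP: delta01 => /ltW.
have [|w [[w01 wb mw] ew sup]] := @supersolution_of_minimizer R _ _ cs ct ch hp F f K (F 1)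
    lipF taylor (fun x => @primitive_max _ _ _ Hf x) (let: And3 _ _ z := f_zeros Hf in z)
    (cells m (e0 |: S)) (cells m S) (inl b) (delta * total) _ adm.
  move=> w [w01 wb _] mw; apply: (le_lt_trans enramp).
  have := @energy_barrier R V E src tgt len len0 S e0 e0S f a Hf m (mustar - eps) delta sigma eps w
    delta01 (ltW eps0) _ pm w01 mw.
  rewrite subrK => /(_ sigmaP) bar; apply: lt_le_trans bar.
  by have := narrow; rewrite -/g -/total; lra.
exists m, w; split => // c cP.
apply: le_trans (om c.1); rewrite ler_wpM2l ?(le_trans ler01 K1)//.
rewrite lerD2r -sqrtr_sqr ler_wsqrtr//.
apply: le_trans (energy_osc len0 e0S Hf w01 ew cP) _.
rewrite /Lam ler_pM2r; last exact: hp.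
by rewrite ler_pM2l// lerD2r (le_trans enramp)// gerBl ltW.
Qed.

Lemma cell_upper_bound (tau eps : R) : 0 < eps ->
  exists m (w : (V + E * 'I_m.+1)%type -> R),
    mass cs ct ch (cells m S) w <= delta * total /\
    forall e (j : nat) (x : R), e \in S -> (j < m.+1)%N -> 0 <= x <= len e / m.+1%:R ->
      U tau e (j%:R * (len e / m.+1%:R) + x) <=
      (w (node src tgt m e j) + w (node src tgt m e j.+1)) / 2 + eps.
Proof.
move=> eps0.
have [K K1 lip] := f_lipschitz Hf.
have [ef [k [/andP[ef0 ef1] /andP[k0 k1] decr]]] := f_decreasing_near0 Hf.
have [T0 small] := U_decay ef0.
pose T1 := Num.min T0 tau.
have T1tau : T1 <= tau by rewrite ge_min lexx orbT.
have T1T0 : T1 <= T0 by rewrite ge_min lexx.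
(* the total error given by the comparison is eta * A *)
pose A := 1 + 3 / k * expR ((K + 1) * (tau - T1)).
have A0 : 0 < A.
  have : 0 < expR ((K + 1) * (tau - T1)) by exact: expR_gt0.
  have : 0 < 3 / k by rewrite divr_gt0.
  rewrite /A; nra.
pose eta := Num.min ef (eps / A).
have eta0 : 0 < eta by rewrite lt_min ef0 divr_gt0.
have eta_ef : eta <= ef by rewrite ge_min lexx.
have etaA : eta * A <= eps by rewrite -ler_pdivlMr// ge_min lexx orbT.
have [m [w [w01 wb mw sup osc]]] := barrier_supersolution K1 eta0 lip.
exists m, w; split => //.
have hp := @cell_h_gt0 R E len len0 m.
have nh e : m.+1%:R * (len e / m.+1%:R) = len e by rewrite mulrC divfK.
pose h e := len e / m.+1%:R.
have h0 e : 0 < h e by rewrite divr_gt0.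
have inl_len e (j : nat) (x : R) : (j < m.+1)%N -> 0 <= x <= h e ->
    0 <= j%:R * h e /\ j%:R * h e + x <= len e.
  move=> jm /andP[x0 xh]; split; first by rewrite mulr_ge0// ltW.
  apply: (@le_trans _ _ (j.+1%:R * h e)); first by rewrite -natr1 mulrDl mul1r lerD2l.
  by rewrite -[leRHS](nh e) ler_pM2r// ler_nat.
have inS c : c \in cells m (e0 |: S) -> c.1 \in e0 |: S by rewrite inE.
pose Uc t (c : E * 'I_m.+1) x := U t c.1 (c.2%:R * h c.1 + x).
pose Yc t (x : (V + E * 'I_m.+1)%type) :=
  match x with inl v => Y t v | inr (e, j) => U t e (j%:R * h e) end.
have YcE t e j : e \in e0 |: S -> (j <= m.+1)%N -> U t e (j%:R * h e) = Yc t (node src tgt m e j).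
  move=> eS; rewrite leq_eqVlt => /orP[/eqP ->|jm].
    by rewrite node_last/= nh U_tgt.
  case: j jm => [|j] jm; first by rewrite node0/= mul0r U_src.
  by rewrite node_inr//= inordK.
have jS (e : E) (j : nat) : j.+1%:R * h e = j%:R * h e + h e :> R.
  by rewrite -natr1 mulrDl mul1r.
have cmp := @comparison R _ _ cs ct ch (cells m (e0 |: S)) hp f K eta ef k K1 eta0 eta_ef ef1 k0 k1
  (let: And3 z _ _ := f_zeros Hf in z) lip decr w (inl b) w01 wb sup osc Uc Yc
  (fun t c => dU t c.1 (c.2%:R * h c.1)) (fun t c => - dU t c.1 (c.2.+1%:R * h c.1)).
move=> e j x eS jm xh.
have eS1 : e \in e0 |: S by rewrite !inE eS orbT.
have cS1 : (e, Ordinal jm) \in cells m (e0 |: S) by rewrite inE.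
apply: (le_trans (cmp _ _ _ _ _ _ _ _ _ T1 _ tau (e, Ordinal jm) x T1tau cS1 xh)) => {cmp}.
- move=> c cP; have [gc _ _ _] := U_edge (inS c cP).
  apply: (@within_continuous_precomp _ _ _ ([set: R] `*` [set x | 0 <= x <= ch c])
    ([set: R] `*` [set x | 0 <= x <= len c.1]) (fun p : R * R => (p.1, c.2%:R * h c.1 + p.2))
    (fun p : R * R => U p.1 c.1 p.2)) gc.
    apply: (@continuous_map_snd R (fun x => c.2%:R * h c.1 + x)) => y.
    by apply: (@cvgD _ _ _ _ _ (fun=> c.2%:R * h c.1) id); [exact: cvg_cst|exact: cvg_id].
  move=> [t y] [_ /= yh]; split => //=.
  have [p1 p2] := inl_len c.1 c.2 y (ltn_ord _) yh; rewrite p2 andbT addr_ge0//.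
  by case/andP: yh.
- move=> t c y cP yh; apply: U_range; first exact: inS.
  have [p1 p2] := inl_len c.1 c.2 y (ltn_ord _) yh; rewrite p2 andbT addr_ge0//.
  by case/andP: yh.
- by move=> t c cP; rewrite /Uc addr0 YcE ?inS//; exact: ltnW.
- by move=> t c cP; rewrite /Uc /cell_h -/(h c.1) -jS YcE ?inS.
- move=> t c y cP /andP[y0 yh].
  have yh' : 0 <= y <= h c.1 by rewrite !ltW.
  have [p1 p2] := inl_len c.1 c.2 y (ltn_ord _) yh'.
  have [_ _ _ ge] := U_edge (inS c cP).
  have [|d [g [dU' dE gP]]] := ge t (c.2%:R * h c.1 + y).
    apply/andP; split; first by rewrite ltr_wpDl.
    have [] := inl_len c.1 c.2 (h c.1) (ltn_ord _); first by rewrite lexx ltW.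
    by move=> _; apply: lt_le_trans; rewrite ltrD2l.
  exists d, g; split => // al be r r0 H; apply: (gP al be r) => // q qr.
  have := H (q - c.2%:R * h c.1); rewrite /Uc (_ : q - _ - y = q - (c.2%:R * h c.1 + y)); last by ring.
  by rewrite [_ + (q - _)]addrC subrK; apply.
- move=> t c al be cP H; have [_ gr _ _] := U_edge (inS c cP).
  apply: (gr t (c.2%:R * h c.1) al be (h c.1)) => //.
    rewrite mulr_ge0 ?(ltW (h0 _))//=; apply: (@lt_le_trans _ _ (c.2.+1%:R * h c.1)).
      by rewrite ltr_pM2r// ltr_nat.
    by rewrite -[leRHS](nh c.1) ler_pM2r// ler_nat.
  by move=> y yh; have := H y yh; rewrite /Uc addr0.
- move=> t c al be cP H; have [_ _ gl _] := U_edge (inS c cP).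
  apply: (gl t (c.2.+1%:R * h c.1) al be (h c.1)) => //.
    rewrite mulr_gt0//=.
    by rewrite -[leRHS](nh c.1) ler_pM2r// ler_nat.
  by move=> y yh; have := H y yh; rewrite /Uc /cell_h -/(h c.1) !jS addrA.
- move=> t z zb.
  pose X (e : E) (j : nat) := dU t e (j%:R * h e) * (node src tgt m e j == z)%:R.
  transitivity (- \sum_(c in cells m (e0 |: S)) (X c.1 c.2.+1 - X c.1 c.2)).
    by rewrite -sumrN; apply: eq_bigr => c _; rewrite /X /cell_s /cell_t; ring.
  rewrite (telescope_cells m (e0 |: S) X) /X; apply/eqP; rewrite oppr_eq0; apply/eqP.
  case: z zb {X} => [v|ej] zb; last first.
    by apply: big1 => d _; rewrite node_last node0/= !mulr0 subrr.
  have vb : v != b by [].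
  rewrite -[RHS](U_kirchhoff t vb); apply: eq_bigr => d _.
  by rewrite node_last node0 mul0r nh.
- move=> ep ep0; have [T TP] := U_decay ep0; exists T => t c y tT cP yh.
  apply: TP => //; first exact: inS.
  have [p1 p2] := inl_len c.1 c.2 y (ltn_ord _) yh; rewrite p2 andbT addr_ge0//.
  by case/andP: yh.
- move=> t c y tT cP yh; apply: small; [exact: le_trans T1T0|exact: inS|].
  have [p1 p2] := inl_len c.1 c.2 y (ltn_ord _) yh; rewrite p2 andbT addr_ge0//.
  by case/andP: yh.
- rewrite /cell_s /cell_t/= -addrA lerD2l; apply: le_trans etaA.
  rewrite /A; move: (expR _) (gt_eqF k0) => q kN.
  by rewrite le_eqVlt; apply/orP; left; apply/eqP; field; rewrite kN.
Qed.

Lemma reservoir_average tau : (forall e, e \in S ->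
    {within [set x : R | 0 <= x <= len e], continuous (U tau e)}) ->
  \sum_(e in S) \int[lebesgue_measure]_(x in [set x : R | 0 <= x <= len e]) U tau e x <=
  delta * total.
Proof.
move=> Uc; have total0 : 0 <= total by apply: sumr_ge0 => e _; exact: ltW.
apply/ler_addgt0Pr => eps eps0.
have t1 : 0 < total + 1 by lra.
have [|m [w [mw wP]]] := @cell_upper_bound tau (eps / (total + 1)); first by rewrite divr_gt0.
pose beta e j := (w (node src tgt m e j) + w (node src tgt m e j.+1)) / 2 + eps / (total + 1).
apply: (@le_trans _ _ (\sum_(e in S) \sum_(j < m.+1) len e / m.+1%:R * beta e j)).
  apply: ler_sum => e eS; apply: integral_le_cells => //; first exact: Uc.
  by move=> j x jm xh; exact: wP.
rewrite -(sum_cells m S (fun e j => len e / m.+1%:R * beta e j)).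
rewrite (_ : \sum_(c in cells m S) _ = mass cs ct ch (cells m S) (fun x => w x + eps / (total + 1))).
  rewrite massD mass_cst (cells_length len) lerD// mulrAC ler_pdivrMr// ler_wpM2l ?(ltW eps0)//.
  by rewrite lerDl.
by apply: eq_bigr => c _; rewrite /beta /cell_h /cell_s /cell_t; move: (eps / _) (m.+1%:R^-1 : R) => q r; field.
Qed.

End ReservoirAverage.

Section LimitIntegral.
Context {R : realType}.
Local Notation mu := (@lebesgue_measure R).

Lemma bounded_limit_integral (gn : nat -> R -> R) (g : R -> R) (l : R) :
  (forall n, {within [set x | 0 <= x <= l], continuous (gn n)}) ->
  (forall n x, 0 <= x <= l -> `|gn n x| <= 1) ->
  (forall x, 0 <= x <= l -> (gn n x @[n --> \oo]) --> g x) ->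
  (\int[mu]_(x in [set x | 0 <= x <= l]) gn n x) @[n --> \oo] -->
  \int[mu]_(x in [set x | 0 <= x <= l]) g x.
Proof.
move=> gc g1 gl.
have itvE : [set x : R | 0 <= x <= l] = [set` `[0, l]].
  by apply/seteqP; split => s /=; rewrite in_itv.
have gi n : mu.-integrable [set` `[0, l]] (EFin \o gn n).
  by apply: continuous_compact_integrable; [exact: segment_compact|rewrite -itvE].
have ci : mu.-integrable [set` `[0, l]] (EFin \o fun=> (1 : R)).
  apply: continuous_compact_integrable; first exact: segment_compact.
  by apply: continuous_subspaceT; exact: cst_continuous.
have mgn n : measurable_fun [set` `[0, l]] (gn n).
  apply/measurable_realfun.measurable_EFinP; exact: (measurable_int _ (gi n)).
have mg : measurable_fun [set` `[0, l]] g.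
  by apply: (@measurable_realfun.measurable_fun_cvg _ _ _ _ gn) => // x; rewrite -itvE; exact: gl.
have [||||ig _ ic] := @dominated_convergence _ _ R mu [set` `[0, l]] (measurable_itv _)
  (fun n => EFin \o gn n) (EFin \o g) (EFin \o fun=> (1 : R)) _ _ _ ci.
- by move=> n; exact: (measurable_int _ (gi n)).
- by apply/measurable_realfun.measurable_EFinP; exact: mg.
- apply: aeW => x; rewrite -itvE => xl; apply: cvg_EFin; last exact: gl.
  by apply: filterS filterT => n _.
- apply: aeW => x n; rewrite -itvE => xl.
  by rewrite /= lee_fin; exact: g1.
rewrite itvE; apply: fine_cvg.
by rewrite fineK//; exact: integrable_fin_num.
Qed.

End LimitIntegral.

(** * The front-like solution in the reservoir *)

(** 1 / (2 l) + l D is minimal at l = (2 D)^(-1/2), with value sqrt (2 D): a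
    longer channel is cut at that length. *)
Lemma effective_channel_length {R : realType} (L D c : R) : 0 < L -> 0 < D ->
  (L <= (Num.sqrt (2 * D))^-1 -> 1 / (2 * L) + L * D <= c) ->
  ((Num.sqrt (2 * D))^-1 < L -> Num.sqrt (2 * D) <= c) ->
  exists l, [/\ 0 < l, l <= L & 1 / (2 * l) + l * D <= c].
Proof.
move=> L0 D0 H1 H2; have s0 : 0 < Num.sqrt (2 * D) by rewrite sqrtr_gt0; lra.
have s2 : Num.sqrt (2 * D) ^+ 2 = 2 * D by rewrite sqr_sqrtr; lra.
have [LL|LL] := leP L (Num.sqrt (2 * D))^-1.
  by exists L; split => //; exact: H1.
exists (Num.sqrt (2 * D))^-1; split; [by rewrite invr_gt0|exact: ltW|].
apply: le_trans (H2 LL).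
move: s0 s2; move: (Num.sqrt _) => s s0 s2.
have -> : D = s ^+ 2 / 2 by rewrite s2; field.
have -> : 1 / (2 * s^-1) + s^-1 * (s ^+ 2 / 2) = s by field; rewrite gt_eqF.
exact: lexx.
Qed.

Lemma continuous_pair_left {R : realType} (t : R) : continuous (fun x : R => (t, x)).
Proof.
move=> p.
have H1 : (fun=> t) x @[x --> p] --> t by exact: cvg_cst.
have H2 : id x @[x --> p] --> p by exact: cvg_id.
exact: (cvg_pair H1 H2).
Qed.

Section FrontDecay.
Context {R : realType} {G : graph_data R}.

(** The first supremum is nonnegative, so that the second one is at most the sum. *)
Lemma front_decay (f phi : R -> R) c (o : edge G) (u : R -> edge G -> R -> R) eps :
  front_like_solution f phi c o u -> far o = None -> 0 < eps ->
  exists T0, forall t e x, t <= T0 -> e != o -> eclosed e x -> u t e x <= eps.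
Proof.
move=> [_ _ lim] fo e0.
have [M [_ MP]] := lim _ (@nbhs_open_ereal_lt R 0 (fun=> eps) e0).
exists (M - 1) => t e x tM eo ex; have {MP} := MP t.
have tM' : t < M by lra.
move=> /(_ tM') /= lt; rewrite -lee_fin; apply: le_trans (ltW lt).
apply: (@le_trans _ _ (`|u t e x|%:E)); first by rewrite lee_fin ler_norm.
apply: (@le_trans _ _ (ereal_sup [set y | exists e x,
    [/\ e != o, eclosed e x & y = `|u t e x|%:E]])).
  by apply: ereal_sup_ubound; exists e, x.
rewrite leeDr//; apply: (@le_trans _ _ (`|u t o 0 - phi (- 0 - c * t)|%:E)).
  by rewrite lee_fin.
by apply: ereal_sup_ubound; exists 0 => //; rewrite /eclosed fo /=.
Qed.

End FrontDecay.

Theorem theorem2p25 (R : realType) (f : R -> R) (a : R)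
    (N : nat) (Omega : graph_data R) (outer : 'I_N -> edge Omega)
    (e0 : edge Omega) (p0 q0 : vert Omega) (L : R)
    (VDelta : {set vert Omega}) (EDelta : {set edge Omega})
    (mu1 delta mustar sigma : R) (phi : R -> R) (c : R) :
  bistable f a ->
  traveling_wave f a phi c ->
  is_metric_graph Omega ->
  (2 <= N)%N ->
  outer_paths outer ->
  reservoir e0 p0 q0 L VDelta EDelta ->
  smallest_positive_eigenvalue VDelta EDelta mu1 ->
  0 < delta < a ->
  0 < mustar ->
  0 < sigma ->
  (forall s : R, 0 <= s <= 1 ->
     sigma <= mustar / 2 * (s - delta) ^+ 2 - primitive f s) ->
  mustar <= mu1 ->
  (L <= (Num.sqrt (2 * (primitive f 1 - primitive f a)))^-1 ->
     1 / (2 * L) + L * (primitive f 1 - primitive f a)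
       <= sigma * total_length EDelta) ->
  ((Num.sqrt (2 * (primitive f 1 - primitive f a)))^-1 < L ->
     Num.sqrt (2 * (primitive f 1 - primitive f a))
       <= sigma * total_length EDelta) ->
  forall (i : 'I_N) (u : R -> edge Omega -> R -> R)
    (v : edge Omega -> R -> R),
    front_like_solution f phi c (outer i) u ->
    limit_profile u v ->
    1 / total_length EDelta * graph_integral EDelta v <= delta.
Proof.
move=> Hf _ HG _ [_ outerP] Hres [mu10 [ueig eigu] mu1min] /andP[delta0 deltaa] _ _ sigmaP mule.
move=> short long i u v front lim.
have [a0 a1] := a_bounds Hf.
have [Rends e0E q0V p0V Rbnd Rsub Rconn Riso] := Hres.
have D0 : 0 < primitive f 1 - primitive f a.
  have [gap _] := primitive_gap Hf; rewrite subr_gt0 (lt_le_trans gap)// (primitive_max Hf)//.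
  by rewrite divr_ge0 ?(ltW a0)// ler_pdivrMr// mul1r (le_trans (ltW a1))// ler1n.
have qp : q0 != p0 by apply: contraNneq p0V => <-.
have L0 : 0 < L by case: Rends => -[_ fe]; exact: (far_gt0 HG fe).
have [l [l0 lL narrow]] := effective_channel_length L0 D0 short long.
have [usol urange _] := front.
have inL (x : R) : 0 <= x <= l -> 0 <= x <= L /\ 0 <= L - x <= L.
  move=> /andP[x0 xl]; have xL := le_trans xl lL.
  by rewrite x0 xL subr_ge0 xL lerBlDr lerDl x0.
(* the channel is oriented from q0 and cut at distance l from q0; its new end is
   identified with the vertex p0, where only the bound U < 1 is used *)
pose fwd := src e0 == q0.
pose rsrc e := if e == e0 then q0 else src e.
pose rtgt e := if e == e0 then p0 else if far e is Some (_, w) then w else src e.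
pose len e : R := if e == e0 then l else if e \in EDelta then elen e else 1.
pose U t e x := if e == e0 then (if fwd then u t e0 x else u t e0 (L - x)) else u t e x.
pose du t e x := derive_in (eclosed e) (u t e) x.
pose dU t e x := if e == e0 then (if fwd then du t e0 x else - du t e0 (L - x)) else du t e x.
(* p0 carries the value at the cut, which is not the value of u at p0 if l < L *)
pose val t w := xget (0 : R) [set y | exists e x, at_vertex e x w /\ y = u t e x].
pose Y t w := if w == p0 then U t e0 l else val t w.
have neq0 e : e \in EDelta -> (e == e0) = false.
  by move=> eE; apply/eqP => ee; rewrite ee (negbTE e0E) in eE.
have farE e : e \in EDelta -> far e = Some (len e, rtgt e).
  move=> eE; have := Rbnd e eE; rewrite /len /rtgt neq0// eE /elen.
  by case: (far e) => [[]|].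
have len0 e : 0 < len e.
  rewrite /len; case: eqP => // _; case: ifPn => // eE; rewrite /elen.
  by case fe: (far e) => [[x w]|]; [exact: (far_gt0 HG fe)|case: (Rbnd e eE fe)].
have valE t e x w : at_vertex e x w -> val t w = u t e x.
  move=> ew; rewrite /val; case: xgetP => [y _ [e' [x' [ew' ->]]]|/(_ (u t e x))[]].
    by apply: (sol_single usol); rewrite ?inE//; eassumption.
  by exists e, x.
have at_src e : at_vertex e 0 (src e) by left.
have at_tgt e : e \in EDelta -> at_vertex e (len e) (rtgt e) by move=> eE; right; exact: farE.
have srcV e : e \in EDelta -> src e \in VDelta.
  by move=> eE; apply: (Rsub e _ eE); exists 0.
have tgtV e : e \in EDelta -> rtgt e \in VDelta.
  by move=> eE; apply: (Rsub e _ eE); exists (len e); exact: at_tgt.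
have Vneq w : w \in VDelta -> (w == p0) = false.
  by move=> wV; apply/eqP => wp; rewrite wp (negbTE p0V) in wV.
have closedE e : e \in EDelta -> eclosed e = [set x | 0 <= x <= len e].
  by move=> eE; rewrite /eclosed farE.
have fwdP : (fwd /\ far e0 = Some (L, p0)) \/ (fwd = false /\ src e0 = p0 /\ far e0 = Some (L, q0)).
  case: Rends => -[se fe]; [right|left]; rewrite /fwd se ?eqxx//.
  by rewrite eq_sym (negbTE qp).
have closed0 : eclosed e0 = [set x | 0 <= x <= L].
  by rewrite /eclosed; case: fwdP => [[_ ->]|[_ [_ ->]]].
have inS1 e : e \in e0 |: EDelta -> e = e0 \/ e \in EDelta.
  by rewrite !inE => /orP[/eqP|]; [left|right].
have lene0 : len e0 = l by rewrite /len eqxx.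
have totalE : total_length EDelta = \sum_(e in EDelta) len e.
  by apply: eq_bigr => e eE; rewrite /len neq0// eE.
have Uedge e : e \in e0 |: EDelta ->
    edge_solution f (fun t x => U t e x) (fun t x => dU t e x) (len e).
  move=> /inS1[->|eE].
    rewrite lene0; apply: (edge_solution_shorten lL); rewrite /U /dU eqxx.
    case: fwdP => [[-> fe]|[-> [_ fe]]]; first exact: (solution_edge usol fe).
    exact: (edge_solution_rev (solution_edge usol fe)).
  by have := solution_edge usol (farE e eE); rewrite /U /dU neq0.
have Urange t e x : e \in e0 |: EDelta -> 0 <= x <= len e -> 0 < U t e x < 1.
  move=> /inS1[->|eE].
    rewrite lene0 /U eqxx => /inL[xL xL'].
    by case: ifP => _; apply: urange; rewrite closed0.
  by rewrite /U neq0// => xl; apply: urange; rewrite closedE.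
have Usrc t e : e \in e0 |: EDelta -> U t e 0 = Y t (rsrc e).
  move=> /inS1[->|eE]; last first.
    by rewrite /Y /rsrc /U neq0// Vneq ?srcV// (valE t e 0).
  rewrite /Y /rsrc eqxx (negbTE qp) /U eqxx.
  case: fwdP => [[fw fe]|[fw [se fe]]]; rewrite fw.
    by rewrite (valE t e0 0)//; left; split => //; exact/eqP.
  by rewrite (valE t e0 L) ?subr0//; right.
have Utgt t e : e \in e0 |: EDelta -> U t e (len e) = Y t (rtgt e).
  move=> /inS1[->|eE]; first by rewrite lene0 /Y /rtgt !eqxx.
  by rewrite /Y /U neq0// Vneq ?tgtV// (valE t e (len e))//; exact: at_tgt.
have Ukir t w : w != p0 -> \sum_(e in e0 |: EDelta)
    (dU t e (len e) * (rtgt e == w)%:R - dU t e 0 * (rsrc e == w)%:R) = 0.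
  move=> wp; have [wV|wV] := boolP (w \in VDelta); last first.
    apply: big1 => e /inS1[->|eE].
      rewrite /rtgt /rsrc eqxx [p0 == w]eq_sym (negbTE wp).
      by rewrite (_ : q0 == w = false) ?mulr0 ?subrr//; apply: contraNF wV => /eqP <-.
    rewrite (_ : rtgt e == w = false); last by apply: contraNF wV => /eqP <-; exact: tgtV.
    rewrite /rsrc neq0// (_ : src e == w = false) ?mulr0 ?subrr//.
    by apply: contraNF wV => /eqP <-; exact: srcV.
  have := sol_kirchhoff usol t (finset.in_setT w); rewrite /outgoing_sum.
  rewrite (bigID (fun e => e \in e0 |: EDelta))/= [X in _ + X]big1 ?addr0; last first.
    move=> e; rewrite !inE/= => eN.
    have noinc x : ~ at_vertex e x w.
      move=> ew; have := Riso e w wV (ex_intro _ x ew).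
      by case=> [eE|ee]; move: eN; rewrite ?eE ?ee ?eqxx ?orbT.
    case: eqP => [se|_]; first by case: (noinc 0); left.
    case fe: (far e) => [[x z]|]; last by rewrite addr0.
    case: eqP => [zw|_]; last by rewrite addr0.
    by case: (noinc x); right; rewrite fe zw.
  move=> /(congr1 -%R); rewrite oppr0 -sumrN => K0; rewrite -[RHS]K0.
  apply: eq_big => [e|e /inS1[->|eE]]; first by rewrite finset.in_setT.
    rewrite /dU /rtgt /rsrc eqxx [p0 == w]eq_sym (negbTE wp) mulr0 add0r.
    case: fwdP => [[fw fe]|[fw [se fe]]]; rewrite fw fe.
      move/eqP: fw => ->; rewrite [p0 == w]eq_sym (negbTE wp) addr0 -/(du t e0 0).
      by case: (q0 == w); rewrite ?mulr1 ?mulr0.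
    rewrite se [p0 == w]eq_sym (negbTE wp) add0r subr0 -/(du t e0 L).
    by case: (q0 == w); rewrite ?mulr1 ?mulr0.
  rewrite /dU /rsrc neq0// farE// -/(du t e 0) -/(du t e (len e)).
  by case: (src e == w); case: (rtgt e == w); rewrite /=; ring.
have Udecay eps : 0 < eps -> exists T0, forall t e x, t <= T0 -> e \in e0 |: EDelta ->
    0 <= x <= len e -> U t e x <= eps.
  move=> eps0; have fo : far (outer i) = None by apply/outerP; exists i.
  have [T0 TP] := front_decay front fo eps0; exists T0 => t e x tT.
  have no e' l' w : far e' = Some (l', w) -> e' != outer i.
    by move=> fe; apply/eqP => ee; rewrite ee fo in fe.
  move=> /inS1[->|eE].
    rewrite lene0 /U eqxx => /inL[xL xL'].
    have e0o : e0 != outer i by case: fwdP => [[_ fe]|[_ [_ fe]]]; exact: no fe.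
    by case: ifP => _; apply: TP => //; rewrite closed0.
  rewrite /U neq0// => xl; apply: TP => //; first exact: (no _ _ _ (farE e eE)).
  by rewrite closedE.
have conn e e' : e \in EDelta -> e' \in EDelta ->
    connect (edge_adj rsrc rtgt EDelta) (rsrc e) (rsrc e').
  move=> eE e'E; rewrite /rsrc !neq0//.
  rewrite (@eq_connect _ _ (adj EDelta)); first exact: Rconn (srcV e eE) (srcV e' e'E).
  move=> w z; apply: eq_existsb => d; case: (boolP (d \in EDelta)) => //= dE.
  by rewrite farE// neq0.
have no_mode (k : R) (A B : edge Omega -> R) (y : vert Omega -> R) :
  0 < k -> \sum_(e in EDelta) (A e ^+ 2 + B e ^+ 2) = 1 ->
  (forall e, e \in EDelta -> A e = y (rsrc e)) ->
  (forall e, e \in EDelta -> A e * cos (k * len e) + B e * sin (k * len e) = y (rtgt e)) ->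
  (forall w, \sum_(e in EDelta)
     (k * (B e * cos (k * len e) - A e * sin (k * len e)) * (rtgt e == w)%:R
      - k * B e * (rsrc e == w)%:R) = 0) ->
  mu1 <= k ^+ 2.
  move=> k0 norm1 As At kir; apply: mu1min; first exact: exprn_gt0.
  apply: (mode_eigenvalue _ farE (fun e _ => len0 e) k0 norm1 _ At) => [e eE|w].
    by rewrite As// /rsrc neq0.
  by rewrite -[RHS](kir w); apply: eq_bigr => e eE; rewrite /rsrc neq0.
have poincare := fun mu => discrete_poincare len0 conn no_mode (mu := mu).
have Uc t e : e \in EDelta -> {within [set x : R | 0 <= x <= len e], continuous (U t e)}.
  move=> eE; have [gc _ _ _] := Uedge e (setU1r _ eE).
  apply: (@within_continuous_precomp _ _ _ [set x : R | 0 <= x <= len e]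
    ([set: R] `*` [set x : R | 0 <= x <= len e]) (fun x : R => (t, x)) (fun p : R * R => U p.1 e p.2) _ _ gc).
    exact: continuous_pair_left.
  by move=> x xl; split.
have delta01 : 0 < delta < 1 by rewrite delta0 (lt_trans deltaa).
have rsrc0 : rsrc e0 != p0 by rewrite /rsrc eqxx.
have rtgt0 : rtgt e0 = p0 by rewrite /rtgt eqxx.
have Sp e : e \in EDelta -> rsrc e != p0 /\ rtgt e != p0.
  move=> eE; split; first by rewrite /rsrc neq0// Vneq ?srcV.
  by rewrite Vneq ?tgtV.
rewrite totalE in narrow.
have narrow' : 1 / (2 * len e0) + len e0 * (primitive f 1 - primitive f a) <=
  sigma * \sum_(e in EDelta) len e by rewrite lene0.
have avg t := reservoir_average len0 e0E rtgt0 rsrc0 Sp Hf delta01 mule sigmaP poincare narrow'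
  Uedge Urange Usrc Utgt Ukir Udecay (Uc t).
have total0 : 0 < total_length EDelta.
  have [e [x [eE _ _]]] := eigen_neq0 eigu.
  by rewrite totalE (bigD1 e)//= ltr_pwDl// sumr_ge0// => d _; exact: ltW.
rewrite mulrAC mul1r ler_pdivrMr// totalE.
have intlim : (fun n : nat => \sum_(e in EDelta)
      \int[lebesgue_measure]_(x in [set x : R | 0 <= x <= len e]) U n%:R e x) @ \oo -->
    graph_integral EDelta v.
  rewrite /graph_integral; apply: cvg_big; first exact: add_continuous.
  move=> e eE; rewrite closedE//.
  apply: (@bounded_limit_integral R (fun n x => U n%:R e x)) => [n|n x xl|x xl]; first exact: Uc.
    have /andP[U0 U1] := Urange n%:R e x (setU1r _ eE) xl.
    by rewrite ger0_norm ltW.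
  have : (fun t : R => u t e x) @ +oo --> v e x by apply: lim; rewrite closedE.
  move=> /(cvg_comp (fun n : nat => n%:R : R) _ (@cvgr_idn R)).
  by rewrite /U neq0.
apply: (ler_cvg_to intlim (@cvg_cst _ (delta * \sum_(e in EDelta) len e : R) _ _ _)).
by apply: filterS filterT => n _ /=; exact: avg.
Qed.
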